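(* Let $n=n(d)$, $d\in\mathbb{N}$, be an arbitrary sequence of positive integers with $n(d)\to\infty$ as $d\to\infty$. Suppose that the random vectors $X^{(d)}$, $d\in\mathbb{N}$, satisfy conditions (a)–(d) listed in the context. (1) (Multiple sums.) Fix $m\in\mathbb{N}$. For each $d$, let $(X^{(d)}(\mathbf{k}))_{\mathbf{k}\in\mathbb{N}_0^m}$ be independent copies of $X^{(d)}$, put $S^{(d)}_{\mathbf{k}}=\sum_{\mathbf{0}\le\mathbf{i}\le\mathbf{k}}X^{(d)}(\mathbf{i})$ for $\mathbf{k}\in\mathbb{N}_0^m$, and let $\mathbb{M}_n^{(d)}=\{S^{(d)}_{\mathbf{k}}:\mathbf{k}\in\{0,1,\dots,n\}^m\}\subset\mathbb{R}^d$. Then, as $d\to\infty$, the random compact metric space $n^{-m/2}\mathbb{M}_n^{(d)}$ (with the Euclidean metric) converges in probability, with respect to the Gromov–Hausdorff metric, to the $m$-variate Wiener spiral $\mathbb{WS}_m$. (2) (Set-indexed sums.) Let $(\mathbb{X},\mathsf{F},\mu)$ be a probability space and let $\mathcal{M}\subset\mathsf{F}$ be a non-empty VC class. For each $d$, let $(X^{(d)}(j))_{j\in\mathbb{N}}$ be independent copies of $X^{(d)}$ and let $(U(j))_{j\in\mathbb{N}}$ be i.i.d. random elements of $\mathbb{X}$ with distribution $\mu$, independent of $(X^{(d)}(j))_{j\in\mathbb{N}}$. Put $S_n^{(d)}(A)=\sum_{j=1}^{n}X^{(d)}(j)\mathbf{1}_{\{U(j)\in A\}}$ for $A\in\mathsf{F}$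 and $\mathbb{M}_n^{(d)}(\mathcal{M})=\{S_n^{(d)}(A):A\in\mathcal{M}\}\subset\mathbb{R}^d$. Then, as $d\to\infty$, the random metric space $n^{-1/2}\mathbb{M}_n^{(d)}(\mathcal{M})$ (with the Euclidean metric) converges in probability, with respect to the Gromov–Hausdorff metric, to the Wiener spiral on $\mathcal{M}$ with governing measure $\mu$.
   Context: $\mathbb{N}_0=\mathbb{N}\cup\{0\}$; inequalities between multi-indices are componentwise. For each $d\in\mathbb{N}$, $X^{(d)}=(X^{(d)}_1,\dots,X^{(d)}_d)$ is a random vector in $\mathbb{R}^d$; $\|\cdot\|_2$ is the Euclidean norm. Conditions: (a) $\mathbb{E}X^{(d)}=0$ and $\mathbb{E}\|X^{(d)}\|_2^2=1$ for all $d$; (b) $\mathbb{E}[X^{(d)}_aX^{(d)}_{a'}]=0$ for all $d$ and all $a\ne a'$ in $\{1,\dots,d\}$; (c) $(\|X^{(d)}\|_2^2)_{d\in\mathbb{N}}$ is uniformly integrable: $\lim_{c\to\infty}\sup_{d\in\mathbb{N}}\mathbb{E}[\|X^{(d)}\|_2^2\mathbf{1}_{\{\|X^{(d)}\|_2^2>c\}}]=0$; (d) $\lim_{d\to\infty}\max_{a\in\{1,\dots,d\}}\mathbb{E}(X_a^{(d)})^2=0$. Wiener spirals: for a probability space $(\mathbb{X},\mathsf{F},\mu)$ put $\rho_\mu(A,B)=\mu(A\triangle B)^{1/2}$, $A,B\in\mathsf{F}$; this is a pseudometric, and a metric after identifying sets that differ by a $\mu$-null set. For a non-empty $\mathcal{A}\subset\mathsf{F}$,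 a Wiener spiral on $\mathcal{A}$ with governing measure $\mu$ is any metric space isometric to $(\mathcal{A},\rho_\mu)$ (with this identification). The $m$-variate Wiener spiral $\mathbb{WS}_m$ is the case $\mathbb{X}=[0,1]^m$ with its Borel $\sigma$-algebra, $\mu$ the Lebesgue measure, and $\mathcal{A}=\{[0,t_1]\times\cdots\times[0,t_m]:t_1,\dots,t_m\in[0,1]\}$. VC class: a family $\mathcal{M}$ of subsets of $\mathbb{X}$ shatters a finite set $I\subset\mathbb{X}$ if every subset $J\subset I$ is of the form $I\cap A$ with $A\in\mathcal{M}$. $\mathcal{M}$ is a VC class if there is $n\in\mathbb{N}$ such that no subset of $\mathbb{X}$ of size $n+1$ is shattered by $\mathcal{M}$. The Gromov–Hausdorff distance between two metric spaces is the infimum of the Hausdorff distances between their images under isometric maps into an arbitrary common metric space. Convergence in probability means that the Gromov–Hausdorff distance to the limit space tends to $0$ in probability. For $c>0$, $c\,\mathbb{M}=\{cx:x\in\mathbb{M}\}$.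
   Formalization: Part (2) adds that, for every n, the set of samples on which some member of the class picks out exactly a given subset of the n points is measurable for the completion of μ^n; without it the claim fails (initial segments of ω₁, countable/co-countable measure). *)

(* Defs.v *)
From HB Require Import structures.
From mathcomp Require Import all_boot all_order all_algebra.
From mathcomp Require Import all_classical all_reals all_analysis.

Set Implicit Arguments.
Unset Strict Implicit.
Unset Printing Implicit Defensive.

Import Order.TTheory GRing.Theory Num.Theory.
Import numFieldNormedType.Exports.

Local Open Scope classical_set_scope.
Local Open Scope ring_scope.

(* Random vectors of R^d are random elements of [d.-tuple R], whose library
   sigma-algebra is the product Borel one; [vec] moves to ['rV[R]_d] for the
   linear structure. The library norm of ['rV[R]_d] is the sup norm, so the
   Euclidean one is defined here. *)
Definition vec (R : realType) (d : nat) (x : d.-tuple R) : 'rV[R]_d :=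
  \row_(a < d) tnth x a.

Definition eucl_norm (R : realType) (d : nat) (v : 'rV[R]_d) : R :=
  Num.sqrt (\sum_(a < d) v ord0 a ^+ 2).

Definition eucl_dist (R : realType) (d : nat) (u v : 'rV[R]_d) : R := eucl_norm (u - v).

Definition scale_set (R : realType) (d : nat) (c : R) (A : set 'rV[R]_d) :
  set 'rV[R]_d := [set c *: x | x in A].

Section metric.
Local Open Scope ereal_scope.
Context {R : realType}.

Definition hausdorff_dist (Z : metricType R) (A B : set Z) : \bar R :=
  maxe (ereal_sup [set ereal_inf [set (mdist x y)%:E | y in B] | x in A])
       (ereal_sup [set ereal_inf [set (mdist x y)%:E | x in A] | y in B]).

(* A metric space is presented as a subset [A] of a type together with a
   distance [rho], of which only the values on [A] matter. *)
Definition isometric_on (T : Type) (A : set T) (rho : T -> T -> R)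
    (Z : metricType R) (f : T -> Z) : Prop :=
  forall x y, A x -> A y -> mdist (f x) (f y) = rho x y.

(* [\bar R]-valued, so that an empty family of embeddings would give +oo. *)
Definition GH_dist (T1 T2 : Type) (A1 : set T1) (rho1 : T1 -> T1 -> R)
    (A2 : set T2) (rho2 : T2 -> T2 -> R) : \bar R :=
  ereal_inf [set r | exists (Z : metricType R) (f1 : T1 -> Z) (f2 : T2 -> Z),
    [/\ isometric_on A1 rho1 f1, isometric_on A2 rho2 f2 &
        r = hausdorff_dist (f1 @` A1) (f2 @` A2)]].

End metric.

Section wiener_spiral.
Context {d : measure_display} {T : measurableType d} {R : realType}.

Definition spiral_dist (mu : probability T R) (A B : set T) : R :=
  Num.sqrt (fine (mu (A `+` B))).

(* [W] is isometric to [(AA, spiral_dist mu)] after the identification of sets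
   at distance 0: [iota] need not be injective on [AA], but [mdist] separates
   the points of [W]. *)
Definition is_wiener_spiral (mu : probability T R) (AA : set (set T))
    (W : metricType R) : Prop :=
  exists iota : set T -> W,
    iota @` AA = [set: W] /\ isometric_on AA (spiral_dist mu) iota.

End wiener_spiral.

Section wiener_spiral_exists.
Context {R : realType}.

Lemma metric_identification (T : Type) (A : set T) (rho : T -> T -> R) :
    A !=set0 ->
    (forall x, A x -> rho x x = 0) ->
    (forall x y, A x -> A y -> rho x y = rho y x) ->
    (forall y x z, A x -> A y -> A z -> rho x z <= rho x y + rho y z) ->
  exists (W : metricType R) (iota : T -> W),
    iota @` A = [set: W] /\ isometric_on A rho iota.
Proof.
move=> [x0 Ax0] rxx rsym rtri.
pose cls x : set T := [set y | A y /\ rho x y = 0].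
pose S := set_type [set c : set T | exists2 x, A x & c = cls x].
have rho_ge0 x y : A x -> A y -> 0 <= rho x y.
  move=> Ax Ay; rewrite -(@pmulrn_lge0 _ _ 2)// -(rxx _ Ax) mulr2n.
  by rewrite {2}(rsym _ _ Ax Ay); exact: rtri.
have repP (c : S) : {x | A x & val c = cls x}.
  by apply: cid2; case: c => c /= /set_mem.
pose rep (c : S) : T := s2val (repP c).
have Arep c : A (rep c) by exact: s2valP (repP c).
have valrep c : val c = cls (rep c) by exact: s2valP' (repP c).
have cls_eq x y : A x -> A y -> rho x y = 0 -> cls x = cls y.
  move=> Ax Ay xy0; apply/seteqP; split => z /= [Az z0]; split => //.
  - apply/eqP; rewrite eq_le rho_ge0// andbT (le_trans (rtri x _ _ _ _ _))//.
    by rewrite z0 addr0 rsym// xy0.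
  - apply/eqP; rewrite eq_le rho_ge0// andbT (le_trans (rtri y _ _ _ _ _))//.
    by rewrite z0 addr0 xy0.
pose dist (c c' : S) : R := rho (rep c) (rep c').
have dxx c : dist c c = 0 by exact: rxx.
have dpos c c' : dist c c' = 0 -> c = c'.
  by move=> d0; apply: val_inj; rewrite !valrep; exact: cls_eq.
have dsym c c' : dist c c' = dist c' c by exact: rsym.
have dtri b a c : dist a c <= dist a b + dist b c by exact: rtri.
pose W : metricType R := HB.pack S (isMetric.Build R S dxx dpos dsym dtri).
have clsS x : A x -> cls x \in [set c : set T | exists2 x, A x & c = cls x].
  by move=> Ax; apply/mem_set; exists x.
pose iota (x : T) : W :=
  if pselect (A x) is left Ax then exist _ (cls x) (clsS _ Ax)
  else exist _ (cls x0) (clsS _ Ax0).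
have rep_iota x : A x -> rho x (rep (iota x)) = 0.
  move=> Ax; have : val (iota x : S) = cls x.
    by rewrite /iota; case: pselect.
  rewrite valrep => e.
  have : cls x (rep (iota x)) by rewrite -e; split => //; exact: rxx.
  by case.
exists W, iota; split.
  apply/seteqP; split => // c _; exists (rep c) => //.
  by apply/esym/dpos; rewrite /dist rep_iota.
move=> x y Ax Ay; rewrite [LHS](_ : _ = dist (iota x) (iota y))//.
have rx := rep_iota _ Ax; have ry := rep_iota _ Ay.
rewrite /dist; apply/eqP; rewrite eq_le; apply/andP; split.
  rewrite (le_trans (rtri x _ _ _ _ _))// (rsym _ x)// rx add0r.
  by rewrite (le_trans (rtri y _ _ _ _ _))// ry addr0.
rewrite (le_trans (rtri (rep (iota x)) _ _ _ _ _))// rx add0r.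
by rewrite (le_trans (rtri (rep (iota y)) _ _ _ _ _))// (rsym _ y)// ry addr0.
Qed.

(* Wiener spirals exist, so a statement about all of them is not vacuous. *)
Lemma wiener_spiral_exists (d : measure_display) (T : measurableType d)
    (mu : probability T R) (AA : set (set T)) :
  AA !=set0 -> AA `<=` measurable ->
  exists W : metricType R, is_wiener_spiral mu AA W.
Proof.
move=> AA0 mAA.
have mY A B : AA A -> AA B -> measurable (A `+` B).
  by move=> /mAA mA /mAA mB; apply: measurableU; exact: measurableD.
apply: (metric_identification AA0) => [A _|A B _ _|B A C AAA AAB AAC].
- by rewrite /spiral_dist setYK measure0 sqrtr0.
- by rewrite /spiral_dist setYC.
rewrite -(@ler_pXn2r _ 2) ?nnegrE ?sqrtr_ge0 ?addr_ge0 ?sqrtr_ge0//.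
rewrite sqrrD /spiral_dist !sqr_sqrtr ?fine_ge0//.
apply: (@le_trans _ _ (fine (mu (A `+` B)) + fine (mu (B `+` C)))).
  have fY A' B' : AA A' -> AA B' -> mu (A' `+` B') \is a fin_num.
    by move=> AA' AB'; apply: fin_num_measure; exact: mY.
  rewrite -fineD ?fY//; apply: fine_le; rewrite ?fin_numD ?fY//.
  apply: le_trans (measureU2 _ _ _); try exact: mY.
  apply: le_measure; rewrite ?inE; try exact: mY.
    by apply: measurableU; exact: mY.
  move=> x /=.
  by case: (pselect (B x)); tauto.
by rewrite addrAC lerDl mulrn_wge0// mulr_ge0// sqrtr_ge0.
Qed.
End wiener_spiral_exists.

Section power_probability.
Context {d : measure_display} {T : measurableType d} {R : realType}.

Definition tcons (n : nat) (x : T * n.-tuple T) : n.+1.-tuple T :=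
  [tuple of x.1 :: x.2].

Lemma measurable_tcons n : measurable_fun [set: T * n.-tuple T] (@tcons n).
Proof. exact: (measurable_cons measurable_fst measurable_snd). Qed.

HB.instance Definition _ n :=
  isMeasurableFun.Build _ _ _ _ (@tcons n) (@measurable_tcons n).

Fixpoint power_prob (mu : probability T R) (n : nat) :
    probability (n.-tuple T) R :=
  match n with
  | 0 => dirac ([tuple] : 0.-tuple T)
  | n'.+1 => distribution (mu \x power_prob mu n')%E (@tcons n')
  end.

End power_probability.

Section multivariate_wiener_spiral.
Context {R : realType}.

(* [0,1]^m is viewed inside R^m, which carries the m-fold product of the
   Lebesgue measure on [0,1] extended by 0. *)
Definition lebesgue_cube (m : nat) :
    probability (m.-tuple (measurableTypeR R)) R :=
  power_prob (uniform_prob (@ltr01 R)) m.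

Definition corner_boxes (m : nat) : set (set (m.-tuple (measurableTypeR R))) :=
  [set [set x | forall l, 0 <= tnth x l <= tnth t l]
      | t in [set t : m.-tuple R | forall l, 0 <= tnth t l <= 1]].

End multivariate_wiener_spiral.
Arguments lebesgue_cube : clear implicits.
Arguments corner_boxes : clear implicits.

Section VC_class.
Context {d : measure_display} {T : measurableType d} {R : realType}.

Definition shatters (M : set (set T)) (I : set T) : Prop :=
  forall J : set T, J `<=` I -> exists2 A, M A & I `&` A = J.

Definition VC_class (M : set (set T)) : Prop :=
  exists2 n : nat, (0 < n)%N &
    forall I : set T, (I #= `I_n.+1)%card -> ~ shatters M I.

(* The family of traces of [M] on an n-point sample, as a random subset of the
   power set of {0, .., n-1}, is measurable for the completion of [mu]^n.
   This is the measurability that makes the set-indexed sums over [M] a random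
   metric space determined by the sample; it is automatic for countable [M].
   The uniform law of large numbers for VC classes fails without it: let [T] be
   the ordinal omega_1 with the countable-cocountable sigma-algebra, [mu] be 0
   on countable sets and 1 on the others, and [M] be the initial segments
   {x | x <= a}, which shatter no pair. All members of [M] are [mu]-null, yet
   any finite sample is contained in one of them. *)
Definition traces_measurable (mu : probability T R) (M : set (set T)) : Prop :=
  forall (n : nat) (J : {set 'I_n}),
    let E := [set x : n.-tuple T |
               exists2 A, M A & forall j, A (tnth x j) <-> j \in J] in
    exists2 B : set (n.-tuple T), measurable B &
      (power_prob mu n).-negligible (E `+` B).

End VC_class.

Section random_elements.
Local Open Scope ereal_scope.
Context {dO : measure_display} {O : measurableType dO} {R : realType}.
Variable P : probability O R.

Definition mutually_independent (dT : measure_display) (T : measurableType dT)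
    (I : eqType) (X : I -> {RV P >-> T}) : Prop :=
  forall (s : seq I) (B : I -> set T), uniq s ->
    (forall i, measurable (B i)) ->
    P (\bigcap_(i in [set` s]) (X i @^-1` B i)) =
    \prod_(i <- s) P (X i @^-1` B i).

Definition iid (dT : measure_display) (T : measurableType dT)
    (nu : probability T R) (I : eqType) (X : I -> {RV P >-> T}) : Prop :=
  (forall i B, measurable B -> distribution P (X i) B = nu B) /\
  mutually_independent X.

Definition sigma_of (dT : measure_display) (T : measurableType dT)
    (I : Type) (X : I -> {RV P >-> T}) : set (set O) :=
  <<s \bigcup_i preimage_set_system [set: O] (X i) measurable >>.

Definition independent_families (dT dT' : measure_display)
    (T : measurableType dT) (T' : measurableType dT') (I I' : Type)
    (X : I -> {RV P >-> T}) (Y : I' -> {RV P >-> T'}) : Prop :=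
  forall E F, sigma_of X E -> sigma_of Y F -> P (E `&` F) = P E * P F.

End random_elements.

(* Outer probability: it agrees with [P d] on events, and does not presuppose
   that [D d] is measurable. *)
Definition cvg0_in_prob (R : realType) (dO : nat -> measure_display)
    (O : forall d, measurableType (dO d)) (P : forall d, probability (O d) R)
    (D : forall d, O d -> \bar R) : Prop :=
  forall eps : R, 0 < eps ->
    ((P d)^*)%mu [set w | (eps%:E < D d w)%E] @[d --> \oo] --> 0%E.

Section sums.
Context {R : realType} {d : nat}.

Definition multiple_sum (m : nat) (X : {ffun 'I_m -> nat} -> d.-tuple R)
    (k : {ffun 'I_m -> nat}) : 'rV[R]_d :=
  \sum_(i \in [set i : {ffun 'I_m -> nat} | forall l, (i l <= k l)%N])
    vec (X i).

Definition multiple_sum_set (m n : nat)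
    (X : {ffun 'I_m -> nat} -> d.-tuple R) : set 'rV[R]_d :=
  [set multiple_sum X k | k in [set k : {ffun 'I_m -> nat} | forall l, (k l <= n)%N]].

Definition set_indexed_sum (T : Type) (n : nat) (X : nat -> d.-tuple R)
    (U : nat -> T) (A : set T) : 'rV[R]_d :=
  \sum_(j < n) (\1_A (U j) : R) *: vec (X j).

Definition set_indexed_sum_set (T : Type) (n : nat) (X : nat -> d.-tuple R)
    (U : nat -> T) (M : set (set T)) : set 'rV[R]_d :=
  [set set_indexed_sum n X U A | A in M].

End sums.

(* Main.v *)
Require Import Defs.
From HB Require Import structures.
From mathcomp Require Import all_boot all_order all_algebra.
From mathcomp Require Import all_classical all_reals all_analysis.
From mathcomp Require Import measurable_realfun ring lra zify.

Import Order.TTheory GRing.Theory Num.Theory.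
Import numFieldNormedType.Exports.

Set Implicit Arguments.
Unset Strict Implicit.
Unset Printing Implicit Defensive.

(** Write S_I for the sum of the steps with index in I. The theorem rests on one
    statement about deterministic families of index sets, [uniform_isometry]:
    over a family of subsets of {1, .., N} of bounded VC dimension, the largest
    value of | ‖S_I - S_J‖ - |I Δ J|^(1/2) | is, with probability close to 1,
    small compared with N^(1/2) once N and the dimension are large. Both parts
    of the theorem follow by choosing the family. For multiple sums these are
    the grid points of boxes, counted by [grid_box_symdiff]. For set-indexed
    sums these are the traces of the class on the sample of indices: they take
    finitely many values, are independent of the steps, so that one may argue
    value by value, and their normalized sizes are controlled by the uniform
    law of large numbers [vc_uniform_lln]. Two spaces with a common
    parametrization and nearly equal distances are close in the
    Gromov-Hausdorff sense, by gluing ([GH_dist_le_distortion]).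

    For a fixed pair, ‖S_I - S_J‖^2 is a diagonal part, to which a truncation
    and uniform integrability apply, plus the cross part of the scalar products
    of distinct steps. Adding a step X to a sum s changes the cross part by
    2 <X, s>, which is centred, of second moment at most v ‖s‖^2 when the
    coordinates are uncorrelated with variances at most v ([mean_dot_sqr]).
    So the cross part has second moment at most 4 v N^2, and v tends to 0.

    Uniformity over the family cannot come from a union bound, which would lose
    a power of log N while N is arbitrary with respect to the dimension. The
    family has a net in the counting distance whose size depends on the scale
    only ([vc_net]), and it remains to bound the mean of the largest ‖S_I - S_J‖
    over pairs at small counting distance ([mean_modulus]). Multiplying the
    steps by signs at most halves such a mean ([mean_max_norm_sign]); for fixed
    steps and random signs, Khintchine moments of high order and chaining
    ([chaining]) give a bound in terms of the weights ‖X_i‖^2, hence one that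
    requires second moments of the steps only. The nets of the chaining are
    relative to these weights; truncation compares them with counting.

    The uniform law of large numbers for the sample of indices comes from a
    ghost sample, random swaps and the polynomial number of traces. The traces
    being measurable up to a null set, the exceptional samples can be enclosed
    in measurable sets. *)

(** * Families of sets of bounded VC dimension *)

Section finite_families.
Local Open Scope nat_scope.

Definition shattered (I : finType) (F : {set {set I}}) (K : {set I}) : bool :=
  [forall J : {set I}, (J \subset K) ==> [exists A in F, (K :&: A)%SET == J]].

Definition VC_at_most (I : finType) (V : nat) (F : {set {set I}}) : Prop :=
  forall K, shattered F K -> #|K| <= V.

Lemma shatteredP (I : finType) (F : {set {set I}}) (K : {set I}) :
  reflect (forall J : {set I}, J \subset K ->
             exists2 A, A \in F & (K :&: A)%SET = J)
          (shattered F K).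
Proof.
apply: (iffP forallP) => [h J JK | h J].
  by have /implyP/(_ JK)/exists_inP[A AF /eqP AJ] := h J; exists A.
by apply/implyP => JK; apply/exists_inP; have [A AF AJ] := h _ JK; exists A => //; apply/eqP.
Qed.

(** Pajor's form of the Sauer lemma. Split the family by a point x: a set
    shattered by both halves counts twice, for itself and with x added. *)
Lemma pajor (I : finType) (F : {set {set I}}) :
  #|F| <= #|[set K | shattered F K]|.
Proof.
move: {2}#|F| (leqnn #|F|) => n; elim: n F => [|n IH] F; first by rewrite leqn0 => /eqP->.
move=> Fn; have [F1|] := leqP #|F| 1.
  case: (set_0Vmem F) => [->|[A AF]]; first by rewrite cards0.
  apply: (leq_trans F1); rewrite card_gt0; apply/set0Pn; exists finset.set0.
  by rewrite inE; apply/shatteredP => J; rewrite finset.subset0 => /eqP->; exists A => //; rewrite finset.set0I.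
move=> /card_gt1P[A [B [AF BF AB]]].
(* split along a point on which two members of F differ *)
have [x xAB] : exists x, (x \in A) != (x \in B).
  by apply/existsP; apply: contra_neqT AB; rewrite negb_exists => /forallP h; apply/setP => x;
     apply/eqP; have := h x; rewrite negbK.
pose F1 := [set C in F | x \in C]; pose F0 := [set C in F | x \notin C].
have cF : #|F| = #|F1| + #|F0|.
  rewrite -(cardsID [set C : {set I} | x \in C] F); congr (_ + _); apply: eq_card => C.
    by rewrite !inE.
  by rewrite !inE andbC.
have [F1gt F0gt] : 0 < #|F1| /\ 0 < #|F0|.
  by split; apply/card_gt0P; move: xAB; case xA: (x \in A); case xB: (x \in B) => // _;
     [exists A|exists B|exists B|exists A]; rewrite inE ?AF ?BF ?xA ?xB.
have F1n : #|F1| <= n by lia.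
have F0n : #|F0| <= n by lia.
rewrite cF (leq_trans (leq_add (IH _ F1n) (IH _ F0n)))//.
set S1 := [set K | shattered F1 K]; set S0 := [set K | shattered F0 K].
have xS1 K : K \in S1 -> x \notin K.
  rewrite inE => /shatteredP/(_ finset.set0 (finset.sub0set _))[C]; rewrite inE => /andP[_ xC] /setP/(_ x).
  by rewrite !inE xC andbT => ->.
have xS0 K : K \in S0 -> x \notin K.
  rewrite inE => /shatteredP/(_ K (subxx _))[C]; rewrite inE => /andP[_ xC] /setP/(_ x).
  by rewrite !inE (negPf xC) andbF => <-.
rewrite -cardsUI.
have inj : {in S1 :&: S0 &, injective (fun K => x |: K)%SET}.
  move=> K L; rewrite !inE => /andP[KS _] /andP[LS _] /setP e; apply/setP => y.
  have := e y; rewrite !inE; case: (eqVneq y x) => [->|//] _.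
  by rewrite (negPf (xS1 K _)) ?inE// (negPf (xS1 L _)) ?inE.
rewrite -(card_in_imset inj) -cardsUI [X in _ + X](_ : _ = 0) ?addn0.
  apply: subset_leq_card; apply/fintype.subsetP => K; rewrite !inE -orbA => /or3P[|/[dup] h|].
  - by move=> /shatteredP h; apply/shatteredP => J /h[C]; rewrite inE => /andP[CF _] <-; exists C.
  - by move=> /shatteredP h'; apply/shatteredP => J /h'[C]; rewrite inE => /andP[CF _] <-; exists C.
  move=> /imsetP[L]; rewrite !inE => /andP[/[dup] L1 /shatteredP h1 /shatteredP h0] ->.
  have xL : x \notin L by apply: xS1; rewrite inE.
  apply/shatteredP => J JL.
  have J'L : (J :\ x)%SET \subset L.
    apply/fintype.subsetP => y; rewrite !inE => /andP[yx yJ].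
    by have := fintype.subsetP JL y yJ; rewrite !inE (negPf yx).
  have [xJ|xJ] := boolP (x \in J).
    have [C] := h1 _ J'L; rewrite inE => /andP[CF xC] /setP e; exists C => //.
    apply/setP => y; have := e y; rewrite !inE; case: (eqVneq y x) => [->|_] //=.
    by rewrite xC xJ.
  have [C] := h0 _ J'L; rewrite inE => /andP[CF xC] /setP e; exists C => //.
  apply/setP => y; have := e y; rewrite !inE; case: (eqVneq y x) => [->|_] //=.
  by rewrite (negPf xC) (negPf xJ).
apply/eqP; rewrite cards_eq0; apply/eqP/setP => K; rewrite !inE.
apply/negbTE/negP => /andP[/orP KS /imsetP[L _ KL]].
have : x \in K by rewrite KL !inE eqxx.
by case: KS => KS; apply/negP; [apply: xS1|apply: xS0]; rewrite inE.
Qed.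

Lemma sum_bin_le (k V : nat) : \sum_(i < V.+1) 'C(k, i) <= k.+1 ^ V.
Proof.
rewrite -[k.+1]add1n expnDn; apply: leq_sum => i _.
rewrite exp1n mul1n.
have iV : i <= V by rewrite -ltnS.
apply: (@leq_trans (k ^ i)).
  rewrite (leq_trans (leq_pmulr _ (fact_gt0 i)))// bin_ffact.
  elim: (nat_of_ord i) => [|j IH]; first by rewrite ffactn0.
  by rewrite ffactnSr expnSr leq_mul// leq_subr.
by rewrite leq_pmull// bin_gt0.
Qed.

(** A set shattered by the traces on Y is a subset of Y shattered by the family,
    hence of size at most V. *)
Lemma sauer_trace (I : finType) (V : nat) (F : {set {set I}}) (Y : {set I}) :
  VC_at_most V F -> #|[set (Y :&: A)%SET | A in F]| <= #|Y|.+1 ^ V.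
Proof.
move=> FV; apply: (leq_trans (pajor _)); apply: (leq_trans _ (sum_bin_le _ _)).
set G := [set _ | _ in F].
have sub : [set K | shattered G K] \subset
    (\bigcup_(i < V.+1) [set K : {set I} | K \subset Y & #|K| == i])%SET.
  apply/fintype.subsetP => K; rewrite inE => /shatteredP h.
  have KY : K \subset Y.
    have [C /imsetP[A _ ->] <-] := h _ (subxx K).
    exact: fintype.subset_trans (finset.subsetIr _ _) (finset.subsetIl _ _).
  have KV : #|K| < V.+1.
    rewrite ltnS; apply: FV; apply/shatteredP => J /h[C /imsetP[A AF ->]] <-.
    by exists A => //; rewrite finset.setIA (finset.setIidPl KY).
  by apply/bigcupP; exists (Ordinal KV) => //; rewrite inE KY/=.
apply: (leq_trans (subset_leq_card sub)).
elim/big_ind2 : _ => [|A a B b Aa Bb|i _]; first by rewrite cards0.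
  by apply: (leq_trans (leq_card_setU _ _)); exact: leq_add.
by rewrite cards_draws.
Qed.

End finite_families.

Local Open Scope ring_scope.

(** * Nets for weighted symmetric differences *)

Definition wdist (R : realType) (I : finType) (w : I -> R) (A B : {set I}) : R :=
  \sum_(i | (i \in A) != (i \in B)) w i.

Lemma wdist_ge0 (R : realType) (I : finType) (w : I -> R) (A B : {set I}) :
  (forall i, 0 <= w i) -> 0 <= wdist w A B.
Proof. by move=> w0; apply: sumr_ge0. Qed.

Lemma wdistxx (R : realType) (I : finType) (w : I -> R) (A : {set I}) :
  wdist w A A = 0.
Proof. by rewrite /wdist big1// => i; rewrite eqxx. Qed.

Lemma wdistC (R : realType) (I : finType) (w : I -> R) (A B : {set I}) :
  wdist w A B = wdist w B A.
Proof. by apply: eq_bigl => i; rewrite eq_sym. Qed.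

Lemma wdist_triangle (R : realType) (I : finType) (w : I -> R) (B A C : {set I}) :
  (forall i, 0 <= w i) -> wdist w A C <= wdist w A B + wdist w B C.
Proof.
move=> w0; rewrite /wdist [leLHS]big_mkcond [X in _ <= X + _]big_mkcond.
rewrite [X in _ <= _ + X]big_mkcond -big_split; apply: ler_sum => i _ /=.
by case: (i \in A) (i \in B) (i \in C) => [] [] [] /=; rewrite ?addr0 ?add0r ?lerDl ?addr_ge0.
Qed.

Lemma wdist_le (R : realType) (I : finType) (w : I -> R) (A B : {set I}) :
  (forall i, 0 <= w i) -> wdist w A B <= \sum_i w i.
Proof.
move=> w0; rewrite /wdist [leLHS]big_mkcond; apply: ler_sum => i _.
by case: ifP.
Qed.

(** The symmetric difference of a separated pair carries a proportion h of the
    weight, so some point lies in at least a proportion h of the symmetric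
    differences of the pairs not yet told apart by Y; add it to Y. This replaces
    Dudley's choice of a random Y. *)
Lemma greedy_hitting (R : realType) (I : finType) (w : I -> R) (W h : R)
    (F : {set {set I}}) (s : nat) :
    (forall i, 0 <= w i) -> \sum_i w i <= W -> 0 <= h <= 1 ->
    {in F &, forall A B, A != B -> h * W < wdist w A B} ->
  exists2 Y : {set I}, (#|Y| <= s)%N &
    #|[set p : {set I} * {set I} | [&& p.1 \in F, p.2 \in F, p.1 != p.2 &
         (Y :&: p.1)%SET == (Y :&: p.2)%SET]]|%:R <= (1 - h) ^+ s * #|F|%:R ^+ 2.
Proof.
move=> w0 wW /andP[h0 h1] sep; elim: s => [|s [Y Ys IH]].
  exists finset.set0; first by rewrite cards0.
  rewrite expr0 mul1r -natrX ler_nat -mulnn -cardsX subset_leq_card//.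
  by apply/fintype.subsetP => -[A B]; rewrite !inE /= => /and4P[-> ->].
set P := [set p | _]%SET in IH.
have ub0 : 0 <= (1 - h) ^+ s * #|F|%:R ^+ 2 by rewrite mulr_ge0// exprn_ge0// subr_ge0.
pose H j := [set p in P | (j \in p.1) != (j \in p.2)]%SET.
have [P0|/set0Pn Pne] := eqVneq P finset.set0.
  exists Y; first by rewrite (leq_trans Ys).
  by rewrite -/P P0 cards0 exprS -mulrA mulr_ge0// subr_ge0.
(* a point hit by an average-or-better fraction of the remaining pairs *)
have [j hj] : exists j, h * #|P|%:R <= #|H j|%:R.
  apply/existsP; apply: contraT; rewrite negb_exists => /forallP nh.
  have : \sum_(p in P) wdist w p.1 p.2 <= h * W * #|P|%:R.
    rewrite [leLHS](_ : _ = \sum_j w j * #|H j|%:R); last first.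
      rewrite /wdist (exchange_big_dep xpredT)//=; apply: eq_bigr => j _.
      rewrite sumr_const mulr_natr; congr (_ *+ _).
      by apply: eq_card => p; rewrite [in RHS]inE.
    apply: (@le_trans _ _ (\sum_j w j * (h * #|P|%:R))).
      by apply: ler_sum => j _; rewrite ler_wpM2l// ltW// ltNge nh.
    by rewrite -mulr_suml mulrA [h * W]mulrC !ler_wpM2r.
  rewrite leNgt => /negP[]; rewrite mulr_natr -sumr_const; apply: ltr_sum.
    by case: Pne => p pP; apply/hasP; exists p => //; rewrite mem_index_enum.
  by move=> -[A B]; rewrite inE /= => /and4P[AF BF AB _]; exact: sep.
exists (j |: Y)%SET; first by rewrite (leq_trans (leq_card_setU _ _))// cards1.
rewrite exprS -mulrA.
apply: (@le_trans _ _ ((1 - h) * #|P|%:R)); last by rewrite ler_wpM2l// subr_ge0.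
have HP : H j \subset P by apply/fintype.subsetP => p; rewrite inE => /andP[].
rewrite mulrBl mul1r lerBrDr (le_trans (lerD (lexx _) hj))// -natrD ler_nat.
rewrite -[leqRHS](cardsID (H j)) addnC leq_add ?(finset.setIidPr HP)//.
apply: subset_leq_card; apply/fintype.subsetP => -[A B]; rewrite !inE /=.
move=> /and4P[-> -> -> /eqP/finset.setP e] /=.
have -> /= : (Y :&: A == Y :&: B)%SET.
  apply/eqP/finset.setP => x; have := e x; rewrite !inE.
  by case: (x \in Y) => //=; rewrite ?orbT.
by have := e j; rewrite !inE eqxx /= => ->; rewrite eqxx.
Qed.

Lemma card_trace_hit (I : finType) (F : {set {set I}}) (Y : {set I}) :
  #|[set p : {set I} * {set I} | [&& p.1 \in F, p.2 \in F, p.1 != p.2 &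
         (Y :&: p.1)%SET == (Y :&: p.2)%SET]]| = 0%N ->
  #|[set (Y :&: A)%SET | A in F]%SET| = #|F|.
Proof.
move=> /eqP; rewrite cards_eq0 => /eqP/finset.setP e.
apply: card_in_imset => A B AF BF /eqP AB; apply/eqP.
by have := e (A, B); rewrite !inE /= AF BF AB andbT /= => /negbFE.
Qed.

(** Arithmetic of the entropy bound: [greedy_hitting] run for
    16 ^ k (2 b k + 1) steps separates a family of size 2 ^ (b k) at scale
    16 ^ - k, which the Sauer bound forbids for this b. *)
Lemma dudley_exponent (V : nat) : exists b : nat, (0 < b)%N /\
  forall k, (0 < k)%N -> ((16 ^ k * (2 * b * k).+1).+1 ^ V < 2 ^ (b * k))%N.
Proof.
exists (2 ^ (V + 7) - 1)%N.
have e7 : (2 ^ (V + 7) = 128 * 2 ^ V)%N by rewrite expnD mulnC.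
have V2 : (V < 2 ^ V)%N by exact: ltn_expl.
have VV : (V * (V + 13) < 2 ^ (V + 7) - 1)%N.
  have : (V * V < 4 * 2 ^ V)%N.
    elim: (V) => // n IH; rewrite expnS.
    have : (n < 2 ^ n)%N by exact: ltn_expl.
    nia.
  by rewrite e7; lia.
split=> [|k k0]; first lia.
set b := (_ - _)%N in VV *.
have bE : (b.+1 = 2 ^ (V + 7))%N by rewrite /b; lia.
have k2 : (k < 2 ^ k)%N by exact: ltn_expl.
apply: (@leq_ltn_trans ((2 ^ ((V + 13) * k)) ^ V)).
  have mono x y : (x <= y)%N -> (x ^ V <= y ^ V)%N.
    by move=> xy; elim: (V) => // n IH; rewrite !expnS leq_mul.
  apply: mono.
  have -> : (2 ^ ((V + 13) * k) = 2 ^ (4 * k) * (2 ^ k * 2 ^ ((V + 8) * k)))%N.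
    by rewrite -!expnD; congr (_ ^ _)%N; lia.
  have -> : (16 ^ k = 2 ^ (4 * k))%N by rewrite expnM.
  have q1 : (0 < 2 ^ (4 * k))%N by rewrite expn_gt0.
  have q2 : (2 ^ (V + 8) <= 2 ^ ((V + 8) * k))%N by rewrite leq_exp2l// leq_pmulr.
  have q3 : (2 * b.+1 = 2 ^ (V + 8))%N by rewrite bE -expnS; congr (_ ^ _)%N; lia.
  apply: (@leq_trans (2 ^ (4 * k) * (2 * b * k).+2)); first nia.
  rewrite leq_pmul2l//; nia.
by rewrite -expnM ltn_exp2l//; nia.
Qed.

Lemma bernoulli_ineq (R : realFieldType) (h : R) (M : nat) :
  0 <= h -> 1 + M%:R * h <= (1 + h) ^+ M.
Proof.
move=> h0; elim: M => [|M IH]; first by rewrite mul0r addr0 expr0.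
rewrite exprS -natr1.
have : (1 + h) * (1 + M%:R * h) <= (1 + h) * (1 + h) ^+ M by rewrite ler_wpM2l// addr_ge0.
have : 0 <= M%:R * h * h by rewrite !mulr_ge0.
lra.
Qed.

Lemma one_minus_inv_exp (R : realFieldType) (M : nat) :
  (0 < M)%N -> (1 - M%:R^-1) ^+ M <= 2^-1 :> R.
Proof.
move=> M0; set h : R := M%:R^-1.
have h0 : 0 <= h by rewrite invr_ge0.
have h1 : h <= 1 by rewrite invf_le1 ?ltr0n// ler1n.
have := bernoulli_ineq M h0; rewrite /h divff ?pnatr_eq0 ?gtn_eqF// -/h => B.
have : (1 - h) ^+ M * (1 + h) ^+ M <= 1.
  rewrite -exprMn exprn_ile1//; nra.
have : 0 <= (1 - h) ^+ M by rewrite exprn_ge0// subr_ge0.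
nra.
Qed.

(** Dudley's entropy bound. After [greedy_hitting] the members of a separated
    family have distinct traces on few points; the Sauer lemma then bounds
    their number independently of the weights and of the ground set. *)
Lemma separated_card (V : nat) : exists b : nat, (0 < b)%N /\
  forall (R : realType) (I : finType) (F : {set {set I}}) (w : I -> R) (W : R) (k : nat),
    VC_at_most V F -> (forall i, 0 <= w i) -> \sum_i w i <= W ->
    {in F &, forall A B, A != B -> 16^-1 ^+ k * W < wdist w A B} ->
  (#|F| <= 2 ^ (b * k))%N.
Proof.
have [b [b0 bP]] := dudley_exponent V; exists b; split => // R I F w W k FV w0 wW sep.
have [k0|k0] := posnP k.
  rewrite k0 muln0 leqNgt; apply/negP => /card_gt1P[A [B [AF BF AB]]].
  have := sep _ _ AF BF AB; rewrite k0 expr0 mul1r ltNge => /negP; apply.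
  exact: le_trans (wdist_le _ _ w0) wW.
rewrite leqNgt; apply/negP => /ltnW/card_geqP[s [us ss sF]].
pose G := [set A in s]%SET.
have cG : #|G| = (2 ^ (b * k))%N by rewrite cardsE (card_uniqP us).
have GF : {subset G <= F} by move=> A; rewrite inE => /sF.
have GV : VC_at_most V G.
  move=> K /shatteredP h; apply: FV; apply/shatteredP => J /h[A AG <-].
  by exists A => //; exact: GF.
pose M := (16 ^ k)%N; have M0 : (0 < M)%N by rewrite expn_gt0.
have hE : 16^-1 ^+ k = M%:R^-1 :> R by rewrite /M natrX exprVn.
have h01 : 0 <= (M%:R^-1 : R) <= 1 by rewrite invr_ge0 ler0n /= invf_le1 ?ltr0n// ler1n.
have sepG : {in G &, forall A B, A != B -> M%:R^-1 * W < wdist w A B}.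
  by move=> A B AG BG AB; rewrite -hE; apply: sep => //; exact: GF.
have [Y Ys Yc] := greedy_hitting (M * (2 * b * k).+1) w0 wW h01 sepG.
have /card_trace_hit cT : #|[set p : {set I} * {set I} | [&& p.1 \in G, p.2 \in G, p.1 != p.2 &
         (Y :&: p.1)%SET == (Y :&: p.2)%SET]]%SET| = 0%N.
  apply/eqP; rewrite -leqn0 -ltnS -(ltr_nat R) (le_lt_trans Yc)//.
  rewrite exprM cG -natrX.
  apply: (@le_lt_trans _ _ (2^-1 ^+ (2 * b * k).+1 * ((2 ^ (b * k)) ^ 2)%N%:R)).
    rewrite ler_wpM2r// lerXn2r ?nnegrE ?exprn_ge0 ?subr_ge0//; first by case/andP: h01.
    exact: one_minus_inv_exp.
  rewrite -expnM natrX exprVn mulrC ltr_pdivrMr ?exprn_gt0// mul1r.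
  by rewrite ltr_eXn2l ?ltr1n//; lia.
have := sauer_trace Y GV; rewrite cT cG leqNgt => /negP; apply.
by apply: leq_ltn_trans (bP k k0); elim: (V) => // n IH; rewrite !expnS leq_mul.
Qed.

(** A maximal separated subfamily is a net. *)
Lemma vc_net (V : nat) : exists b : nat, (0 < b)%N /\
  forall (R : realType) (I : finType) (F : {set {set I}}) (w : I -> R) (W : R) (k : nat),
    VC_at_most V F -> (forall i, 0 <= w i) -> \sum_i w i <= W ->
  exists G : {set {set I}}, [/\ G \subset F, (#|G| <= 2 ^ (b * k))%N &
    {in F, forall A, exists2 B, B \in G & wdist w A B <= 16^-1 ^+ k * W}].
Proof.
have [b [b0 bP]] := separated_card V; exists b; split => // R I F w W k FV w0 wW.
pose sep (G : {set {set I}}) := (G \subset F) &&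
  [forall A in G, forall B in G, (A != B) ==> (16^-1 ^+ k * W < wdist w A B)].
have sep0 : sep finset.set0.
  by rewrite /sep finset.sub0set; apply/forall_inP => A; rewrite inE.
have [G /maxsetP[/andP[GF /forall_inP Gs] Gmax] _] := maxset_exists sep0.
have {}Gs : {in G &, forall A B, A != B -> 16^-1 ^+ k * W < wdist w A B}.
  by move=> A B /Gs /forall_inP h /h /implyP.
exists G; split => //.
  apply: (bP _ _ _ w W) => //.
  move=> K /shatteredP h; apply: FV; apply/shatteredP => J /h[A AG <-].
  by exists A => //; exact: (fintype.subsetP GF).
move=> A AF; have [AG|AG] := boolP (A \in G).
  exists A => //; rewrite wdistxx mulr_ge0 ?exprn_ge0 ?invr_ge0//.
  by apply: le_trans wW; apply: sumr_ge0.
have : ~~ sep (A |: G)%SET.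
  apply/negP => /Gmax/(_ (finset.subsetUr _ _)) e.
  by move: AG; rewrite -e !inE eqxx.
rewrite /sep finset.subUset finset.sub1set AF GF /= => h.
have [B BG Bd] : exists2 B, B \in G & wdist w A B <= 16^-1 ^+ k * W.
  apply/exists_inP; apply: contraNT h; rewrite negb_exists_in => /forall_inP h.
  apply/forall_inP => C CG; apply/forall_inP => D DG; apply/implyP => CD.
  move: CG DG; rewrite !inE => /orP[/eqP CA|CG] /orP[/eqP DA|DG].
  - by rewrite CA DA eqxx in CD.
  - by rewrite CA ltNge h.
  - by rewrite DA wdistC ltNge h.
  - exact: Gs.
by exists B.
Qed.

Local Open Scope classical_set_scope.
Local Open Scope ring_scope.

(** * Euclidean norms and random signs *)

Definition nsq (R : realType) (d : nat) (v : 'rV[R]_d) : R := \sum_(a < d) v ord0 a ^+ 2.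

Definition dot (R : realType) (d : nat) (u v : 'rV[R]_d) : R :=
  \sum_(a < d) u ord0 a * v ord0 a.

Section euclidean.
Context {R : realType} {d : nat}.
Implicit Types u v w : 'rV[R]_d.

Lemma nsq_ge0 v : 0 <= nsq v.
Proof. by apply: sumr_ge0 => a _; exact: sqr_ge0. Qed.

Lemma nsq0 : nsq (0 : 'rV[R]_d) = 0.
Proof. by rewrite /nsq big1// => a _; rewrite mxE expr0n. Qed.

Lemma eucl_norm_sqr v : eucl_norm v ^+ 2 = nsq v.
Proof. by rewrite sqr_sqrtr// nsq_ge0. Qed.

Lemma eucl_norm_ge0 v : 0 <= eucl_norm v.
Proof. exact: sqrtr_ge0. Qed.

Lemma nsqD u v : nsq (u + v) = nsq u + 2 * dot u v + nsq v.
Proof.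
rewrite /nsq /dot mulr_sumr -!big_split; apply: eq_bigr => a _ /=.
by rewrite mxE; ring.
Qed.

Lemma nsqZ (c : R) v : nsq (c *: v) = c ^+ 2 * nsq v.
Proof. by rewrite /nsq mulr_sumr; apply: eq_bigr => a _; rewrite mxE exprMn. Qed.

Lemma nsqN v : nsq (- v) = nsq v.
Proof. by rewrite -scaleN1r nsqZ; ring. Qed.

Lemma dotC u v : dot u v = dot v u.
Proof. by apply: eq_bigr => a _; rewrite mulrC. Qed.

Lemma dotDl u v w : dot (u + v) w = dot u w + dot v w.
Proof. by rewrite /dot -big_split; apply: eq_bigr => a _; rewrite mxE mulrDl. Qed.

Lemma dotZl c u v : dot (c *: u) v = c * dot u v.
Proof. by rewrite /dot mulr_sumr; apply: eq_bigr => a _; rewrite mxE mulrA. Qed.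

Lemma dotvv v : dot v v = nsq v.
Proof. by apply: eq_bigr => a _; rewrite expr2. Qed.

Lemma cauchy_schwarz u v : dot u v ^+ 2 <= nsq u * nsq v.
Proof.
have [v0|v0] := eqVneq (nsq v) 0.
  suff -> : dot u v = 0 by rewrite v0 mulr0 expr0n.
  rewrite /dot big1// => a _; suff -> : v ord0 a = 0 by rewrite mulr0.
  have : v ord0 a ^+ 2 <= nsq v.
    by rewrite /nsq (bigD1 a)//= lerDl sumr_ge0// => b _; exact: sqr_ge0.
  by rewrite v0 => h; apply/eqP; rewrite -sqrf_eq0 eq_le h sqr_ge0.
have vp : 0 < nsq v by rewrite lt_def v0 nsq_ge0.
have := nsq_ge0 (u - (dot u v / nsq v) *: v).
rewrite nsqD nsqN nsqZ -scaleNr dotC dotZl (dotC v).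
set p := dot u v; set q := nsq u; set r := nsq v in v0 vp *.
have -> : q + 2 * (- (p / r) * p) + (p / r) ^+ 2 * r = q - p ^+ 2 / r by field.
by rewrite subr_ge0 ler_pdivrMr.
Qed.

Lemma eucl_normD u v : eucl_norm (u + v) <= eucl_norm u + eucl_norm v.
Proof.
rewrite -(@ler_pXn2r _ 2)// ?nnegrE ?addr_ge0 ?eucl_norm_ge0//.
rewrite sqrrD !eucl_norm_sqr nsqD lerD2r lerD2l.
have : dot u v <= eucl_norm u * eucl_norm v.
  apply: le_trans (ler_norm _) _.
  rewrite -(@ler_pXn2r _ 2)// ?nnegrE ?mulr_ge0 ?eucl_norm_ge0//.
  by rewrite -normrX ger0_norm ?sqr_ge0// exprMn !eucl_norm_sqr cauchy_schwarz.
by rewrite mulr2n; lra.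
Qed.

Lemma eucl_normN v : eucl_norm (- v) = eucl_norm v.
Proof. by rewrite /eucl_norm -!/(nsq _) nsqN. Qed.

Lemma eucl_normZ c v : eucl_norm (c *: v) = `|c| * eucl_norm v.
Proof. by rewrite /eucl_norm -!/(nsq _) nsqZ sqrtrM ?sqr_ge0// sqrtr_sqr. Qed.

Lemma eucl_norm0 : eucl_norm (0 : 'rV[R]_d) = 0.
Proof. by rewrite /eucl_norm -/(nsq _) nsq0 sqrtr0. Qed.

Lemma eucl_norm_sum (I : Type) (s : seq I) (P : pred I) (f : I -> 'rV[R]_d) :
  eucl_norm (\sum_(i <- s | P i) f i) <= \sum_(i <- s | P i) eucl_norm (f i).
Proof.
elim/big_ind2 : _ => [|u a v b ua vb|//]; first by rewrite eucl_norm0.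
exact: le_trans (eucl_normD _ _) (lerD ua vb).
Qed.

Lemma dot_eucl_norm u v : `|dot u v| <= eucl_norm u * eucl_norm v.
Proof.
rewrite -(@ler_pXn2r _ 2)// ?nnegrE ?mulr_ge0 ?eucl_norm_ge0//.
by rewrite -normrX ger0_norm ?sqr_ge0// exprMn !eucl_norm_sqr cauchy_schwarz.
Qed.

End euclidean.

(** The mean over independent uniform signs, by recursion rather than as a
    normalized sum, so that inductions on the number of signs are immediate. *)
Fixpoint sign_avg (R : realType) (n : nat) : (n.-tuple bool -> R) -> R :=
  match n with
  | 0 => fun f => f [tuple]
  | n'.+1 => fun f => sign_avg
      (fun s : n'.-tuple bool => (f [tuple of true :: s] + f [tuple of false :: s]) / 2)
  end.

Section sign_avg.
Context {R : realType}.

Lemma le_sign_avg n (f g : n.-tuple bool -> R) :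
  (forall s, f s <= g s) -> sign_avg f <= sign_avg g.
Proof.
elim: n f g => [|n IH] f g fg /=; first exact: fg.
by apply: IH => s; rewrite ler_pM2r ?invr_gt0// lerD.
Qed.

Lemma eq_sign_avg n (f g : n.-tuple bool -> R) : f =1 g -> sign_avg f = sign_avg g.
Proof. by move=> fg; apply/eqP; rewrite eq_le !le_sign_avg// => s; rewrite fg. Qed.

Lemma sign_avgD n (f g : n.-tuple bool -> R) :
  sign_avg (fun s => f s + g s) = sign_avg f + sign_avg g.
Proof.
elim: n f g => [//|n IH] f g /=; rewrite -IH; apply: eq_sign_avg => s.
by field.
Qed.

Lemma sign_avgZ n (c : R) (f : n.-tuple bool -> R) :
  sign_avg (fun s => c * f s) = c * sign_avg f.
Proof.
elim: n f => [//|n IH] f /=; rewrite -IH; apply: eq_sign_avg => s.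
by field.
Qed.

Lemma sign_avg_cst n (c : R) : sign_avg (fun _ : n.-tuple bool => c) = c.
Proof.
elim: n => [//|n IH] /=; rewrite -[RHS]IH; apply: eq_sign_avg => s.
by field.
Qed.

Lemma sign_avg_sum n (I : Type) (r : seq I) (Q : pred I) (f : I -> n.-tuple bool -> R) :
  sign_avg (fun s => \sum_(i <- r | Q i) f i s) = \sum_(i <- r | Q i) sign_avg (f i).
Proof.
elim: r => [|i r IH].
  by rewrite big_nil -[RHS](sign_avg_cst n); apply: eq_sign_avg => s; rewrite big_nil.
rewrite big_cons -IH; case: ifP => Qi.
  by rewrite -sign_avgD; apply: eq_sign_avg => s; rewrite big_cons Qi.
by apply: eq_sign_avg => s; rewrite big_cons Qi.
Qed.

Lemma sign_avg_ge0 n (f : n.-tuple bool -> R) : (forall s, 0 <= f s) -> 0 <= sign_avg f.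
Proof. by move=> f0; rewrite -[leLHS](sign_avg_cst n); exact: le_sign_avg. Qed.

Definition sign_sum n d (v : 'I_n -> 'rV[R]_d) (s : n.-tuple bool) : 'rV[R]_d :=
  \sum_(i < n) ((-1) ^+ tnth s i) *: v i.

Lemma sign_sum_cons n d (v : 'I_n.+1 -> 'rV[R]_d) b (s : n.-tuple bool) :
  sign_sum v [tuple of b :: s] =
  sign_sum (fun i => v (lift ord0 i)) s + (-1) ^+ b *: v ord0.
Proof.
rewrite /sign_sum big_ord_recl tnth0 addrC; congr (_ + _).
by apply: eq_bigr => i _; rewrite tnthS.
Qed.

(** The odd terms of the two binomial expansions cancel; what is left of
    second order carries a factor t ^ 2. *)
Lemma two_sided_power (q : nat) : exists2 C : R, 0 <= C &
  forall x y t : R, 0 <= x -> x <= y -> t ^+ 2 <= 4 * x * y ->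
    ((y + x + t) ^+ q.+1 + (y + x - t) ^+ q.+1) / 2 <= y ^+ q.+1 + C * x * y ^+ q.
Proof.
suff [C [D [C0 _ CD]]] : exists C D : R, [/\ 0 <= C, 0 <= D &
  forall x y t : R, 0 <= x -> x <= y -> t ^+ 2 <= 4 * x * y ->
    ((y + x + t) ^+ q.+1 + (y + x - t) ^+ q.+1) / 2 <= y ^+ q.+1 + C * x * y ^+ q /\
    t * (((y + x + t) ^+ q.+1 - (y + x - t) ^+ q.+1) / 2) <= D * x * y ^+ q.+1].
  by exists C => // x y t x0 xy ty; have [] := CD x y t x0 xy ty.
elim: q => [|q [C [D [C0 D0 IH]]]].
  by exists 1, 4; split=> // x y t x0 xy ty; rewrite !expr1 expr0; split; lra.
exists (1 + 2 * C + D), (2 * D + 4 * (1 + C)).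
split=> [||x y t x0 xy ty]; [by rewrite !addr_ge0// mulr_ge0|
  by rewrite addr_ge0// mulr_ge0// addr_ge0|].
have [IHa IHb] := IH x y t x0 xy ty.
rewrite (exprS (y + x + t) q.+1) (exprS (y + x - t) q.+1) (exprS y q.+1) {IH}.
have y0 : 0 <= y by exact: le_trans xy.
have yq0 : 0 <= y ^+ q by rewrite exprn_ge0.
move: IHa IHb; rewrite (exprS y q).
set P := (y + x + t) ^+ q.+1; set M := (y + x - t) ^+ q.+1; set Y := y ^+ q in yq0 *.
set a := (P + M) / 2; set b := t * ((P - M) / 2) => IHa IHb.
have xY0 : 0 <= x * Y by rewrite mulr_ge0.
have xyY0 : 0 <= x * y * Y by rewrite !mulr_ge0.
have h1 : x * (x * Y) <= y * (x * Y) by rewrite ler_wpM2r.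
have h1C : C * (x * (x * Y)) <= C * (y * (x * Y)) by rewrite ler_wpM2l.
have h2 : (y + x) * a <= (y + x) * (y * Y + C * x * Y) by rewrite ler_wpM2l// addr_ge0.
split.
  have -> : ((y + x + t) * P + (y + x - t) * M) / 2 = (y + x) * a + b.
    by rewrite /a /b; field.
  nra.
have -> : t * (((y + x + t) * P - (y + x - t) * M) / 2) = (y + x) * b + t ^+ 2 * a.
  by rewrite /a /b; field.
have U0 : 0 <= y * Y + C * x * Y by rewrite addr_ge0 ?mulr_ge0.
have h3 : t ^+ 2 * a <= 4 * x * y * (y * Y + C * x * Y).
  apply: (@le_trans _ _ (t ^+ 2 * (y * Y + C * x * Y))); first by rewrite ler_wpM2l ?sqr_ge0.
  by rewrite ler_wpM2r.
have h4 : (y + x) * b <= (y + x) * (D * x * (y * Y)) by rewrite ler_wpM2l// addr_ge0.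
have h5 : (y + x) * (D * x * (y * Y)) <= 2 * y * (D * x * (y * Y)).
  by rewrite ler_wpM2r ?mulr_ge0//; lra.
have h6 : 4 * x * y * (C * x * Y) <= 4 * x * y * (C * y * Y).
  by rewrite ler_wpM2l ?mulr_ge0// ler_wpM2r// ler_wpM2l.
lra.
Qed.

(** Adding the total weight W to the squared norm of the partial sum makes it
    dominate the squared norm of the next term, as [two_sided_power] requires;
    the moment of order q.+1 then grows by at most a multiple of that of order
    q times the squared norm of each term. *)
Lemma khintchine_shifted (q : nat) : exists2 K : R, 0 <= K &
  forall n d (v : 'I_n -> 'rV[R]_d) (W : R), \sum_i nsq (v i) <= W ->
    sign_avg (fun s => (nsq (sign_sum v s) + W) ^+ q) <= K * W ^+ q.
Proof.
elim: q => [|q [K K0 IHq]].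
  by exists 1 => // n d v W _; rewrite expr0 mulr1 sign_avg_cst.
have [C C0 CP] := two_sided_power q.
exists (1 + C * K) => [|n d v W vW]; first by rewrite addr_ge0// mulr_ge0.
suff : sign_avg (fun s => (nsq (sign_sum v s) + W) ^+ q.+1) <=
    W ^+ q.+1 + C * (\sum_i nsq (v i)) * (K * W ^+ q).
  move=> /le_trans; apply; rewrite mulrDl mul1r lerD2l exprS.
  have W0 : 0 <= W by apply: le_trans vW; apply: sumr_ge0 => i _; exact: nsq_ge0.
  have : C * (\sum_i nsq (v i)) * (K * W ^+ q) <= C * W * (K * W ^+ q).
    by rewrite ler_wpM2r ?mulr_ge0 ?exprn_ge0// ler_wpM2l.
  by move=> /le_trans; apply; rewrite le_eqVlt; apply/orP; left; apply/eqP; ring.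
elim: n v vW => [|n IHn] v vW.
  by rewrite /= /sign_sum !big_ord0 nsq0 add0r mulr0 mul0r addr0.
have v00 := nsq_ge0 (v ord0).
have tl0 : 0 <= \sum_(i < n) nsq (v (lift ord0 i)).
  by apply: sumr_ge0 => i _; exact: nsq_ge0.
move: vW; rewrite big_ord_recl => vW.
have tlW : \sum_(i < n) nsq (v (lift ord0 i)) <= W by lra.
have := IHn _ tlW; have := IHq _ _ _ _ tlW.
set u := fun i => v (lift ord0 i) => IH1 IH2.
rewrite /=; apply: (@le_trans _ _ (sign_avg (fun s => (nsq (sign_sum u s) + W) ^+ q.+1 +
    C * nsq (v ord0) * (nsq (sign_sum u s) + W) ^+ q))).
  apply: le_sign_avg => s; rewrite !sign_sum_cons -/u.
  set S := sign_sum u s; have S0 := nsq_ge0 S.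
  have xy : nsq (v ord0) <= nsq S + W by lra.
  have ty : (2 * dot S (v ord0)) ^+ 2 <= 4 * nsq (v ord0) * (nsq S + W).
    have := cauchy_schwarz S (v ord0); have : 0 <= nsq (v ord0) * W by rewrite mulr_ge0//; lra.
    by rewrite exprMn; lra.
  apply: le_trans (CP _ _ _ v00 xy ty).
  rewrite expr1 expr0 scaleN1r scale1r !nsqD nsqN.
  have -> : dot S (- v ord0) = - dot S (v ord0) by rewrite -scaleN1r dotC dotZl dotC mulN1r.
  by rewrite le_eqVlt; apply/orP; left; apply/eqP; congr (_ / _); rewrite addrC;
     congr (_ ^+ _ + _ ^+ _); ring.
rewrite sign_avgD sign_avgZ mulrDr mulrDl.
have : C * nsq (v ord0) * sign_avg (fun s => (nsq (sign_sum u s) + W) ^+ q) <=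
       C * nsq (v ord0) * (K * W ^+ q) by rewrite ler_wpM2l ?mulr_ge0.
lra.
Qed.

Lemma khintchine (q : nat) : exists2 K : R, 0 <= K &
  forall n d (v : 'I_n -> 'rV[R]_d),
    sign_avg (fun s => nsq (sign_sum v s) ^+ q) <= K * (\sum_i nsq (v i)) ^+ q.
Proof.
have [K K0 KP] := khintchine_shifted q; exists K => // n d v.
apply: le_trans (KP _ _ _ _ (lexx _)); apply: le_sign_avg => s.
have W0 : 0 <= \sum_i nsq (v i) by apply: sumr_ge0 => i _; exact: nsq_ge0.
by rewrite lerXn2r ?nnegrE ?addr_ge0 ?nsq_ge0// lerDl.
Qed.

End sign_avg.

(** * Chaining *)

Definition set_diff (R : realType) (n : nat) (A B : {set 'I_n}) (i : 'I_n) : R :=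
  (i \in A)%:R - (i \in B)%:R.

Section chaining.
Context {R : realType} {n d : nat}.
Variable x : 'I_n -> 'rV[R]_d.
Local Notation wx := (fun i => nsq (x i)).

Definition sign_diff (A B : {set 'I_n}) (s : n.-tuple bool) : 'rV[R]_d :=
  sign_sum (fun i => set_diff R A B i *: x i) s.

Lemma sign_diffD (B A C : {set 'I_n}) s : sign_diff A C s = sign_diff A B s + sign_diff B C s.
Proof.
rewrite /sign_diff /sign_sum -big_split; apply: eq_bigr => i _ /=.
by rewrite -scalerDr -scalerDl; congr (_ *: (_ *: _)); rewrite /set_diff; ring.
Qed.

Lemma sign_diffN (A B : {set 'I_n}) s : sign_diff A B s = - sign_diff B A s.
Proof.
rewrite /sign_diff /sign_sum -sumrN; apply: eq_bigr => i _ /=.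
by rewrite -scalerN -scaleNr; congr (_ *: (_ *: _)); rewrite /set_diff; ring.
Qed.

Lemma sign_diffxx (A : {set 'I_n}) s : sign_diff A A s = 0.
Proof.
by rewrite /sign_diff /sign_sum big1// => i _; rewrite /set_diff subrr scale0r scaler0.
Qed.

Lemma set_diff_sqr (A B : {set 'I_n}) i :
  set_diff R A B i ^+ 2 = ((i \in A) != (i \in B))%:R.
Proof.
by rewrite /set_diff; case: (i \in A) (i \in B) => [] []; rewrite /= ?subrr ?subr0 ?sub0r ?sqrrN ?expr0n ?expr1n.
Qed.

Lemma sum_nsq_set_diff (A B : {set 'I_n}) :
  \sum_i nsq (set_diff R A B i *: x i) = wdist wx A B.
Proof.
rewrite /wdist [RHS]big_mkcond; apply: eq_bigr => i _.
by rewrite nsqZ set_diff_sqr; case: ifP => _; rewrite ?mul1r ?mul0r.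
Qed.

(** A maximum is at most t plus a sum of high powers over t: the Khintchine
    moment of order 2 q.+1 turns a number of pairs growing like l ^ (2 q + 1)
    into a factor l only. *)
Lemma sign_diff_max (q : nat) (K : R)
    (KP : forall v : 'I_n -> 'rV[R]_d,
      sign_avg (fun s => nsq (sign_sum v s) ^+ q.+1) <= K * (\sum_i nsq (v i)) ^+ q.+1)
    (P : {set {set 'I_n} * {set 'I_n}}) (r l : R) : 0 <= K -> 0 < r -> 0 < l ->
    {in P, forall p, wdist wx p.1 p.2 <= r ^+ 2} ->
  exists H : n.-tuple bool -> R,
    (forall s, {in P, forall p, eucl_norm (sign_diff p.1 p.2 s) <= H s}) /\
    sign_avg H <= r * (l + #|P|%:R * K / l ^+ (2 * q).+1).
Proof.
move=> K0 r0 l0 Pr; pose t := l * r; have t0 : 0 < t by rewrite mulr_gt0.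
exists (fun s => t + (t ^+ (2 * q).+1)^-1 *
  \sum_(p in P) nsq (sign_diff p.1 p.2 s) ^+ q.+1); split.
  move=> s p pP; set y := eucl_norm _.
  have y0 : 0 <= y by exact: eucl_norm_ge0.
  have [yt|ty] := leP y t.
    rewrite (le_trans yt)// lerDl mulr_ge0 ?invr_ge0 ?exprn_ge0// ?(ltW t0)//.
    by apply: sumr_ge0 => p' _; rewrite exprn_ge0// nsq_ge0.
  apply: (@le_trans _ _ ((t ^+ (2 * q).+1)^-1 * y ^+ (2 * q).+2)).
    rewrite mulrC ler_pdivlMr ?exprn_gt0// (exprS y) ler_wpM2l//.
    by rewrite lerXn2r ?nnegrE ?(ltW t0)// ltW.
  apply: (@le_trans _ _ ((t ^+ (2 * q).+1)^-1 *
    \sum_(p in P) nsq (sign_diff p.1 p.2 s) ^+ q.+1)); last by rewrite lerDr ltW.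
  rewrite ler_wpM2l ?invr_ge0 ?exprn_ge0 ?(ltW t0)//.
  have -> : y ^+ (2 * q).+2 = nsq (sign_diff p.1 p.2 s) ^+ q.+1.
    by rewrite -eucl_norm_sqr -exprM; congr (_ ^+ _); lia.
  rewrite (bigD1 p)//= lerDl sumr_ge0// => p' _.
  by rewrite exprn_ge0// nsq_ge0.
rewrite sign_avgD sign_avg_cst sign_avgZ sign_avg_sum.
apply: (@le_trans _ _ (t + (t ^+ (2 * q).+1)^-1 * \sum_(p in P) K * (r ^+ 2) ^+ q.+1)).
  rewrite lerD2l ler_wpM2l ?invr_ge0 ?exprn_ge0 ?(ltW t0)//.
  apply: ler_sum => p pP; apply: (le_trans (KP _)); rewrite ler_wpM2l//.
  have w0 i : 0 <= wx i by exact: nsq_ge0.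
  rewrite sum_nsq_set_diff lerXn2r ?nnegrE ?wdist_ge0 ?exprn_ge0 ?(ltW r0)//.
  exact: Pr.
rewrite sumr_const -[_ *+ _]mulr_natl /t le_eqVlt; apply/orP; left; apply/eqP.
rewrite -exprM (_ : (2 * q.+1 = (2 * q).+2)%N); last lia.
rewrite exprMn (exprS r (2 * q).+1).
by field; rewrite !expf_neq0 ?gt_eqF.
Qed.

Lemma sign_diff_crude (A B : {set 'I_n}) (e : R) s :
  0 <= e -> wdist wx A B <= e ^+ 2 -> eucl_norm (sign_diff A B s) <= n%:R * e.
Proof.
move=> e0 AB; rewrite (le_trans (eucl_norm_sum _ _ _))//.
rewrite -[X in X%:R * _](card_ord n) mulr_natl -sumr_const.
apply: ler_sum => i _; rewrite eucl_normZ normrX normrN1 expr1n mul1r.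
rewrite -(@ler_pXn2r _ 2)// ?nnegrE ?eucl_norm_ge0// eucl_norm_sqr (le_trans _ AB)//.
rewrite -sum_nsq_set_diff (bigD1 i)//= lerDl sumr_ge0// => j _.
exact: nsq_ge0.
Qed.

End chaining.

(** Dudley chaining along the nets of [vc_net], whose sizes 2 ^ (b k) at scale
    4 ^ - k are absorbed by the moment of order 2 b. *)
Lemma chaining (R : realType) (V : nat) : exists2 C : R, 0 <= C &
  forall (n d : nat) (x : 'I_n -> 'rV[R]_d) (F : {set {set 'I_n}}) (w r : R) (k0 : nat),
    VC_at_most V F -> 0 < w -> 0 < r -> \sum_i nsq (x i) <= w ^+ 2 ->
  exists H : n.-tuple bool -> R,
    (forall s, {in F &, forall A B, wdist (fun i => nsq (x i)) A B <= r ^+ 2 ->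
       eucl_norm (sign_diff x A B s) <= H s}) /\
    sign_avg H <= C * (2^-1 ^+ k0 * w + 2 ^+ k0 * r).
Proof.
have [b' [b'0 netP]] := vc_net V; case: b' b'0 netP => // b _ netP.
have [K K0 KP] := @khintchine R b.+1.
pose C1 := 2 * (1 + 2 ^+ b.+1 * K).
have C10 : 0 <= C1 by rewrite mulr_ge0// addr_ge0// mulr_ge0// exprn_ge0.
exists (4 * C1 + 2 + 2 * (1 + K)) => [|n d x F w r k0 FV w0 r0 xw].
  by rewrite !addr_ge0// mulr_ge0// addr_ge0.
have wx0 i : 0 <= nsq (x i) by exact: nsq_ge0.
have /choice[G GP] k := netP R _ F (fun i => nsq (x i)) _ k FV wx0 xw.
have /choice[pi piP] (kA : nat * {set 'I_n}) : exists B, kA.2 \in F ->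
    B \in G kA.1 /\ wdist (fun i => nsq (x i)) kA.2 B <= 16^-1 ^+ kA.1 * w ^+ 2.
  have [AF|AF] := boolP (kA.2 \in F); last by exists finset.set0.
  by have [_ _ /(_ _ AF)[B BG Bd]] := GP kA.1; exists B.
have h4 k : 16^-1 ^+ k = (4^-1 ^+ k) ^+ 2 :> R.
  by rewrite -exprM mulnC exprM; congr (_ ^+ _); rewrite expr2; field.
have h4S k : 16^-1 ^+ k.+1 = 16^-1 * 16^-1 ^+ k :> R by rewrite exprS.
have h40 k : 0 < 4^-1 ^+ k :> R by rewrite exprn_gt0.
have e42 k : 4^-1 ^+ k * 2 ^+ k = 2^-1 ^+ k :> R.
  by rewrite -exprMn; congr (_ ^+ _); field.
have link k : exists H : n.-tuple bool -> R,
    (forall s, {in F, forall A, eucl_norm (sign_diff x (pi (k, A)) (pi (k.+1, A)) s) <= H s}) /\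
    sign_avg H <= C1 * 2^-1 ^+ k * w.
  pose P : {set {set 'I_n} * {set 'I_n}} :=
    [set p in finset.setX (G k) (G k.+1) | wdist (fun i => nsq (x i)) p.1 p.2 <= (2 * 4^-1 ^+ k * w) ^+ 2]%SET.
  have PG : (#|P| <= 2 ^ (b.+1 * k) * 2 ^ (b.+1 * k.+1))%N.
    apply: (@leq_trans #|finset.setX (G k) (G k.+1)|).
      by apply: subset_leq_card; apply/fintype.subsetP => p; rewrite inE => /andP[].
    rewrite cardsX leq_mul//; [by have [] := GP k|by have [] := GP k.+1].
  have rk0 : 0 < 2 * 4^-1 ^+ k * w by rewrite !mulr_gt0.
  have lk0 : 0 < 2 ^+ k :> R by rewrite exprn_gt0.
  have [|H [HP Havg]] := sign_diff_max (x := x) (KP n d) (P := P) K0 rk0 lk0.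
    by move=> p; rewrite inE => /andP[].
  exists H; split.
    move=> s A AF; apply: (HP s (pi (k, A), pi (k.+1, A))).
    have [g1 d1] := piP (k, A) AF; have [g2 d2] := piP (k.+1, A) AF.
    rewrite inE /= inE /= g1 g2 /=.
    apply: (le_trans (wdist_triangle A _ _ wx0)).
    rewrite wdistC (le_trans (lerD d1 d2))// /= h4S !exprMn -h4.
    have : 0 <= 16^-1 ^+ k * w ^+ 2 by rewrite mulr_ge0 ?exprn_ge0// ltW.
    lra.
  apply: (le_trans Havg).
  have bnd : #|P|%:R * K / (2 ^+ k) ^+ (2 * b).+1 <= 2 ^+ k * (2 ^+ b.+1 * K).
    rewrite ler_pdivrMr ?exprn_gt0//.
    apply: (@le_trans _ _ ((2 ^ (b.+1 * k) * 2 ^ (b.+1 * k.+1))%N%:R * K)).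
      by rewrite ler_wpM2r// ler_nat.
    have -> : 2 ^+ k * (2 ^+ b.+1 * K) * (2 ^+ k) ^+ (2 * b).+1 =
        2 ^+ (k + b.+1 + k * (2 * b).+1) * K by rewrite !exprD exprM; ring.
    rewrite natrM !natrX -exprD le_eqVlt; apply/orP; left; apply/eqP.
    by congr (_ ^+ _ * _); rewrite !mulnS !mulSn; ring.
  apply: (@le_trans _ _ (2 * 4^-1 ^+ k * w * (2 ^+ k + 2 ^+ k * (2 ^+ b.+1 * K)))).
    by rewrite ler_wpM2l ?(ltW rk0)// lerD2l.
  by rewrite /C1 -e42 le_eqVlt; apply/orP; left; apply/eqP; ring.
have chain m : exists H : n.-tuple bool -> R,
    (forall s, {in F, forall A, eucl_norm (sign_diff x (pi (k0, A)) (pi ((k0 + m)%N, A)) s) <= H s}) /\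
    sign_avg H <= C1 * (2 * 2^-1 ^+ k0 - 2 * 2^-1 ^+ (k0 + m)) * w.
  elim: m => [|m [H [HP Havg]]].
    exists (fun=> 0); split => [s A AF|]; first by rewrite addn0 sign_diffxx eucl_norm0.
    by rewrite sign_avg_cst addn0 subrr mulr0 mul0r.
  have [L [LP Lavg]] := link (k0 + m)%N.
  exists (fun s => H s + L s); split => [s A AF|].
    rewrite addnS (sign_diffD x (pi ((k0 + m)%N, A))) (le_trans (eucl_normD _ _))//.
    by apply: lerD; [exact: HP|exact: LP].
  rewrite sign_avgD (le_trans (lerD Havg Lavg))// addnS exprS.
  by rewrite le_eqVlt; apply/orP; left; apply/eqP; field.
have [H [HP Havg]] := chain n.
(* at depth k0 + n the triangle inequality alone suffices *)
have last s A : A \in F ->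
    eucl_norm (sign_diff x A (pi ((k0 + n)%N, A)) s) <= 2^-1 ^+ k0 * w.
  move=> AF; have [_ dA] := piP ((k0 + n)%N, A) AF.
  have e0 : 0 <= 4^-1 ^+ (k0 + n) * w by rewrite mulr_ge0 ?(ltW w0)// ltW.
  apply: (le_trans (sign_diff_crude s e0 _)); first by rewrite exprMn -h4.
  rewrite mulrA ler_pM2r// exprD mulrCA -[leRHS]mulr1 ler_pM ?mulr_ge0 ?exprn_ge0//.
    by rewrite -e42 ler_peMr ?exprn_ge0// exprn_ege1// ler1n.
  rewrite exprVn ler_pdivrMr ?exprn_gt0// mul1r -natrX ler_nat.
  by rewrite ltnW// ltn_expl.
(* close sets have close projections on the net of scale 4 ^ - k0, which has at
   most 2 ^ (2 b k0) pairs *)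
pose rm := r + 2 * 4^-1 ^+ k0 * w.
have rm0 : 0 < rm by rewrite addr_gt0// !mulr_gt0.
pose P : {set {set 'I_n} * {set 'I_n}} :=
  [set p in finset.setX (G k0) (G k0) | wdist (fun i => nsq (x i)) p.1 p.2 <= rm ^+ 2]%SET.
have PG : (#|P| <= 2 ^ (b.+1 * k0) * 2 ^ (b.+1 * k0))%N.
  apply: (@leq_trans #|finset.setX (G k0) (G k0)|).
    by apply: subset_leq_card; apply/fintype.subsetP => p; rewrite inE => /andP[].
  by rewrite cardsX leq_mul//; have [] := GP k0.
have lk0 : 0 < 2 ^+ k0 :> R by rewrite exprn_gt0.
have [|M [MP Mavg]] := sign_diff_max (x := x) (KP n d) (P := P) K0 rm0 lk0.
  by move=> p; rewrite inE => /andP[].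
exists (fun s => 2 * (H s + 2^-1 ^+ k0 * w) + M s); split.
  move=> s A B AF BF AB.
  have [g1 d1] := piP (k0, A) AF; have [g2 d2] := piP (k0, B) BF.
  have tri D : D \in F -> eucl_norm (sign_diff x D (pi (k0, D)) s) <= H s + 2^-1 ^+ k0 * w.
    move=> DF; rewrite (sign_diffD x (pi ((k0 + n)%N, D))) addrC (le_trans (eucl_normD _ _))//.
    by apply: lerD; [rewrite sign_diffN eucl_normN; exact: HP|exact: last].
  have mid : eucl_norm (sign_diff x (pi (k0, A)) (pi (k0, B)) s) <= M s.
    apply: (MP s (pi (k0, A), pi (k0, B))); rewrite inE /= inE /= g1 g2 /=.
    apply: (le_trans (wdist_triangle A _ _ wx0)).
    apply: (le_trans (lerD (lexx _) (wdist_triangle B _ _ wx0))).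
    rewrite (wdistC _ _ A) (le_trans (lerD d1 (lerD AB d2)))// /rm sqrrD !exprMn h4 /=.
    have : 0 <= r * (2 * 4^-1 ^+ k0 * w) by rewrite !mulr_ge0 ?exprn_ge0 ?(ltW r0) ?(ltW w0).
    have : 0 <= (4^-1 ^+ k0) ^+ 2 * w ^+ 2 by rewrite mulr_ge0 ?sqr_ge0.
    by rewrite mulr2n; lra.
  rewrite (sign_diffD x (pi (k0, A))) (sign_diffD x (pi (k0, B)) (pi (k0, A))).
  rewrite (sign_diffN x (pi (k0, B)) B).
  apply: (le_trans (eucl_normD _ _)); apply: (le_trans (lerD (lexx _) (eucl_normD _ _))).
  by rewrite eucl_normN; have := tri A AF; have := tri B BF; lra.
rewrite sign_avgD sign_avgZ sign_avgD sign_avg_cst.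
have bnd : #|P|%:R * K / (2 ^+ k0) ^+ (2 * b).+1 <= 2 ^+ k0 * K.
  rewrite ler_pdivrMr ?exprn_gt0//.
  apply: (@le_trans _ _ ((2 ^ (b.+1 * k0) * 2 ^ (b.+1 * k0))%N%:R * K)).
    by rewrite ler_wpM2r// ler_nat.
  have -> : 2 ^+ k0 * K * (2 ^+ k0) ^+ (2 * b).+1 = 2 ^+ (k0 + k0 * (2 * b).+1) * K.
    by rewrite !exprD exprM; ring.
  rewrite natrM !natrX -exprD le_eqVlt; apply/orP; left; apply/eqP.
  by congr (_ ^+ _ * _); rewrite !mulnS !mulSn; ring.
have Mavg' : sign_avg M <= (1 + K) * (2 ^+ k0 * r + 2 * (2^-1 ^+ k0 * w)).
  apply: (le_trans Mavg); apply: (@le_trans _ _ (rm * (2 ^+ k0 + 2 ^+ k0 * K))).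
    by rewrite ler_wpM2l ?(ltW rm0)// lerD2l.
  by rewrite /rm -e42 le_eqVlt; apply/orP; left; apply/eqP; ring.
have Havg' : sign_avg H <= 2 * C1 * (2^-1 ^+ k0 * w).
  apply: (le_trans Havg); apply: (@le_trans _ _ (C1 * (2 * 2^-1 ^+ k0) * w)).
    by rewrite ler_wpM2r ?(ltW w0)// ler_wpM2l// lerBlDr lerDl mulr_ge0 ?exprn_ge0.
  by rewrite le_eqVlt; apply/orP; left; apply/eqP; ring.
have q0 : 0 <= 2^-1 ^+ k0 * w by rewrite mulr_ge0 ?exprn_ge0// ltW.
have p0 : 0 <= 2 ^+ k0 * r by rewrite mulr_ge0 ?exprn_ge0// ltW.
have : 0 <= (4 * C1 + 2) * (2 ^+ k0 * r) by rewrite mulr_ge0// addr_ge0// mulr_ge0.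
have : 0 <= K * (2 ^+ k0 * r) by rewrite mulr_ge0.
lra.
Qed.

(** * Means and powers of a probability *)

Lemma measurable_le_set d (T : measurableType d) (R : realType) (f g : T -> R) :
  measurable_fun setT f -> measurable_fun setT g -> measurable [set w | f w <= g w].
Proof.
move=> mf mg; have h := measurable_fun_ler mf mg.
by have /(_ [set true]) := h measurableT; rewrite setTI; apply.
Qed.

Lemma measurable_lt_set d (T : measurableType d) (R : realType) (f g : T -> R) :
  measurable_fun setT f -> measurable_fun setT g -> measurable [set w | f w < g w].
Proof.
move=> mf mg; have h := measurable_fun_ltr mf mg.
by have /(_ [set true]) := h measurableT; rewrite setTI; apply.
Qed.

Section mean.
Context {d : measure_display} {T : measurableType d} {R : realType}.
Variable P : probability T R.
Implicit Types f g : T -> R.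

Definition mean f : \bar R := (\int[P]_w (f w)%:E)%E.

Lemma le_mean f g : measurable_fun setT f -> measurable_fun setT g ->
  (forall w, 0 <= f w) -> (forall w, f w <= g w) -> (mean f <= mean g)%E.
Proof.
move=> mf mg f0 fg; apply: ge0_le_integral => //.
- by move=> w _; rewrite lee_fin.
- exact/measurable_EFinP.
- exact/measurable_EFinP.
- by move=> w _; rewrite lee_fin.
Qed.

Lemma mean_ge0 f : (forall w, 0 <= f w) -> (0 <= mean f)%E.
Proof. by move=> f0; apply: integral_ge0 => w _; rewrite lee_fin. Qed.

Lemma eq_mean f g : f =1 g -> mean f = mean g.
Proof. by move=> fg; apply: eq_integral => w _; rewrite fg. Qed.

Lemma meanD f g : measurable_fun setT f -> measurable_fun setT g ->
  (forall w, 0 <= f w) -> (forall w, 0 <= g w) ->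
  mean (fun w => f w + g w) = (mean f + mean g)%E.
Proof.
move=> mf mg f0 g0; rewrite -ge0_integralD//.
- by move=> w _; rewrite lee_fin.
- exact/measurable_EFinP.
- by move=> w _; rewrite lee_fin.
- exact/measurable_EFinP.
Qed.

Lemma meanZ (c : R) f : 0 <= c -> measurable_fun setT f -> (forall w, 0 <= f w) ->
  mean (fun w => c * f w) = (c%:E * mean f)%E.
Proof.
move=> c0 mf f0; rewrite -ge0_integralZl//.
- exact/measurable_EFinP.
- by move=> w _; rewrite lee_fin.
Qed.

Lemma mean_cst (c : R) : mean (fun=> c) = c%:E.
Proof. by rewrite /mean integral_cst//= probability_setT mule1. Qed.

Lemma mean_sum (I : Type) (s : seq I) (f : I -> T -> R) :
  (forall i, measurable_fun setT (f i)) -> (forall i w, 0 <= f i w) ->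
  mean (fun w => \sum_(i <- s) f i w) = (\sum_(i <- s) mean (f i))%E.
Proof.
move=> mf f0; rewrite /mean -ge0_integral_sum//.
- by apply: eq_integral => w _; rewrite sumEFin.
- by move=> i; exact/measurable_EFinP.
- by move=> i w _; rewrite lee_fin.
Qed.

Lemma markov_mean f (a : R) : measurable_fun setT f -> (forall w, 0 <= f w) -> 0 < a ->
  (P [set w | (a <= f w)%R] <= (a^-1)%:E * mean f)%E.
Proof.
move=> mf f0 a0.
have mA : measurable [set w | a <= f w].
  exact: measurable_le_set.
have E : mean (fun w => a * \1_[set w | a <= f w] w) = (a%:E * P [set w | (a <= f w)%R])%E.
  rewrite meanZ; [|exact: ltW|exact: measurable_indic|by []].
  by rewrite /mean integral_indic// setIT.
rewrite muleC lee_pdivlMr// muleC -E; apply: le_mean => //.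
- by apply: measurable_funM => //; exact: measurable_indic.
- by move=> w; rewrite mulr_ge0// ltW.
move=> w; rewrite indicE; have [h|h] := boolP (a <= f w).
  by rewrite mem_set// mulr1.
by rewrite memNset ?mulr0//; exact/negP.
Qed.

(** The cross term vanishes, as f is centred. With c a function of the other
    variables this is how second moments grow one independent variable at a
    time. *)
Lemma mean_sqr_addl f (c v : R) : measurable_fun setT f ->
  mean f = 0%E -> (mean (fun w => (f w ^+ 2)%R) <= v%:E)%E ->
  (mean (fun w => ((c + f w) ^+ 2)%R) <= (c ^+ 2 + v)%:E)%E.
Proof.
move=> mf f0 fv.
have if2 : P.-integrable setT (fun w => (f w ^+ 2)%:E).
  apply/integrableP; split; first exact/measurable_EFinP/measurable_funX.
  under eq_integral do rewrite gee0_abs ?lee_fin ?sqr_ge0//.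
  exact: le_lt_trans fv (ltry _).
have i1 (r : R) : P.-integrable setT (fun=> r%:E) by exact: finite_measure_integrable_cst.
have iF : P.-integrable setT (EFin \o f).
  apply: (@le_integrable _ _ _ _ _ measurableT _ (fun w => (1 + f w ^+ 2)%:E)).
  - exact/measurable_EFinP.
  - move=> w _ /=; rewrite lee_fin [leRHS]ger0_norm ?addr_ge0 ?sqr_ge0//.
    have := sqr_ge0 (`|f w| - 1); rewrite sqrrB1 real_normK ?num_real//.
    by have := normr_ge0 (f w); rewrite mulr2n; lra.
  - exact: (integrableD measurableT (i1 1) if2).
have i2 : P.-integrable setT (fun w => ((2 * c)%:E * (f w)%:E)%E) by exact: integrableZl.
rewrite /mean [leLHS](_ : _ =
    \int[P]_w (((c ^+ 2)%:E + (2 * c)%:E * (f w)%:E) + (f w ^+ 2)%:E))%E; last first.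
  by apply: eq_integral => w _; rewrite -EFinM -!EFinD; congr EFin; ring.
rewrite (integralD measurableT (integrableD measurableT (i1 _) i2) if2).
rewrite (integralD measurableT (i1 _) i2).
rewrite integral_cst//= probability_setT mule1 integralZl// -/(mean f) f0 mule0 adde0.
by rewrite EFinD leeD2l.
Qed.

End mean.

Section power_mean.
Context {d : measure_display} {T : measurableType d} {R : realType}.
Variable mu : probability T R.

Lemma measurable_tcons2 n (t : n.-tuple T) :
  measurable_fun setT (fun x : T => tcons (x, t)).
Proof.
exact: (measurableT_comp (measurable_tcons (n := n)) (pair2_measurable t)).
Qed.

Lemma power_tonelli n (f : n.+1.-tuple T -> \bar R) : measurable_fun setT f ->
  (forall t, 0 <= f t)%E ->
  (\int[power_prob mu n.+1]_t f t =
   \int[power_prob mu n]_t \int[mu]_x f (tcons (x, t)))%E.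
Proof.
move=> mf f0; rewrite /= ge0_integral_distribution//.
rewrite fubini_tonelli2//; first exact: measurableT_comp.
by move=> x; exact: f0.
Qed.

Lemma power_tonelli' n (f : n.+1.-tuple T -> \bar R) : measurable_fun setT f ->
  (forall t, 0 <= f t)%E ->
  (\int[power_prob mu n.+1]_t f t =
   \int[mu]_x \int[power_prob mu n]_t f (tcons (x, t)))%E.
Proof.
move=> mf f0; rewrite /= ge0_integral_distribution//.
rewrite fubini_tonelli1//; first exact: measurableT_comp.
by move=> x; exact: f0.
Qed.

(** The induction step of the moment bounds: by Tonelli it suffices to integrate
    the first variable with the others frozen. *)
Lemma le_mean_power n (f : n.+1.-tuple T -> R) (g : n.-tuple T -> R) :
  measurable_fun setT f -> measurable_fun setT g ->
  (forall t, 0 <= f t) -> (forall t, (mean mu (fun x => f (tcons (x, t))) <= (g t)%:E)%E) ->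
  (mean (power_prob mu n.+1) f <= mean (power_prob mu n) g)%E.
Proof.
move=> mf mg f0 fg; rewrite /mean power_tonelli//; last exact/measurable_EFinP.
apply: ge0_le_integral => //.
- by move=> t _; apply: integral_ge0 => x _; rewrite lee_fin.
- apply: (measurable_fun_fubini_tonelli_G (m1 := mu) (EFin \o (f \o @tcons _ T n))) => //.
    apply/measurable_EFinP; exact: measurableT_comp.
  by move=> x /=; rewrite lee_fin.
- exact/measurable_EFinP.
- by move=> t _; exact: fg.
Qed.

Lemma mean_power_tnth n (f : T -> R) (i : 'I_n) : measurable_fun setT f ->
  (forall x, 0 <= f x) ->
  mean (power_prob mu n) (fun t => f (tnth t i)) = mean mu f.
Proof.
move=> mf f0; elim: n i => [[]//|n IH] i.
rewrite /mean power_tonelli; [|apply/measurable_EFinP; apply: (measurableT_comp mf);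
  exact: measurable_tnth|by move=> t; rewrite lee_fin].
have [j ->|->] := unliftP ord0 i; last first.
  transitivity (\int[power_prob mu n]_t mean mu f)%E.
    by apply: eq_integral => t _; apply: eq_integral => x _; rewrite tnth0.
  by rewrite integral_cst//= probability_setT mule1.
rewrite -[RHS](IH j); apply: eq_integral => t _.
transitivity (mean mu (fun=> f (tnth t j))); last exact: mean_cst.
by apply: eq_integral => x _; rewrite tnthS.
Qed.

End power_mean.

(** * Second moments of sums *)

Section bounded_sums.
Context {d : measure_display} {T : measurableType d} {R : realType}.
Variable nu : probability T R.

Lemma measurable_weighted_sum n (c : 'I_n -> R) (f : T -> R) :
  measurable_fun setT f ->
  measurable_fun setT (fun t : n.-tuple T => \sum_i c i * f (tnth t i)).
Proof.
move=> mf; apply: measurable_sum => i; apply: measurable_funM; first exact: measurable_cst.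
by apply: (measurableT_comp mf); exact: measurable_tnth.
Qed.

(** The variances of independent centred terms add up, and each is at most
    b ^ 2. *)
Lemma mean_bounded_sum_sqr n (c : 'I_n -> R) (y : T -> R) (b e : R) :
  (forall i, c i ^+ 2 <= 1) -> measurable_fun setT y -> (forall x, 0 <= y x <= b) ->
  mean nu y = e%:E ->
  (mean (power_prob nu n) (fun t => ((\sum_i c i * (y (tnth t i) - e)) ^+ 2)%R) <=
     (n%:R * b ^+ 2)%:E)%E.
Proof.
move=> + my yb ye.
have y0 x : 0 <= y x by case/andP: (yb x).
have e0 : 0 <= e by rewrite -lee_fin -ye; exact: mean_ge0.
have eb : e <= b.
  rewrite -lee_fin -ye -(mean_cst nu b); apply: le_mean => //.
  by move=> x; case/andP: (yb x).
have mye : measurable_fun setT (fun x => y x - e).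
  by apply: measurable_funB => //; exact: measurable_cst.
have iy : nu.-integrable setT (EFin \o y).
  apply/integrableP; split; first exact/measurable_EFinP.
  under eq_integral do rewrite gee0_abs ?lee_fin//.
  by rewrite -/(mean nu y) ye ltry.
elim: n c => [|n IH] c c1.
  rewrite (@eq_mean _ _ _ _ _ (fun=> 0)) ?mean_cst ?mul0r// => t.
  by rewrite big_ord0 expr0n.
pose c' i := c (lift ord0 i).
apply: (@le_trans _ _ (mean (power_prob nu n)
    (fun t => (\sum_i c' i * (y (tnth t i) - e)) ^+ 2 + b ^+ 2))).
  apply: le_mean_power.
  - apply: measurable_funX; exact: (measurable_weighted_sum c mye).
  - apply: measurable_funD; last exact: measurable_cst.
    by apply: measurable_funX; exact: (measurable_weighted_sum c' mye).
  - by move=> t; exact: sqr_ge0.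
  move=> t.
  rewrite (@eq_mean _ _ _ _ _
    (fun x => (\sum_i c' i * (y (tnth t i) - e) + c ord0 * (y x - e)) ^+ 2)); last first.
    move=> x; congr (_ ^+ 2); rewrite big_ord_recl tnth0 addrC; congr (_ + _).
    by apply: eq_bigr => i _; rewrite tnthS.
  apply: mean_sqr_addl.
  - by apply: measurable_funM => //; exact: measurable_cst.
  - rewrite /mean; under eq_integral do rewrite EFinM EFinB.
    have ie : nu.-integrable setT (fun=> e%:E) by exact: finite_measure_integrable_cst.
    rewrite integralZl//; last exact: (integrableB measurableT iy ie).
    by rewrite (integralB measurableT iy ie) -!/(mean nu _) mean_cst ye subee// mule0.
  rewrite -(mean_cst nu (b ^+ 2)); apply: le_mean.
  - by apply: measurable_funX; apply: measurable_funM => //; exact: measurable_cst.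
  - exact: measurable_cst.
  - by move=> x; exact: sqr_ge0.
  move=> x; rewrite exprMn -[leRHS]mul1r ler_pM ?sqr_ge0//.
  by have /andP[] := yb x => ? ?; nra.
rewrite meanD; [|by apply: measurable_funX; exact: (measurable_weighted_sum c' mye)
  |exact: measurable_cst|by move=> t; exact: sqr_ge0|by move=> t; exact: sqr_ge0].
rewrite mean_cst -natr1 mulrDl mul1r EFinD leeD2r//; apply: IH => i; exact: c1.
Qed.

End bounded_sums.

(** The moment conditions at a fixed dimension; v bounds the coordinate
    variances. *)
Record white_law (R : realType) (D : nat) (nu : probability (D.-tuple R) R) (v : R) : Prop := {
  white_ge0 : 0 <= v;
  white_centred : forall a, mean nu (fun x => tnth x a) = 0%E;
  white_norm : mean nu (fun x => nsq (vec x)) = 1%E;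
  white_uncorrelated : forall a b, a != b -> mean nu (fun x => tnth x a * tnth x b) = 0%E;
  white_small : forall a, (mean nu (fun x => (tnth x a ^+ 2)%R) <= v%:E)%E
}.

Definition lin_sum (R : realType) (D n : nat) (c : 'I_n -> R) (t : n.-tuple (D.-tuple R)) :
  'rV[R]_D := \sum_i c i *: vec (tnth t i).

Section vec_measurable.
Context {R : realType} {D : nat}.

Lemma nsq_vecE (x : D.-tuple R) : nsq (vec x) = \sum_a tnth x a ^+ 2.
Proof. by apply: eq_bigr => a _; rewrite mxE. Qed.

Lemma dot_vecE (x : D.-tuple R) s : dot (vec x) s = \sum_a tnth x a * s ord0 a.
Proof. by apply: eq_bigr => a _; rewrite mxE. Qed.

Lemma measurable_nsq_vec : measurable_fun setT (fun x : D.-tuple R => nsq (vec x)).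
Proof.
rewrite (_ : (fun _ => _) = (fun x : D.-tuple R => \sum_a tnth x a ^+ 2)); last first.
  by apply/funext => x; rewrite nsq_vecE.
by apply: measurable_sum => a; apply: measurable_funX; exact: measurable_tnth.
Qed.

Lemma measurable_dot_vec s : measurable_fun setT (fun x : D.-tuple R => dot (vec x) s).
Proof.
rewrite (_ : (fun _ => _) = (fun x : D.-tuple R => \sum_a tnth x a * s ord0 a)); last first.
  by apply/funext => x; rewrite dot_vecE.
apply: measurable_sum => a; apply: measurable_funM; first exact: measurable_tnth.
exact: measurable_cst.
Qed.

(** Measurability for the product Borel structure of the row vectors. *)
Definition coord_measurable d (T : measurableType d) (f : T -> 'rV[R]_D) : Prop :=
  forall a, measurable_fun setT (fun w => f w ord0 a).

Lemma measurable_nsq d (T : measurableType d) (f : T -> 'rV[R]_D) :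
  coord_measurable f -> measurable_fun setT (fun w => nsq (f w)).
Proof. by move=> mf; apply: measurable_sum => a; apply: measurable_funX. Qed.

Lemma measurable_eucl_norm d (T : measurableType d) (f : T -> 'rV[R]_D) :
  coord_measurable f -> measurable_fun setT (fun w => eucl_norm (f w)).
Proof.
move=> mf; apply: (measurableT_comp _ (measurable_nsq mf)).
apply: continuous_measurable_fun; exact: sqrt_continuous.
Qed.

Lemma coord_measurable_lin_sum n (c : 'I_n -> R) (u : 'rV[R]_D) :
  coord_measurable (fun t => u + lin_sum c t).
Proof.
move=> a; rewrite (_ : (fun _ => _) = (fun t : n.-tuple (D.-tuple R) =>
    u ord0 a + \sum_i c i * tnth (tnth t i) a)); last first.
  by apply/funext => t; rewrite mxE summxE; congr (_ + _); apply: eq_bigr => i _; rewrite !mxE.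
apply: measurable_funD; first exact: measurable_cst.
apply: measurable_sum => i; apply: measurable_funM; first exact: measurable_cst.
exact: (measurableT_comp (measurable_tnth a) (measurable_tnth i)).
Qed.

Lemma measurable_nsq_lin_sum n (c : 'I_n -> R) :
  measurable_fun setT (fun t : n.-tuple (D.-tuple R) => nsq (lin_sum c t)).
Proof.
rewrite (_ : (fun _ => _) = (fun t => nsq (0 + lin_sum c t))).
  exact: measurable_nsq (coord_measurable_lin_sum c 0).
by apply/funext => t; rewrite add0r.
Qed.

Lemma lin_sum_cons n (c : 'I_n.+1 -> R) (x : D.-tuple R) (t : n.-tuple (D.-tuple R)) :
  lin_sum c (tcons (x, t)) = c ord0 *: vec x + lin_sum (fun i => c (lift ord0 i)) t.
Proof.
rewrite /lin_sum big_ord_recl tnth0; congr (_ + _).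
by apply: eq_bigr => i _; rewrite tnthS.
Qed.

End vec_measurable.

Section white_law.
Context {R : realType} {D : nat} {nu : probability (D.-tuple R) R} {v : R}.
Hypothesis nuP : white_law nu v.

Lemma white_integrable_nsq : nu.-integrable setT (fun x => (nsq (vec x))%:E).
Proof.
apply/integrableP; split; first by apply/measurable_EFinP; exact: measurable_nsq_vec.
under eq_integral do rewrite gee0_abs ?lee_fin ?nsq_ge0//.
by rewrite -/(mean nu _) (white_norm nuP) ltry.
Qed.

Lemma white_integrable_mul a b : nu.-integrable setT (fun x => (tnth x a * tnth x b)%:E).
Proof.
apply: (le_integrable measurableT _ _ white_integrable_nsq).
  by apply/measurable_EFinP; apply: measurable_funM; exact: measurable_tnth.
move=> x _ /=; rewrite lee_fin [leRHS]ger0_norm ?nsq_ge0// nsq_vecE normrM.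
have sq c : tnth x c ^+ 2 <= \sum_a tnth x a ^+ 2.
  by rewrite (bigD1 c)//= lerDl sumr_ge0// => e _; exact: sqr_ge0.
have := sq a; have := sq b; rewrite -!(real_normK (num_real (tnth x _))).
have := sqr_ge0 (`|tnth x a| - `|tnth x b|); rewrite sqrrB mulr2n; lra.
Qed.

Lemma white_integrable_tnth a : nu.-integrable setT (fun x => (tnth x a)%:E).
Proof.
have i1 : nu.-integrable setT (fun=> 1%:E) by exact: finite_measure_integrable_cst.
apply: (le_integrable measurableT _ _ (integrableD measurableT i1 (white_integrable_mul a a))).
  by apply/measurable_EFinP; exact: measurable_tnth.
move=> x _ /=; rewrite lee_fin [leRHS]ger0_norm -expr2 ?addr_ge0 ?sqr_ge0//.
have := sqr_ge0 (`|tnth x a| - 1); rewrite sqrrB1 real_normK ?num_real//.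
by have := normr_ge0 (tnth x a); rewrite mulr2n; lra.
Qed.

Lemma white_integrable_dot s : nu.-integrable setT (fun x => (dot (vec x) s)%:E).
Proof.
rewrite (_ : (fun _ => _) = (fun x : D.-tuple R => \sum_a (s ord0 a)%:E * (tnth x a)%:E)%E).
  by apply: integrable_sum => // a _; apply: integrableZl => //; exact: white_integrable_tnth.
by apply/funext => x; rewrite dot_vecE -sumEFin; apply: eq_bigr => a _; rewrite -EFinM mulrC.
Qed.

Lemma mean_dot s : mean nu (fun x => dot (vec x) s) = 0%E.
Proof.
rewrite /mean (_ : (fun _ => _) = (fun x : D.-tuple R => \sum_a (s ord0 a)%:E * (tnth x a)%:E)%E).
  rewrite integral_sum//; last first.
    by move=> a; apply: integrableZl => //; exact: white_integrable_tnth.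
  rewrite big1// => a _; rewrite integralZl//; last exact: white_integrable_tnth.
  by rewrite -/(mean nu _) (white_centred nuP) mule0.
by apply/funext => x; rewrite dot_vecE -sumEFin; apply: eq_bigr => a _; rewrite -EFinM mulrC.
Qed.

(** The only place where both the decorrelation and the smallness of the
    coordinates enter. *)
Lemma mean_dot_sqr s : (mean nu (fun x => (dot (vec x) s ^+ 2)%R) <= (v * nsq s)%:E)%E.
Proof.
rewrite /mean (_ : (fun _ => _) = (fun x : D.-tuple R =>
    \sum_a \sum_b (s ord0 a * s ord0 b)%:E * (tnth x a * tnth x b)%:E)%E); last first.
  apply/funext => x; rewrite dot_vecE expr2 mulr_suml -sumEFin; apply: eq_bigr => a _.
  rewrite mulr_sumr -sumEFin; apply: eq_bigr => b _.
  by rewrite -EFinM; congr EFin; ring.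
have iab a b : nu.-integrable setT
    (fun x => (s ord0 a * s ord0 b)%:E * (tnth x a * tnth x b)%:E)%E.
  by apply: integrableZl => //; exact: white_integrable_mul.
rewrite integral_sum//; last by move=> a; apply: integrable_sum.
rewrite [leRHS](_ : _ = \sum_a (s ord0 a ^+ 2)%:E * v%:E)%E; last first.
  rewrite /nsq mulr_sumr -sumEFin; apply: eq_bigr => a _.
  by rewrite -EFinM; congr EFin; ring.
apply: lee_sum => a _; rewrite integral_sum// (bigD1 a)//= big1 => [|b ba].
  rewrite adde0 integralZl//; last exact: white_integrable_mul.
  rewrite -expr2; apply: lee_wpmul2l; first by rewrite lee_fin sqr_ge0.
  exact: (white_small nuP a).
rewrite integralZl//; last exact: white_integrable_mul.
by have := white_uncorrelated nuP (a := a) (b := b); rewrite /mean eq_sym => ->//; rewrite mule0.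
Qed.

Lemma mean_nsq_lin_sum n (c : 'I_n -> R) : (forall i, c i ^+ 2 <= 1) ->
  (mean (power_prob nu n) (fun t => nsq (lin_sum c t)) <= n%:R%:E)%E.
Proof.
elim: n c => [|n IH] c c1.
  rewrite (@eq_mean _ _ _ _ _ (fun=> 0)) ?mean_cst// => t.
  by rewrite /lin_sum big_ord0 nsq0.
have mS := measurable_nsq_lin_sum (D := D) (fun i => c (lift ord0 i)).
apply: (@le_trans _ _ (mean (power_prob nu n)
    (fun t => 1 + nsq (lin_sum (fun i => c (lift ord0 i)) t)))).
  apply: le_mean_power => //.
  - exact: measurable_nsq_lin_sum.
  - by apply: measurable_funD => //; exact: measurable_cst.
  - by move=> t; exact: nsq_ge0.
  move=> t; set S := lin_sum _ t.
  rewrite /mean (_ : (fun _ => _) = (fun x => ((c ord0 ^+ 2)%:E * (nsq (vec x))%:E +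
      (2 * c ord0)%:E * (dot (vec x) S)%:E) + (nsq S)%:E)%E); last first.
    apply/funext => x; rewrite lin_sum_cons nsqD nsqZ dotZl -!EFinM -!EFinD.
    by congr EFin; rewrite -/S; ring.
  have i1 : nu.-integrable setT (fun x => (c ord0 ^+ 2)%:E * (nsq (vec x))%:E)%E.
    by apply: integrableZl => //; exact: white_integrable_nsq.
  have i2 : nu.-integrable setT (fun x => (2 * c ord0)%:E * (dot (vec x) S)%:E)%E.
    by apply: integrableZl => //; exact: white_integrable_dot.
  have i3 : nu.-integrable setT (fun x => (nsq S)%:E) by exact: finite_measure_integrable_cst.
  rewrite (integralD measurableT (integrableD measurableT i1 i2) i3).
  rewrite (integralD measurableT i1 i2).
  rewrite integralZl//; last exact: white_integrable_nsq.
  rewrite integralZl//; last exact: white_integrable_dot.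
  rewrite -!/(mean nu _) mean_dot (white_norm nuP) mule0 adde0 mule1 mean_cst -EFinD lee_fin.
  by rewrite lerD2r c1.
rewrite meanD//; last by move=> t; exact: nsq_ge0.
rewrite mean_cst -natr1 [n%:R + 1]addrC EFinD leeD2l//; apply: IH => i; exact: c1.
Qed.

(** Off-diagonal part of the squared norm of a sum. *)
Definition cross_part n (c : 'I_n -> R) (t : n.-tuple (D.-tuple R)) : R :=
  nsq (lin_sum c t) - \sum_i c i ^+ 2 * nsq (vec (tnth t i)).

Lemma measurable_cross_part n (c : 'I_n -> R) : measurable_fun setT (cross_part c).
Proof.
apply: measurable_funB; first exact: measurable_nsq_lin_sum.
exact: (measurable_weighted_sum (fun i => c i ^+ 2) measurable_nsq_vec).
Qed.

(** A new step x changes the cross part by 2 <x, S>, a centred variable for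
    which [mean_dot_sqr] gives variance at most v times the squared norm of the
    sum S of the others, itself at most n on average. *)
Lemma mean_cross_part_sqr n (c : 'I_n -> R) : (forall i, c i ^+ 2 <= 1) ->
  (mean (power_prob nu n) (fun t => (cross_part c t ^+ 2)%R) <= (4 * v * n%:R ^+ 2)%:E)%E.
Proof.
have v0 := white_ge0 nuP.
elim: n c => [|n IH] c c1.
  rewrite (@eq_mean _ _ _ _ _ (fun=> 0)) ?mean_cst ?lee_fin ?mulr_ge0// => t.
  by rewrite /cross_part /lin_sum !big_ord0 nsq0 subrr expr0n.
pose c' i := c (lift ord0 i).
have mS := measurable_nsq_lin_sum (D := D) c'.
have mC := measurable_cross_part c'.
apply: (@le_trans _ _ (mean (power_prob nu n)
    (fun t => cross_part c' t ^+ 2 + 4 * v * nsq (lin_sum c' t)))).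
  apply: le_mean_power.
  - by apply: measurable_funX; exact: measurable_cross_part.
  - apply: measurable_funD; first exact: measurable_funX.
    by apply: measurable_funM => //; exact: measurable_cst.
  - by move=> t; exact: sqr_ge0.
  move=> t; set S := lin_sum c' t.
  rewrite (@eq_mean _ _ _ _ _
    (fun x => (cross_part c' t + 2 * c ord0 * dot (vec x) S) ^+ 2)); last first.
    move=> x; congr (_ ^+ 2); rewrite /cross_part lin_sum_cons -/c' -/S nsqD nsqZ dotZl.
    rewrite big_ord_recl tnth0.
    under eq_bigr do rewrite tnthS.
    by rewrite /c'; ring.
  apply: mean_sqr_addl.
  - by apply: measurable_funM; [exact: measurable_cst|exact: measurable_dot_vec].
  - rewrite /mean; under eq_integral do rewrite EFinM.
    rewrite integralZl//; last exact: white_integrable_dot.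
    by rewrite -/(mean nu _) mean_dot mule0.
  rewrite (@eq_mean _ _ _ _ _ (fun x => (4 * c ord0 ^+ 2) * dot (vec x) S ^+ 2)); last first.
    by move=> x; ring.
  rewrite meanZ; [|by rewrite mulr_ge0// sqr_ge0
    |by apply: measurable_funX; exact: measurable_dot_vec|by move=> x; exact: sqr_ge0].
  apply: (@le_trans _ _ ((4 * c ord0 ^+ 2)%:E * (v * nsq S)%:E)%E).
    by apply: lee_wpmul2l; [rewrite lee_fin mulr_ge0 ?sqr_ge0|exact: mean_dot_sqr].
  rewrite -EFinM lee_fin.
  have : c ord0 ^+ 2 * (v * nsq S) <= 1 * (v * nsq S).
    by rewrite ler_wpM2r ?c1// mulr_ge0// nsq_ge0.
  lra.
rewrite meanD; [|exact: measurable_funX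
  |by apply: measurable_funM => //; exact: measurable_cst
  |by move=> t; exact: sqr_ge0
  |by move=> t; rewrite mulr_ge0 ?nsq_ge0// mulr_ge0].
rewrite meanZ ?mulr_ge0//; last by move=> t; exact: nsq_ge0.
apply: (@le_trans _ _ ((4 * v * n%:R ^+ 2)%:E + (4 * v)%:E * n%:R%:E)%E).
  apply: leeD; first by apply: IH => i; exact: c1.
  apply: lee_wpmul2l; first by rewrite lee_fin mulr_ge0.
  by apply: mean_nsq_lin_sum => i; exact: c1.
rewrite -EFinM -EFinD lee_fin -mulrDr ler_wpM2l ?mulr_ge0// -natr1.
by have := ler0n R n; nra.
Qed.

End white_law.

(** * Symmetrization *)

Section max_norm.
Context {R : realType} {D : nat} (J : finType) (Q : pred J).

(** The translations u are there for the induction on the number of variables. *)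
Definition max_norm n (u : J -> 'rV[R]_D) (c : J -> 'I_n -> R)
    (t : n.-tuple (D.-tuple R)) : R :=
  \big[Num.max/0]_(p | Q p) eucl_norm (u p + lin_sum (c p) t).

Lemma max_norm_ge0 n u (c : J -> 'I_n -> R) t : 0 <= max_norm u c t.
Proof. by rewrite /max_norm; elim/big_ind : _ => // [x y x0 y0|p _];
  [rewrite le_max x0|exact: eucl_norm_ge0]. Qed.

Lemma measurable_max_norm n u (c : J -> 'I_n -> R) : measurable_fun setT (max_norm u c).
Proof.
rewrite /max_norm; elim: (index_enum J) => [|p L IH].
  rewrite (_ : (fun _ => _) = cst 0); first exact: measurable_cst.
  by apply/funext => t; rewrite big_nil.
case Qp : (Q p); last first.
  rewrite (_ : (fun _ => _) = (fun t => \big[Num.max/0]_(p <- L | Q p)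
    eucl_norm (u p + lin_sum (c p) t)))//.
  by apply/funext => t; rewrite big_cons Qp.
rewrite (_ : (fun _ => _) = (fun t => eucl_norm (u p + lin_sum (c p) t)) \max
   (fun t => \big[Num.max/0]_(p <- L | Q p) eucl_norm (u p + lin_sum (c p) t))).
  apply: measurable_maxr => //; apply: measurable_eucl_norm.
  exact: coord_measurable_lin_sum.
by apply/funext => t; rewrite big_cons Qp.
Qed.

End max_norm.

Section symmetrization.
Context {R : realType} {D : nat} {nu : probability (D.-tuple R) R} {v : R}.
Hypothesis nuP : white_law nu v.
Variables (J : finType) (Q : pred J).

(** Test u + c x against the unit vector of direction u: the contribution of x
    is centred. *)
Lemma eucl_norm_le_mean (u : 'rV[R]_D) (c : R) :
  ((eucl_norm u)%:E <= mean nu (fun x => eucl_norm (u + c *: vec x)))%E.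
Proof.
have [u0|u0] := eqVneq (eucl_norm u) 0.
  by rewrite u0; apply: mean_ge0 => x; exact: eucl_norm_ge0.
have up : 0 < eucl_norm u by rewrite lt_def u0 eucl_norm_ge0.
pose e := (eucl_norm u)^-1 *: u.
have e1 : eucl_norm e = 1 by rewrite eucl_normZ ger0_norm ?invr_ge0 ?(ltW up)// mulVf.
have ue : dot u e = eucl_norm u.
  rewrite dotC dotZl dotvv -eucl_norm_sqr; field; exact: u0.
have mf : measurable_fun setT (fun x => c * dot (vec x) e).
  by apply: measurable_funM; [exact: measurable_cst|exact: measurable_dot_vec].
have ic : nu.-integrable setT (fun=> (eucl_norm u)%:E) by exact: finite_measure_integrable_cst.
have id : nu.-integrable setT (fun x => (c%:E * (dot (vec x) e)%:E)%E).
  by apply: integrableZl => //; exact: (white_integrable_dot nuP).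
have -> : (eucl_norm u)%:E = (\int[nu]_x (eucl_norm u + c * dot (vec x) e)%:E)%E.
  under eq_integral do rewrite EFinD EFinM.
  rewrite (integralD measurableT ic id) integralZl//; last exact: (white_integrable_dot nuP).
  by rewrite -!/(mean nu _) (mean_dot nuP) mule0 adde0 mean_cst.
apply: le_trans (lee_abs _) _.
apply: le_trans (le_abse_integral _ measurableT _) _.
  by apply/measurable_EFinP/measurable_funD => //; exact: measurable_cst.
rewrite -[leLHS]/(mean nu (fun x => `|eucl_norm u + c * dot (vec x) e|)).
apply: le_mean => [|||x].
- by apply: (measurableT_comp (@normr_measurable _ _)); apply: measurable_funD => //;
    exact: measurable_cst.
- apply: measurable_eucl_norm => a.
  rewrite (_ : (fun _ => _) = (fun x => u ord0 a + c * tnth x a)); last first.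
    by apply/funext => x; rewrite !mxE.
  apply: measurable_funD; first exact: measurable_cst.
  by apply: measurable_funM; [exact: measurable_cst|exact: measurable_tnth].
- by move=> x; exact: normr_ge0.
rewrite -ue -dotZl -dotDl.
by apply: (le_trans (dot_eucl_norm _ _)); rewrite e1 mulr1.
Qed.

(** Jensen: forgetting some of the centred variables decreases the mean of a
    maximum of norms. *)
Lemma mean_max_norm_mask n (mask : 'I_n -> bool) (u : J -> 'rV[R]_D) (c : J -> 'I_n -> R) :
  (mean (power_prob nu n) (max_norm Q u (fun p i => (mask i)%:R * c p i)%R) <=
   mean (power_prob nu n) (max_norm Q u c))%E.
Proof.
elim: n mask u c => [|n IH] mask u c.
  rewrite (@eq_mean _ _ _ _ _ (max_norm Q u c))// => t.
  by apply: eq_bigr => p _; rewrite /lin_sum !big_ord0.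
pose mask' i := mask (lift ord0 i); pose c' p i := c p (lift ord0 i).
have cons (e : J -> 'I_n.+1 -> R) x t : max_norm Q u e (tcons (x, t)) =
    max_norm Q (fun p => u p + e p ord0 *: vec x) (fun p i => e p (lift ord0 i)) t.
  by apply: eq_bigr => p _; rewrite lin_sum_cons addrA.
have mE (e : J -> 'I_n.+1 -> R) : measurable_fun setT (fun t => (max_norm Q u e t)%:E).
  by apply/measurable_EFinP; exact: measurable_max_norm.
have e0 (e : J -> 'I_n.+1 -> R) t : (0 <= (max_norm Q u e t)%:E)%E.
  by rewrite lee_fin max_norm_ge0.
case m0 : (mask ord0).
  rewrite [leLHS](power_tonelli' nu (mE _) (e0 _)) [leRHS](power_tonelli' nu (mE _) (e0 _)).
  apply: ge0_le_integral.
  - exact: measurableT.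
  - by move=> x _; apply: integral_ge0 => t _; rewrite lee_fin max_norm_ge0.
  - apply: (measurable_fun_fubini_tonelli_F (m2 := power_prob nu n)
      (EFin \o (max_norm Q u (fun p i => (mask i)%:R * c p i) \o @tcons _ _ n))) => //.
      by apply/measurable_EFinP; apply: measurableT_comp => //; exact: measurable_max_norm.
    by move=> x /=; rewrite lee_fin max_norm_ge0.
  - apply: (measurable_fun_fubini_tonelli_F (m2 := power_prob nu n)
      (EFin \o (max_norm Q u c \o @tcons _ _ n))) => //.
      by apply/measurable_EFinP; apply: measurableT_comp => //; exact: measurable_max_norm.
    by move=> x /=; rewrite lee_fin max_norm_ge0.
  move=> x _.
  have := IH mask' (fun p => u p + c p ord0 *: vec x) c'.
  rewrite /mean; under eq_integral => t _.
    rewrite (_ : max_norm _ _ _ t = max_norm Q u (fun p i => (mask i)%:R * c p i) (tcons (x, t))).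
    over.
    by rewrite cons m0 /=; congr max_norm; apply/funext => p; rewrite mul1r.
  move=> /le_trans; apply; rewrite le_eqVlt; apply/orP; left; apply/eqP.
  by apply: eq_integral => t _; rewrite cons.
apply: (@le_trans _ _ (mean (power_prob nu n) (max_norm Q u c'))).
  apply: le_trans (IH mask' u c').
  apply: le_mean_power; try exact: measurable_max_norm.
    by move=> t; exact: max_norm_ge0.
  move=> t; rewrite (@eq_mean _ _ _ _ _
    (fun=> max_norm Q u (fun p i => (mask' i)%:R * c' p i) t)) ?mean_cst// => x.
  rewrite cons m0; congr max_norm.
  by apply/funext => p; rewrite mul0r scale0r addr0.
rewrite [leRHS](power_tonelli nu (mE _) (e0 _)); apply: ge0_le_integral => //.
- by move=> t _; rewrite lee_fin max_norm_ge0.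
- by apply/measurable_EFinP; exact: measurable_max_norm.
- apply: (measurable_fun_fubini_tonelli_G (m1 := nu) (EFin \o (max_norm Q u c \o @tcons _ _ n))) => //.
    by apply/measurable_EFinP; apply: measurableT_comp => //; exact: measurable_max_norm.
  by move=> x /=; rewrite lee_fin max_norm_ge0.
move=> t _; rewrite {1}/max_norm.
elim/big_ind : _ => [|x y hx hy|p Qp].
- by apply: integral_ge0 => x _; rewrite lee_fin max_norm_ge0.
- by rewrite /Order.max; case: ifP.
apply: (le_trans (eucl_norm_le_mean _ (c p ord0))).
apply: le_mean.
- apply: measurable_eucl_norm => a.
  rewrite (_ : (fun _ => _) = (fun x => (u p + lin_sum (c' p) t) ord0 a + c p ord0 * tnth x a)); last first.
    by apply/funext => x; rewrite !mxE.
  apply: measurable_funD; first exact: measurable_cst.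
  by apply: measurable_funM; [exact: measurable_cst|exact: measurable_tnth].
- apply: (measurableT_comp (measurable_max_norm Q u c)).
  exact: measurable_tcons2.
- by move=> x; exact: eucl_norm_ge0.
move=> x; rewrite cons addrAC.
exact: (le_bigmax_cond 0 (fun p => eucl_norm (u p + c p ord0 *: vec x + lin_sum (c' p) t))).
Qed.

(** Split the variables by sign: each half is a mask, up to a global sign, both
    of the original sum and of the signed one. *)
Lemma mean_max_norm_sign n (c : J -> 'I_n -> R) (s : n.-tuple bool) :
  (mean (power_prob nu n) (max_norm Q (fun=> 0%R) c) <=
   2%:E * mean (power_prob nu n) (max_norm Q (fun=> 0%R) (fun p i => (-1) ^+ tnth s i * c p i)%R))%E.
Proof.
pose e p i := (-1) ^+ tnth s i * c p i.
pose mp (b : bool) (t : n.-tuple (D.-tuple R)) :=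
  max_norm Q (fun=> 0) (fun p i => (tnth s i == b)%:R * e p i) t.
have mmp b : measurable_fun setT (mp b) by exact: measurable_max_norm.
have mp0 b t : 0 <= mp b t by exact: max_norm_ge0.
apply: (@le_trans _ _ (mean (power_prob nu n) (fun t => mp false t + mp true t))).
  apply: le_mean.
  - exact: measurable_max_norm.
  - exact: measurable_funD.
  - by move=> t; exact: max_norm_ge0.
  move=> t; apply/bigmax_leP; split; first by rewrite addr_ge0.
  move=> p Qp.
  have -> : 0 + lin_sum (c p) t = (0 + lin_sum (fun i => (tnth s i == false)%:R * e p i) t)
      - (0 + lin_sum (fun i => (tnth s i == true)%:R * e p i) t).
    rewrite !add0r /lin_sum -sumrN -big_split; apply: eq_bigr => i _ /=.
    rewrite -scalerBl /e; congr (_ *: _).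
    by case: (tnth s i); rewrite /= ?expr1 ?expr0; ring.
  rewrite (le_trans (eucl_normD _ _))// eucl_normN lerD//.
    exact: (le_bigmax_cond 0 (fun p => eucl_norm (0 + lin_sum (fun i => (tnth s i == false)%:R * e p i) t))).
  exact: (le_bigmax_cond 0 (fun p => eucl_norm (0 + lin_sum (fun i => (tnth s i == true)%:R * e p i) t))).
rewrite meanD// (_ : 2%:E = 1 + 1)%E; last by rewrite -EFinD.
rewrite ge0_muleDl ?lee_fin// mul1e.
by apply: leeD; exact: mean_max_norm_mask.
Qed.

End symmetrization.

Section mean_sign_avg.
Context {d : measure_display} {T : measurableType d} {R : realType}.
Variable P : probability T R.

Lemma measurable_sign_avg n (f : n.-tuple bool -> T -> R) :
  (forall s, measurable_fun setT (f s)) ->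
  measurable_fun setT (fun w => sign_avg (fun s => f s w)).
Proof.
elim: n f => [|n IH] f mf /=; first exact: mf.
apply: (IH (fun s w => (f [tuple of true :: s] w + f [tuple of false :: s] w) / 2)) => s.
apply: measurable_funM; last exact: measurable_cst.
by apply: measurable_funD; exact: mf.
Qed.

(** A bound valid for each choice of signs holds for their average. *)
Lemma le_mean_sign_avg n (f : n.-tuple bool -> T -> R) (a : \bar R) :
  (0 <= a)%E -> (forall s, measurable_fun setT (f s)) -> (forall s w, 0 <= f s w) ->
  (forall s, (a <= mean P (f s))%E) -> (a <= mean P (fun w => sign_avg (fun s => f s w)))%E.
Proof.
move=> a0.
have half : ((2^-1)%:E * (a + a))%E = a.
  case: a a0 => [r|//|//] r0; first by rewrite -EFinD -EFinM; congr EFin; field.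
  by rewrite addye// mulry gtr0_sg ?invr_gt0// mul1e.
elim: n f => [|n IH] f mf f0 af /=; first exact: af.
apply: (IH (fun s w => (f [tuple of true :: s] w + f [tuple of false :: s] w) / 2)).
- move=> s; apply: measurable_funM; last exact: measurable_cst.
  by apply: measurable_funD; exact: mf.
- by move=> s w; rewrite divr_ge0 ?addr_ge0.
move=> s; rewrite (@eq_mean _ _ _ _ _
  (fun w => 2^-1 * (f [tuple of true :: s] w + f [tuple of false :: s] w))); last first.
  by move=> w; rewrite mulrC.
rewrite meanZ; [|by []|by apply: measurable_funD; exact: mf|by move=> w; rewrite addr_ge0].
rewrite meanD//; apply: (@le_trans _ _ ((2^-1)%:E * (a + a))%E); last first.
  by apply: lee_wpmul2l; [rewrite lee_fin|apply: leeD; exact: af].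
by rewrite half.
Qed.

End mean_sign_avg.

(** * Equicontinuity of sums *)

Definition tail_nsq (R : realType) (D : nat) (b : R) (x : D.-tuple R) : R :=
  nsq (vec x) * (b < nsq (vec x))%R%:R.

Section tail.
Context {R : realType} {D : nat}.

Lemma tail_nsq_ge0 b (x : D.-tuple R) : 0 <= tail_nsq b x.
Proof. by rewrite /tail_nsq mulr_ge0// nsq_ge0. Qed.

Lemma tail_nsqE b (x : D.-tuple R) :
  tail_nsq b x = nsq (vec x) * \1_[set y : D.-tuple R | b < nsq (vec y)] x.
Proof.
rewrite /tail_nsq indicE; have [h|h] := boolP (b < nsq (vec x)); first by rewrite mem_set.
by rewrite memNset//; exact/negP.
Qed.

Lemma measurable_tail_nsq b : measurable_fun setT (@tail_nsq R D b).
Proof.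
rewrite (_ : tail_nsq b = (fun x : D.-tuple R => nsq (vec x) *
   \1_[set y : D.-tuple R | b < nsq (vec y)] x)); last by apply/funext => x; exact: tail_nsqE.
apply: measurable_funM; first exact: measurable_nsq_vec.
apply: measurable_indic; apply: measurable_lt_set; last exact: measurable_nsq_vec.
exact: measurable_cst.
Qed.

Lemma nsq_le_tail b (x : D.-tuple R) : 0 <= b -> nsq (vec x) - tail_nsq b x <= b.
Proof.
by move=> b0; rewrite /tail_nsq; case: ltP => h; rewrite ?mulr1 ?subrr// mulr0 subr0.
Qed.

Lemma tail_le_nsq b (x : D.-tuple R) : tail_nsq b x <= nsq (vec x).
Proof. by rewrite /tail_nsq ler_piMr ?nsq_ge0//; case: (_ < _). Qed.

End tail.

Lemma mean_sum_tnth (R : realType) (D n : nat) (nu : probability (D.-tuple R) R)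
    (f : D.-tuple R -> R) (e : R) : measurable_fun setT f -> (forall x, 0 <= f x) ->
  (mean nu f <= e%:E)%E ->
  (mean (power_prob nu n) (fun t => (\sum_i f (tnth t i))%R) <= (n%:R * e)%:E)%E.
Proof.
move=> mf f0 fe; rewrite mean_sum//; last first.
  by move=> i; apply: (measurableT_comp mf); exact: measurable_tnth.
apply: (@le_trans _ _ (\sum_(i < n) e%:E)%E).
  by apply: lee_sum => i _; rewrite mean_power_tnth.
by rewrite sumEFin sumr_const card_ord mulr_natl.
Qed.

(** Equicontinuity of the normalized sums. Distances between index sets are
    measured by counting, which does not see large summands: a truncation
    level b mediates between the counting distance and the random one used for
    chaining. *)
Lemma mean_modulus (R : realType) (V : nat) : exists2 C : R, 0 <= C &
  forall (D n : nat) (nu : probability (D.-tuple R) R) (v : R) (F : {set {set 'I_n}})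
    (k0 : nat) (b h q e : R),
  white_law nu v -> VC_at_most V F -> (0 < n)%N -> 0 < q -> 0 <= b -> 0 <= h ->
  (mean nu (tail_nsq b) <= e%:E)%E ->
  (mean (power_prob nu n)
    (max_norm [pred p : {set 'I_n} * {set 'I_n} | [&& p.1 \in F, p.2 \in F &
       (wdist (fun=> 1) p.1 p.2 <= h * n%:R)%R]]
     (fun=> 0%R) (fun p => set_diff R p.1 p.2)) <=
   (C * Num.sqrt n%:R * (2^-1 ^+ k0 + 2 ^+ k0 * (q + (b * h + e) / q)))%:E)%E.
Proof.
have [C C0 chainP] := chaining R V.
exists (4 * C) => [|D n nu v F k0 b h q e nuP FV n0 q0 b0 h0 tail_e]; first by rewrite mulr_ge0.
have e0 : 0 <= e.
  by rewrite -lee_fin; apply: le_trans tail_e; apply: mean_ge0 => x; exact: tail_nsq_ge0.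
have nR0 : 0 < n%:R :> R by rewrite ltr0n.
set rt := Num.sqrt n%:R.
have rt0 : 0 < rt by rewrite sqrtr_gt0.
have rt2 : rt ^+ 2 = n%:R by rewrite sqr_sqrtr// ltW.
set Q := [pred p | _].
case: (set_0Vmem F) => [F0|[A0 A0F]].
  rewrite (@eq_mean _ _ _ _ _ (fun=> 0)).
    rewrite mean_cst lee_fin !mulr_ge0 ?(ltW rt0)// addr_ge0 ?exprn_ge0// mulr_ge0 ?exprn_ge0//.
    by rewrite addr_ge0 ?(ltW q0)// divr_ge0 ?(ltW q0)// addr_ge0// mulr_ge0.
  by move=> t; rewrite /max_norm big_pred0// => p; rewrite /Q /= F0 inE.
pose W (t : n.-tuple (D.-tuple R)) := \sum_i nsq (vec (tnth t i)).
pose L (t : n.-tuple (D.-tuple R)) := \sum_i tail_nsq b (tnth t i).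
have W0 t : 0 <= W t by apply: sumr_ge0 => i _; exact: nsq_ge0.
have L0 t : 0 <= L t by apply: sumr_ge0 => i _; exact: tail_nsq_ge0.
pose w t := rt * (1 + W t / n%:R).
pose r t := rt * (q + (b * h + L t / n%:R) / q).
pose sg (s : n.-tuple bool) (p : {set 'I_n} * {set 'I_n}) i : R :=
  (-1) ^+ tnth s i * set_diff R p.1 p.2 i.
have bound t : sign_avg (fun s => 2 * max_norm Q (fun=> 0) (sg s) t) <=
    2 * C * (2^-1 ^+ k0 * w t + 2 ^+ k0 * r t).
  have wt0 : 0 < w t by rewrite mulr_gt0// ltr_wpDr// divr_ge0// ltW.
  have y0 : 0 <= b * h + L t / n%:R by rewrite addr_ge0 ?divr_ge0 ?(ltW nR0)// mulr_ge0.
  have rt'0 : 0 < r t by rewrite mulr_gt0// ltr_wpDr// divr_ge0// ltW.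
  have Ww : \sum_i nsq (vec (tnth t i)) <= w t ^+ 2.
    rewrite -/(W t) /w exprMn rt2.
    have -> : n%:R * (1 + W t / n%:R) ^+ 2 = n%:R + 2 * W t + (W t) ^+ 2 / n%:R.
      by field; rewrite gt_eqF.
    have : 0 <= (W t) ^+ 2 / n%:R by rewrite divr_ge0 ?sqr_ge0// ltW.
    by have := W0 t; lra.
  have Lr : b * h * n%:R + L t <= r t ^+ 2.
    rewrite /r exprMn rt2; set y := b * h + _ in y0 *.
    have -> : b * h * n%:R + L t = n%:R * y by rewrite /y; field; rewrite gt_eqF.
    rewrite ler_wpM2l ?(ltW nR0)//.
    have -> : (q + y / q) ^+ 2 = q ^+ 2 + 2 * y + (y / q) ^+ 2 by field; rewrite gt_eqF.
    by have := sqr_ge0 q; have := sqr_ge0 (y / q); lra.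
  have [H [HP Havg]] := chainP n D (fun i => vec (tnth t i)) F (w t) (r t) k0 FV wt0 rt'0 Ww.
  rewrite sign_avgZ -mulrA ler_wpM2l//; apply: le_trans Havg.
  apply: le_sign_avg => s; apply/bigmax_leP; split.
    apply: le_trans (HP s A0 A0 A0F A0F _); first exact: eucl_norm_ge0.
    by rewrite wdistxx sqr_ge0.
  move=> -[A B] /and3P[/= AF BF AB].
  have -> : 0 + lin_sum (sg s (A, B)) t = sign_diff (fun i => vec (tnth t i)) A B s.
    by rewrite add0r; apply: eq_bigr => i _; rewrite scalerA.
  apply: HP => //; apply: le_trans Lr.
  apply: (@le_trans _ _ (b * wdist (fun=> 1) A B + L t)); last first.
    by rewrite lerD2r -mulrA ler_wpM2l.
  rewrite /wdist mulr_sumr /L [X in _ + X](bigID (fun i => (i \in A) != (i \in B))) /= addrA.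
  rewrite -big_split /= ler_wpDr ?sumr_ge0// => [i _|]; first exact: tail_nsq_ge0.
  apply: ler_sum => i _; rewrite mulr1 -lerBlDr.
  exact: nsq_le_tail.
pose K0 := C * rt * (2^-1 ^+ k0 + 2 ^+ k0 * (q + b * h / q)).
pose K1 := C * rt * 2^-1 ^+ k0 / n%:R.
pose K2 := C * rt * 2 ^+ k0 / (q * n%:R).
have boundE t : 2 * C * (2^-1 ^+ k0 * w t + 2 ^+ k0 * r t) = 2 * K0 + 2 * K1 * W t + 2 * K2 * L t.
  by rewrite /w /r /K0 /K1 /K2; field; rewrite !gt_eqF.
have K00 : 0 <= K0.
  by rewrite !mulr_ge0 ?(ltW rt0)// addr_ge0 ?exprn_ge0// mulr_ge0 ?exprn_ge0//
     addr_ge0 ?(ltW q0)// divr_ge0 ?(ltW q0)// mulr_ge0.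
have K10 : 0 <= K1 by rewrite divr_ge0 ?(ltW nR0)// !mulr_ge0 ?exprn_ge0// ltW.
have K20 : 0 <= K2 by rewrite divr_ge0 ?mulr_ge0 ?exprn_ge0// ltW.
have mW : measurable_fun setT W.
  apply: measurable_sum => i; apply: (measurableT_comp measurable_nsq_vec).
  exact: measurable_tnth.
have mL : measurable_fun setT L.
  apply: measurable_sum => i; apply: (measurableT_comp (measurable_tail_nsq b)).
  exact: measurable_tnth.
have mf (s : n.-tuple bool) :
    measurable_fun setT (fun t => 2 * max_norm Q (fun=> (0 : 'rV[R]_D)) (sg s) t).
  by apply: measurable_funM; [exact: measurable_cst|exact: measurable_max_norm].
have f0 (s : n.-tuple bool) (t : n.-tuple (D.-tuple R)) :
    0 <= 2 * max_norm Q (fun=> 0) (sg s) t by rewrite mulr_ge0// max_norm_ge0.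
have mKW : measurable_fun setT (fun t => 2 * K1 * W t).
  by apply: measurable_funM => //; exact: measurable_cst.
have mKL : measurable_fun setT (fun t => 2 * K2 * L t).
  by apply: measurable_funM => //; exact: measurable_cst.
have mK0W : measurable_fun setT (fun t => 2 * K0 + 2 * K1 * W t).
  by apply: measurable_funD => //; exact: measurable_cst.
have KW0 t : 0 <= 2 * K1 * W t by rewrite mulr_ge0// mulr_ge0.
have K0W0 t : 0 <= 2 * K0 + 2 * K1 * W t by rewrite addr_ge0// mulr_ge0.
have KL0 t : 0 <= 2 * K2 * L t by rewrite mulr_ge0// mulr_ge0.
apply: (@le_trans _ _ (mean (power_prob nu n)
    (fun t => sign_avg (fun s => 2 * max_norm Q (fun=> 0) (sg s) t)))).
  apply: le_mean_sign_avg => //.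
    by apply: mean_ge0 => t; exact: max_norm_ge0.
  move=> s; rewrite meanZ//; last by move=> t; exact: max_norm_ge0.
    exact: (mean_max_norm_sign nuP).
  exact: measurable_max_norm.
apply: (@le_trans _ _ (mean (power_prob nu n) (fun t => 2 * K0 + 2 * K1 * W t + 2 * K2 * L t))).
  apply: le_mean.
  - exact: measurable_sign_avg.
  - exact: measurable_funD.
  - by move=> t; exact: sign_avg_ge0.
  - by move=> t; rewrite -boundE; exact: bound.
rewrite meanD// meanD; [|exact: measurable_cst|by []|by move=> t; rewrite mulr_ge0|by []].
have K1'0 : 0 <= 2 * K1 by rewrite mulr_ge0.
have K2'0 : 0 <= 2 * K2 by rewrite mulr_ge0.
rewrite mean_cst (meanZ _ K1'0 mW W0) (meanZ _ K2'0 mL L0).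
have EW : (mean (power_prob nu n) W <= (n%:R * 1)%:E)%E.
  apply: (mean_sum_tnth n measurable_nsq_vec) => [x|]; first exact: nsq_ge0.
  by rewrite (white_norm nuP).
have EL : (mean (power_prob nu n) L <= (n%:R * e)%:E)%E.
  by apply: (mean_sum_tnth n (measurable_tail_nsq b)) => // x; exact: tail_nsq_ge0.
apply: (@le_trans _ _ ((2 * K0)%:E + (2 * K1)%:E * (n%:R * 1)%:E + (2 * K2)%:E * (n%:R * e)%:E)%E).
  by apply: leeD; [apply: leeD => //|]; apply: lee_wpmul2l => //; rewrite lee_fin mulr_ge0.
rewrite -!EFinM -!EFinD lee_fin /K0 /K1 /K2.
have -> : 2 * (C * rt * (2^-1 ^+ k0 + 2 ^+ k0 * (q + b * h / q))) +
  2 * (C * rt * 2^-1 ^+ k0 / n%:R) * (n%:R * 1) + 2 * (C * rt * 2 ^+ k0 / (q * n%:R)) * (n%:R * e) =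
  2 * (C * rt) * (2 * 2^-1 ^+ k0 + 2 ^+ k0 * (q + (b * h + e) / q)).
  by field; rewrite !gt_eqF.
have : 0 <= 2 * (C * rt) * (2 ^+ k0 * (q + (b * h + e) / q)).
  rewrite !mulr_ge0 ?exprn_ge0 ?(ltW rt0)// addr_ge0 ?(ltW q0)// divr_ge0 ?(ltW q0)//.
  by rewrite addr_ge0// mulr_ge0.
lra.
Qed.

(** * Uniform near-isometry *)

(** Since |x - y| <= x + y; it turns bounds on squares into bounds on norms. *)
Lemma sqr_sub_le (R : realType) (x y : R) : 0 <= x -> 0 <= y ->
  (x - y) ^+ 2 <= `|x ^+ 2 - y ^+ 2|.
Proof.
move=> x0 y0; rewrite subr_sqr normrM -real_normK ?num_real// expr2.
rewrite ler_wpM2l// (ger0_norm (addr_ge0 x0 y0)).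
by rewrite (le_trans (ler_normB _ _))// !ger0_norm.
Qed.

Lemma sqrt_sub_le (R : realType) (x y e : R) : 0 <= x -> 0 <= y -> 0 <= e ->
  `|x ^+ 2 - y ^+ 2| <= e ^+ 2 -> `|x - y| <= e.
Proof.
move=> x0 y0 e0 h; rewrite -(@ler_pXn2r _ 2)// ?nnegrE// real_normK ?num_real//.
by rewrite (le_trans (sqr_sub_le x0 y0)).
Qed.

Lemma half_expr_small (R : realType) (e : R) : 0 < e -> exists k, 2^-1 ^+ k <= e.
Proof.
move=> e0; exists (Num.bound e^-1); have ei : 0 <= e^-1 by rewrite invr_ge0 ltW.
rewrite exprVn invf_ple ?posrE ?exprn_gt0//.
apply: (le_trans (ltW (archi_boundP ei))).
by rewrite -natrX ler_nat ltnW// ltn_expl.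
Qed.

Lemma lin_sum_set_diffD (R : realType) (D n : nat) (B A C : {set 'I_n})
    (t : n.-tuple (D.-tuple R)) :
  lin_sum (set_diff R A C) t = lin_sum (set_diff R A B) t + lin_sum (set_diff R B C) t.
Proof.
rewrite /lin_sum -big_split; apply: eq_bigr => i _ /=; rewrite -scalerDl.
by congr (_ *: _); rewrite /set_diff; ring.
Qed.

Lemma sum_sqr_set_diff (R : realType) (n : nat) (A B : {set 'I_n}) :
  \sum_i set_diff R A B i ^+ 2 = wdist (fun=> 1) A B.
Proof.
rewrite /wdist [RHS]big_mkcond; apply: eq_bigr => i _; rewrite set_diff_sqr.
by case: ifP.
Qed.

(** The squared norm of a sum differs from the number of its terms by the
    off-diagonal part, the fluctuation of the truncated diagonal, and the
    diagonal tail. *)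
Lemma nsq_lin_sum_split (R : realType) (D n : nat) (A B : {set 'I_n}) (b ey ez : R)
    (t : n.-tuple (D.-tuple R)) : ey + ez = 1 -> 0 <= ez ->
  `|nsq (lin_sum (set_diff R A B) t) - wdist (fun=> 1) A B| <=
  `|cross_part (set_diff R A B) t| +
  `|\sum_i set_diff R A B i ^+ 2 * (nsq (vec (tnth t i)) - tail_nsq b (tnth t i) - ey)| +
  (\sum_i tail_nsq b (tnth t i) + n%:R * ez).
Proof.
move=> eyz ez0; rewrite -sum_sqr_set_diff.
set c := set_diff R A B; set Y := \sum_i _ * (_ - ey).
pose Z := \sum_i c i ^+ 2 * (tail_nsq b (tnth t i) - ez).
have -> : nsq (lin_sum c t) - \sum_i c i ^+ 2 = cross_part c t + Y + Z.
  rewrite /cross_part /Y /Z -addrA -big_split /= -addrA; congr (_ + _).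
  rewrite -!sumrN -big_split /=; apply: eq_bigr => i _.
  have -> : ey = 1 - ez by lra.
  by ring.
apply: (le_trans (ler_normD _ _)); apply: lerD; first exact: ler_normD.
apply: (le_trans (ler_norm_sum _ _ _)).
rewrite -[X in X%:R * ez](card_ord n) mulr_natl -sumr_const -big_split /=.
apply: ler_sum => i _.
rewrite normrM ger0_norm ?sqr_ge0// set_diff_sqr.
have z0 := tail_nsq_ge0 b (tnth t i).
apply: (@le_trans _ _ `|tail_nsq b (tnth t i) - ez|).
  by rewrite ler_piMl// lern1 leq_b1.
by rewrite (le_trans (ler_normB _ _))// !ger0_norm.
Qed.

(** By [mean_modulus] the sums over all pairs are close to those over the pairs
    of a net, and the net is finite, of size independent of n, so that
    Chebyshev's inequality applies to each pair. The order of the constants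
    matters: the tail e is chosen first, then the truncation level b may be
    chosen for it, then the scale of the net and the thresholds N0 and v0. A
    single function f collects all the errors, so that one use of Markov's
    inequality bounds the exceptional set. *)
Theorem uniform_isometry (R : realType) (V : nat) (r eta : R) : 0 < r -> 0 < eta ->
  exists2 e : R, 0 < e & forall b, 0 <= b -> exists (N0 : nat) (v0 : R), 0 < v0 /\
  forall (D n : nat) (nu : probability (D.-tuple R) R) (v : R) (F : {set {set 'I_n}}),
    white_law nu v -> v <= v0 -> (N0 <= n)%N -> (0 < n)%N ->
    (mean nu (tail_nsq b) <= e%:E)%E -> VC_at_most V F ->
  exists B, [/\ measurable B, (power_prob nu n B <= eta%:E)%E &
    forall t, ~ B t -> {in F &, forall A A',
      `|eucl_norm (lin_sum (set_diff R A A') t) - Num.sqrt (wdist (fun=> 1) A A')|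
        <= r * Num.sqrt n%:R}].
Proof.
move=> r0 eta0.
have [C C0 modP] := mean_modulus R V.
have [bV [_ netP]] := vc_net V.
pose K := 4 * C / r; have K0 : 0 <= K by rewrite divr_ge0 ?mulr_ge0// ltW.
pose u := eta / (8 * (K + 1)).
have K1 : 0 < K + 1 by rewrite ltr_wpDl.
have u0 : 0 < u by rewrite divr_gt0// mulr_gt0.
have [k0 k0u] := half_expr_small u0.
pose q := 2^-1 ^+ k0 * u; have q0 : 0 < q by rewrite mulr_gt0// exprn_gt0.
have q2u : 2 ^+ k0 * q = u by rewrite /q mulrA -exprMn divff// expr1n mul1r.
pose a := r ^+ 2 / 16; have a0 : 0 < a by rewrite divr_gt0// exprn_gt0.
exists (Num.min (q ^+ 2) (Num.min (a / 8) (a * eta / 16))).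
  by rewrite !lt_min exprn_gt0//= !divr_gt0// mulr_gt0.
set e := Num.min _ _.
have [eq2 ea eae] : [/\ e <= q ^+ 2, e <= a / 8 & e <= a * eta / 16].
  by split; rewrite /e !ge_min lexx ?orbT.
move=> b b0.
have [k1 hq] : exists k1, 16^-1 ^+ k1 <= Num.min (q ^+ 2 / (b + 1)) (r ^+ 2 / 32).
  have : 0 < Num.min (q ^+ 2 / (b + 1)) (r ^+ 2 / 32).
    by rewrite lt_min !divr_gt0 ?exprn_gt0// ltr_wpDl.
  move=> /half_expr_small[k hk]; exists k; apply: le_trans hk.
  by rewrite lerXn2r ?nnegrE//; lra.
set h := 16^-1 ^+ k1 in hq.
have h0 : 0 <= h by rewrite exprn_ge0.
have [bhq hr] : b * h <= q ^+ 2 /\ h <= r ^+ 2 / 32.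
  move: hq; rewrite le_min => /andP[hb ->]; split => //.
  move: hb; rewrite ler_pdivlMr ?ltr_wpDl// => hb.
  by apply: le_trans hb; rewrite mulrDr mulr1 [b * h]mulrC lerDl.
have [M [M0 ME]] : exists M : R, 0 < M /\ (2 ^ (bV * k1) * 2 ^ (bV * k1))%N%:R = M.
  by exists (2 ^ (bV * k1) * 2 ^ (bV * k1))%N%:R; rewrite ltr0n muln_gt0 !expn_gt0.
exists (Num.bound (8 * 16 * M * b ^+ 2 / (a ^+ 2 * eta))), (a ^+ 2 * eta / (8 * (8 * 8) * M)).
split; first by rewrite divr_gt0 ?mulr_gt0 ?exprn_gt0.
move=> D n nu v F nuP vv0 Nn n0 tail_e FV.
have nR0 : 0 < n%:R :> R by rewrite ltr0n.
have rt0 : 0 < Num.sqrt n%:R :> R by rewrite sqrtr_gt0.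
have rt2 : (Num.sqrt n%:R) ^+ 2 = n%:R :> R by rewrite sqr_sqrtr// ltW.
have w1n : \sum_(i < n) (1 : R) <= n%:R by rewrite sumr_const card_ord.
have [G [GF cG GP]] := netP R _ F (fun=> 1) n%:R k1 FV (fun=> ler01) w1n.
have GP' : {in F, forall A, exists2 A', A' \in G & wdist (fun=> 1) A A' <= h * n%:R} by [].
set Q : pred ({set 'I_n} * {set 'I_n}) :=
  [pred p | [&& p.1 \in F, p.2 \in F & wdist (fun=> 1) p.1 p.2 <= h * n%:R]].
have modn := modP D n nu v F k0 b h q e nuP FV n0 q0 b0 h0 tail_e.
pose y (x : D.-tuple R) := nsq (vec x) - tail_nsq b x.
have my : measurable_fun setT y.
  by apply: measurable_funB; [exact: measurable_nsq_vec|exact: measurable_tail_nsq].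
have y0 x : 0 <= y x by rewrite subr_ge0 tail_le_nsq.
have yb x : 0 <= y x <= b by rewrite y0 nsq_le_tail.
have e0 : 0 <= e.
  by rewrite -lee_fin; apply: le_trans tail_e; apply: mean_ge0 => x; exact: tail_nsq_ge0.
have [ey [ez [Ey eyz ez0 eze]]] : exists ey ez : R, [/\ mean nu y = ey%:E, ey + ez = 1,
    0 <= ez & ez <= e].
  have := white_norm nuP; rewrite (@eq_mean _ _ _ _ _ (fun x => y x + tail_nsq b x)); last first.
    by move=> x; rewrite /y subrK.
  rewrite meanD//; [|exact: measurable_tail_nsq|by move=> x; exact: tail_nsq_ge0].
  have := mean_ge0 nu (tail_nsq_ge0 (D := D) b); have := mean_ge0 nu y0; move: tail_e.
  case: (mean nu (tail_nsq b)) => [ez| |]//; case: (mean nu y) => [ey| |]// eze _ ez0 [eyz].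
  by exists ey, ez; split => //; rewrite -lee_fin.
pose L (t : n.-tuple (D.-tuple R)) := \sum_i tail_nsq b (tnth t i).
pose Y (p : {set 'I_n} * {set 'I_n}) (t : n.-tuple (D.-tuple R)) :=
  \sum_i set_diff R p.1 p.2 i ^+ 2 * (y (tnth t i) - ey).
pose X (p : {set 'I_n} * {set 'I_n}) (t : n.-tuple (D.-tuple R)) :=
  cross_part (set_diff R p.1 p.2) t.
pose mx := max_norm Q (fun=> (0 : 'rV[R]_D)) (fun p => set_diff R p.1 p.2).
pose GG := enum (finset.setX G G).
pose f3 t := \sum_(p <- GG) (X p t ^+ 2 + Y p t ^+ 2).
pose c1 := (r * Num.sqrt n%:R / 4)^-1; pose c2 := (a * n%:R / 4)^-1.
have c10 : 0 < c1 by rewrite invr_gt0 divr_gt0// mulr_gt0.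
have c20 : 0 < c2 by rewrite invr_gt0 divr_gt0// mulr_gt0.
have mX p : measurable_fun setT (X p) by exact: measurable_cross_part.
have mY p : measurable_fun setT (Y p).
  apply: (measurable_weighted_sum (fun i => set_diff R p.1 p.2 i ^+ 2) (f := fun x => y x - ey)).
  by apply: measurable_funB => //; exact: measurable_cst.
have mL : measurable_fun setT L.
  apply: measurable_sum => i; apply: (measurableT_comp (measurable_tail_nsq b)).
  exact: measurable_tnth.
have mmx : measurable_fun setT mx by exact: measurable_max_norm.
have mXY p : measurable_fun setT (fun t => X p t ^+ 2 + Y p t ^+ 2).
  by apply: measurable_funD; exact: measurable_funX.
have mf3 : measurable_fun setT f3 by exact: measurable_sum.
have mx0 t : 0 <= mx t by exact: max_norm_ge0.
have L0 t : 0 <= L t by apply: sumr_ge0 => i _; exact: tail_nsq_ge0.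
have XY0 p t : 0 <= X p t ^+ 2 + Y p t ^+ 2 by rewrite addr_ge0// sqr_ge0.
have f30 t : 0 <= f3 t by apply: sumr_ge0 => p _; exact: XY0.
pose f t := c1 * mx t + c2 * L t + c2 ^+ 2 * f3 t.
have m1 : measurable_fun setT (fun t => c1 * mx t).
  by apply: measurable_funM => //; exact: measurable_cst.
have m2 : measurable_fun setT (fun t => c2 * L t).
  by apply: measurable_funM => //; exact: measurable_cst.
have m3 : measurable_fun setT (fun t => c2 ^+ 2 * f3 t).
  by apply: measurable_funM => //; exact: measurable_cst.
have p1 t : 0 <= c1 * mx t by rewrite mulr_ge0// ltW.
have p2 t : 0 <= c2 * L t by rewrite mulr_ge0// ltW.
have p3 t : 0 <= c2 ^+ 2 * f3 t by rewrite mulr_ge0// sqr_ge0.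
have m12 : measurable_fun setT (fun t => c1 * mx t + c2 * L t) by exact: measurable_funD.
have p12 t : 0 <= c1 * mx t + c2 * L t by rewrite addr_ge0.
have mf : measurable_fun setT f by exact: measurable_funD.
have pf t : 0 <= f t by rewrite addr_ge0.
exists [set t | 1 <= f t]; split.
- by apply: measurable_le_set => //; exact: measurable_cst.
- apply: (le_trans (markov_mean _ mf pf ltr01)); rewrite invr1 mul1e.
  rewrite /f meanD// meanD// (meanZ _ (ltW c10) mmx mx0) (meanZ _ (ltW c20) mL L0).
  rewrite (meanZ _ (sqr_ge0 c2) mf3 f30).
  have B1 : (c1%:E * mean (power_prob nu n) mx <= (eta / 2)%:E)%E.
    apply: (@le_trans _ _ (c1%:E * (C * Num.sqrt n%:R *
        (2^-1 ^+ k0 + 2 ^+ k0 * (q + (b * h + e) / q)))%:E)%E).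
      by apply: lee_wpmul2l => //; rewrite lee_fin ltW.
    rewrite -EFinM lee_fin /c1.
    have -> : (r * Num.sqrt n%:R / 4)^-1 * (C * Num.sqrt n%:R *
      (2^-1 ^+ k0 + 2 ^+ k0 * (q + (b * h + e) / q))) =
      K * (2^-1 ^+ k0 + 2 ^+ k0 * (q + (b * h + e) / q)).
      by rewrite /K; field; rewrite !gt_eqF.
    have h2 : (b * h + e) / q <= 2 * q by rewrite ler_pdivrMr//; move: bhq eq2; clear; lra.
    have h3 : 2 ^+ k0 * (q + (b * h + e) / q) <= 2 ^+ k0 * (3 * q).
      by rewrite ler_wpM2l ?exprn_ge0//; move: h2; clear; lra.
    have h4 : 2 ^+ k0 * (3 * q) = 3 * u by rewrite -q2u; ring.
    have h5 : 8 * ((K + 1) * u) = eta by rewrite /u; field; rewrite gt_eqF.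
    have : K * (2^-1 ^+ k0 + 2 ^+ k0 * (q + (b * h + e) / q)) <= K * (4 * u).
      by rewrite ler_wpM2l//; move: h3 h4 k0u; clear; lra.
    by move: h5 u0; clear; lra.
  have B2 : (c2%:E * mean (power_prob nu n) L <= (eta / 4)%:E)%E.
    apply: (@le_trans _ _ (c2%:E * (n%:R * e)%:E)%E).
      apply: lee_wpmul2l; first by rewrite lee_fin ltW.
      by apply: (mean_sum_tnth n (measurable_tail_nsq b)) => // x; exact: tail_nsq_ge0.
    rewrite -EFinM lee_fin /c2.
    have -> : (a * n%:R / 4)^-1 * (n%:R * e) = 4 * e / a by field; rewrite !gt_eqF.
    by rewrite ler_pdivrMr//; move: eae; clear; lra.
  have B3 : ((c2 ^+ 2)%:E * mean (power_prob nu n) f3 <= (eta / 4)%:E)%E.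
    apply: (@le_trans _ _ ((c2 ^+ 2)%:E * (M * (4 * v * n%:R ^+ 2 + n%:R * b ^+ 2))%:E)%E).
      apply: lee_wpmul2l; first by rewrite lee_fin sqr_ge0.
      rewrite mean_sum//.
      apply: (@le_trans _ _ (\sum_(p <- GG) (4 * v * n%:R ^+ 2 + n%:R * b ^+ 2)%:E)%E).
        apply: lee_sum => p _; rewrite meanD; [|exact: measurable_funX|exact: measurable_funX|
          by move=> t; exact: sqr_ge0|by move=> t; exact: sqr_ge0].
        have sd i : set_diff R p.1 p.2 i ^+ 2 <= 1 by rewrite set_diff_sqr lern1 leq_b1.
        rewrite EFinD; apply: leeD; first exact: (mean_cross_part_sqr nuP).
        apply: mean_bounded_sum_sqr => // i.
        by rewrite set_diff_sqr; case: (_ != _); rewrite ?expr1n ?expr0n.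
      rewrite sumEFin lee_fin big_const_seq count_predT iter_addr_0 -[X in X <= _]mulr_natl.
      rewrite ler_wpM2r ?addr_ge0 ?mulr_ge0 ?sqr_ge0 ?(white_ge0 nuP)//.
      by rewrite -ME ler_nat /GG -cardE cardsX leq_mul.
    rewrite -EFinM lee_fin /c2.
    have -> : (a * n%:R / 4)^-1 ^+ 2 * (M * (4 * v * n%:R ^+ 2 + n%:R * b ^+ 2)) =
      16 * 4 * M * v / a ^+ 2 + 16 * M * b ^+ 2 / (a ^+ 2 * n%:R).
      by field; rewrite !gt_eqF.
    have : 16 * 4 * M * v / a ^+ 2 <= eta / 8.
      rewrite ler_pdivrMr ?exprn_gt0//.
      by have := vv0; rewrite ler_pdivlMr ?mulr_gt0//; clear; lra.
    have : 16 * M * b ^+ 2 / (a ^+ 2 * n%:R) <= eta / 8.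
      rewrite ler_pdivrMr ?mulr_gt0 ?exprn_gt0//.
      have : 8 * 16 * M * b ^+ 2 / (a ^+ 2 * eta) <= n%:R.
        apply: (@le_trans _ _ (Num.bound (8 * 16 * M * b ^+ 2 / (a ^+ 2 * eta)))%:R).
          by rewrite ltW// archi_boundP// divr_ge0 ?mulr_ge0 ?sqr_ge0// ltW.
        by rewrite ler_nat.
      by rewrite ler_pdivrMr ?mulr_gt0 ?exprn_gt0//; clear; lra.
    by clear; lra.
  apply: (@le_trans _ _ ((eta / 2)%:E + (eta / 4)%:E + (eta / 4)%:E)%E).
    by apply: leeD => //; apply: leeD.
  by rewrite -!EFinD lee_fin; clear; lra.
move=> t /= /negP; rewrite -ltNge => ft1 A B AF BF.
have [s1 s2 s3] : [/\ c1 * mx t < 1, c2 * L t < 1 & c2 ^+ 2 * f3 t < 1].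
  by move: ft1; rewrite /f; have := p1 t; have := p2 t; have := p3 t; clear; split; lra.
have [A' A'G AA'] := GP' A AF; have [B' B'G BB'] := GP' B BF.
have A'F : A' \in F by exact: (fintype.subsetP GF).
have B'F : B' \in F by exact: (fintype.subsetP GF).
have mxt : mx t < r * Num.sqrt n%:R / 4.
  by move: s1; rewrite /c1 mulrC ltr_pdivrMr ?mul1r// divr_gt0// mulr_gt0.
have near p : Q p -> eucl_norm (lin_sum (set_diff R p.1 p.2) t) <= r * Num.sqrt n%:R / 4.
  move=> Qp; apply: le_trans (ltW mxt).
  have := le_bigmax_cond 0 (fun p => eucl_norm (0 + lin_sum (set_diff R p.1 p.2) t)) Qp.
  by rewrite add0r.
have n1 := near (A, A'); have n2 := near (B', B).
rewrite /Q /= AF A'F AA' in n1; rewrite /Q /= BF B'F wdistC BB' in n2.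
have {}n1 := n1 isT; have {}n2 := n2 isT.
have an4 : 0 < a * n%:R / 4 by rewrite divr_gt0// mulr_gt0.
have small (z : R) : c2 ^+ 2 * z ^+ 2 < 1 -> `|z| <= a * n%:R / 4.
  rewrite /c2 exprVn mulrC ltr_pdivrMr ?exprn_gt0// mul1r => hz.
  by rewrite -(@ler_pXn2r _ 2)// ?nnegrE ?(ltW an4)// real_normK ?num_real// ltW.
have [sX sY] : c2 ^+ 2 * X (A', B') t ^+ 2 < 1 /\ c2 ^+ 2 * Y (A', B') t ^+ 2 < 1.
  have le3 : X (A', B') t ^+ 2 + Y (A', B') t ^+ 2 <= f3 t.
    rewrite /f3 (big_rem (A', B')) /=; last by rewrite /GG mem_enum finset.in_setX A'G B'G.
    by rewrite lerDl; apply: sumr_ge0 => p _; exact: XY0.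
  have : c2 ^+ 2 * (X (A', B') t ^+ 2 + Y (A', B') t ^+ 2) < 1.
    by apply: le_lt_trans s3; rewrite ler_wpM2l// sqr_ge0.
  have : 0 <= c2 ^+ 2 * X (A', B') t ^+ 2 by rewrite mulr_ge0 ?sqr_ge0.
  have : 0 <= c2 ^+ 2 * Y (A', B') t ^+ 2 by rewrite mulr_ge0 ?sqr_ge0.
  by rewrite mulrDr; clear; split; lra.
have sL : L t <= a * n%:R / 4.
  by move: s2; rewrite /c2 mulrC ltr_pdivrMr// mul1r => /ltW.
have w10 (S S' : {set 'I_n}) : 0 <= wdist (fun=> 1 : R) S S' by exact: wdist_ge0.
have mid : `|eucl_norm (lin_sum (set_diff R A' B') t) - Num.sqrt (wdist (fun=> 1) A' B')|
    <= r * Num.sqrt n%:R / 4.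
  apply: sqrt_sub_le; [exact: eucl_norm_ge0|exact: sqrtr_ge0|
    by rewrite divr_ge0// mulr_ge0 ?(ltW r0)// ltW|].
  rewrite eucl_norm_sqr sqr_sqrtr//.
  apply: (le_trans (nsq_lin_sum_split A' B' b t eyz ez0)).
  have := small _ sX; have := small _ sY; rewrite /X /Y /y /= => hY hX.
  have -> : (r * Num.sqrt n%:R / 4) ^+ 2 = a * n%:R by rewrite !exprMn rt2 /a; field.
  have : n%:R * ez <= n%:R * (a / 8) by rewrite ler_wpM2l ?(ltW nR0)// (le_trans eze).
  by move: sL hX hY an4; rewrite /L; clear; lra.
have wd : `|Num.sqrt (wdist (fun=> 1) A' B') - Num.sqrt (wdist (fun=> 1) A B)|
    <= r * Num.sqrt n%:R / 4.
  apply: sqrt_sub_le; [exact: sqrtr_ge0|exact: sqrtr_ge0|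
    by rewrite divr_ge0// mulr_ge0 ?(ltW r0)// ltW|].
  rewrite !sqr_sqrtr//.
  have t1 := wdist_triangle A A' B' (w := fun=> (1 : R)) (fun=> ler01).
  have t2 := wdist_triangle B A B' (w := fun=> (1 : R)) (fun=> ler01).
  have t3 := wdist_triangle A' A B (w := fun=> (1 : R)) (fun=> ler01).
  have t4 := wdist_triangle B' A' B (w := fun=> (1 : R)) (fun=> ler01).
  rewrite (wdistC _ A' A) in t1; rewrite (wdistC _ B' B) in t4.
  have -> : (r * Num.sqrt n%:R / 4) ^+ 2 = 2 * (r ^+ 2 / 32) * n%:R by rewrite !exprMn rt2; field.
  have : 2 * h * n%:R <= 2 * (r ^+ 2 / 32) * n%:R by rewrite ler_wpM2r ?(ltW nR0)// ler_wpM2l.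
  by rewrite ler_norml; move: t1 t2 t3 t4 AA' BB'; clear; lra.
have cut : `|eucl_norm (lin_sum (set_diff R A B) t) - eucl_norm (lin_sum (set_diff R A' B') t)|
    <= 2 * (r * Num.sqrt n%:R / 4).
  have e1 : lin_sum (set_diff R A B) t = lin_sum (set_diff R A' B') t +
      (lin_sum (set_diff R A A') t + lin_sum (set_diff R B' B) t).
    by rewrite (lin_sum_set_diffD A') (lin_sum_set_diffD B' A'); rewrite addrCA.
  set S := lin_sum (set_diff R A B) t in e1 *; set S' := lin_sum (set_diff R A' B') t in e1 *.
  set E := _ + lin_sum _ t in e1.
  have hE : eucl_norm E <= 2 * (r * Num.sqrt n%:R / 4).
    by apply: (le_trans (eucl_normD _ _)); move: n1 n2; clear; lra.
  have le1 : eucl_norm S <= eucl_norm S' + eucl_norm E by rewrite e1 eucl_normD.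
  have le2 : eucl_norm S' <= eucl_norm S + eucl_norm E.
    have -> : S' = S - E by rewrite e1 addrK.
    by rewrite -(eucl_normN E) eucl_normD.
  by rewrite ler_norml; move: hE le1 le2; clear; lra.
by move: mid wd cut; rewrite !ler_norml; clear; lra.
Qed.

(** * Independent samples *)

Section rectangles.
Context {d : measure_display} {T : measurableType d} {R : realType}.
Variable mu : probability T R.

Definition rectangle n (B : 'I_n -> set T) : set (n.-tuple T) :=
  [set t | forall i, B i (tnth t i)].

Lemma measurable_rectangle n (B : 'I_n -> set T) :
  (forall i, measurable (B i)) -> measurable (rectangle B).
Proof.
move=> mB; rewrite (_ : rectangle B =
    \bigcap_(i in [set: 'I_n]) ((fun t => tnth t i) @^-1` B i)).
  apply: fin_bigcap_measurable => [|i _]; first exact: finite_finset.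
  by rewrite -[X in measurable X]setTI; apply: measurable_tnth.
by apply/seteqP; split => [t h i _|t h i]; [exact: h|exact: h].
Qed.

Lemma power_prob_rectangle n (B : 'I_n -> set T) : (forall i, measurable (B i)) ->
  power_prob mu n (rectangle B) = (\prod_(i < n) mu (B i))%E.
Proof.
elim: n B => [|n IH] B mB.
  rewrite big_ord0 /= (_ : rectangle B = setT); first exact: probability_setT.
  by apply/seteqP; split => // t _ [].
rewrite big_ord_recl -IH//= /distribution /pushforward.
rewrite (_ : _ @^-1` _ = B ord0 `*` rectangle (fun i => B (lift ord0 i))).
  apply: product_measure1E => //; exact: measurable_rectangle.
apply/seteqP; split => -[x t] /=.
  move=> h; split => [|i]; first by have := h ord0; rewrite tnth0.
  by have := h (lift ord0 i); rewrite tnthS.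
move=> [h0 h] i; have [j ->|->] := unliftP ord0 i; first by rewrite tnthS; exact: h.
by rewrite tnth0.
Qed.

(** Rectangles are stable under intersection and generate the sigma-algebra of
    tuples. *)
Lemma power_prob_unique n (m : {measure set (n.-tuple T) -> \bar R}) :
  (forall B, (forall i, measurable (B i)) ->
     m (rectangle B) = (\prod_(i < n) mu (B i))%E) ->
  forall E, measurable E -> m E = power_prob mu n E.
Proof.
move=> mrect E mE.
pose G := [set E | exists2 B : 'I_n -> set T, (forall i, measurable (B i)) & E = rectangle B].
pose H := [set X | G X /\ X `<=` [set: n.-tuple T]].
have rT : rectangle (fun _ : 'I_n => [set: T]) = setT by apply/seteqP; split.
have mT : m setT = power_prob mu n setT.
  have e1 := mrect (fun=> setT) (fun=> measurableT).
  have e2 := power_prob_rectangle (n := n) (B := fun=> setT) (fun=> measurableT).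
  by rewrite rT in e1 e2; rewrite e1 e2.
apply: (g_sigma_algebra_measure_unique_trace G [set: n.-tuple T]) => //.
- by move=> X [[B mB ->] _]; exact: measurable_rectangle.
- move=> X Y [[B mB ->] _] [[B' mB' ->] _]; split => //.
  exists (fun i => B i `&` B' i); first by move=> i; exact: measurableI.
  apply/seteqP; split => [t [h h'] i|t h]; first by split; [exact: h|exact: h'].
  by split => i; have [] := h i.
- by move=> X [[B mB ->] _]; rewrite mrect//; apply/esym; exact: power_prob_rectangle.
- by rewrite mT probability_setT ltry.
rewrite -/H; move: E mE; apply: smallest_sub; first exact: smallest_sigma_algebra.
rewrite -bigcup_seq; apply: bigcup_sub => i _ _ [Y mY <-].
apply: sub_sigma_algebra; split => //.
exists (fun j => if j == i then Y else setT); first by move=> j; case: ifP.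
apply/seteqP; split => [t [_ h] j|t h]; first by case: eqP => [->|].
by split => //; have := h i; rewrite eqxx.
Qed.

End rectangles.

Section iid_law.
Context {dO : measure_display} {O : measurableType dO} {R : realType}.
Context {dT : measure_display} {T : measurableType dT}.
Variables (P : probability O R) (nu : probability T R) (I : eqType).
Variable X : I -> {RV P >-> T}.

Definition sample n (s : n.-tuple I) (w : O) : n.-tuple T := [tuple X (tnth s j) w | j < n].

Lemma measurable_sample n (s : n.-tuple I) : measurable_fun setT (sample s).
Proof.
apply/measurable_fun_tnthP => i.
rewrite (_ : _ \o _ = X (tnth s i)); first exact: measurable_funPT.
by apply/funext => w; rewrite /= tnth_mktuple.
Qed.

(** On rectangles this is mutual independence; [power_prob_unique] does the
    rest. *)
Lemma sample_law n (s : n.-tuple I) (E : set (n.-tuple T)) : iid nu X -> uniq s -> measurable E ->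
  P (sample s @^-1` E) = power_prob nu n E.
Proof.
move=> [Xnu Xind] us mE.
pose S : {mfun O >-> n.-tuple T} := HB.pack (sample s) (isMeasurableFun.Build _ _ _ _ _ (measurable_sample s)).
rewrite -[LHS]/(distribution P S E).
apply: power_prob_unique => // B mB.
pose B' (i : I) : set T := if insub (index i s) is Some j then B j else setT.
have B's j : B' (tnth s j) = B j.
  rewrite /B' (tnth_nth (tnth s j)) index_uniq ?size_tuple//.
  by case: insubP => [k _ /val_inj ->//|]; rewrite ltn_ord.
rewrite -[LHS]/(P (sample s @^-1` rectangle B)).
rewrite (_ : _ @^-1` _ = \bigcap_(i in [set` (s : seq I)]) (X i @^-1` B' i)).
  rewrite Xind//; last by move=> i; rewrite /B'; case: insub.
  rewrite big_tuple; apply: eq_bigr => j _; rewrite B's.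
  by rewrite -[LHS]/(distribution P (X (tnth s j)) (B j)) Xnu.
apply/seteqP; split => [w h i /= /tnthP[j ->]|w h j].
  by rewrite B's; have := h j; rewrite tnth_mktuple.
by rewrite tnth_mktuple -B's; apply: (h (tnth s j)); exact: mem_tnth.
Qed.

(** Lets the independence of two families, a property of the sigma-algebras
    they generate, apply to events on samples. *)
Lemma sigma_of_sample n (s : n.-tuple I) (E : set (n.-tuple T)) : measurable E ->
  sigma_of X (sample s @^-1` E).
Proof.
move: E; apply: (@smallest_sub _ _ _ [set E | sigma_of X (sample s @^-1` E)]).
  have [s0 sD sU] := smallest_sigma_algebra [set: O]
    (\bigcup_i preimage_set_system [set: O] (X i) measurable).
  split => [|A sA|F sF] /=.
  - by rewrite preimage_set0.
  - by rewrite setTD preimage_setC -setTD; exact: sD.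
  - by rewrite preimage_bigcup; exact: sU.
rewrite -bigcup_seq; apply: bigcup_sub => j _ _ [Y mY <-] /=.
apply: sub_sigma_algebra; exists (tnth s j) => //; exists Y => //.
by apply/seteqP; split => w /=; rewrite tnth_mktuple.
Qed.

End iid_law.

(** * Gluing metric spaces *)

Section gluing.
Context {R : realType} {J T1 T2 : Type}.
Variables (Js : set J) (f : J -> T1) (g : J -> T2).
Variables (rho1 : T1 -> T1 -> R) (rho2 : T2 -> T2 -> R) (r : R).
Local Notation A1 := (f @` Js).
Local Notation A2 := (g @` Js).
Hypothesis Js0 : Js !=set0.
Hypothesis rho1xx : forall x, A1 x -> rho1 x x = 0.
Hypothesis rho1C : forall x y, A1 x -> A1 y -> rho1 x y = rho1 y x.
Hypothesis rho1_tri : forall y x z, A1 x -> A1 y -> A1 z -> rho1 x z <= rho1 x y + rho1 y z.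
Hypothesis rho2xx : forall x, A2 x -> rho2 x x = 0.
Hypothesis rho2C : forall x y, A2 x -> A2 y -> rho2 x y = rho2 y x.
Hypothesis rho2_tri : forall y x z, A2 x -> A2 y -> A2 z -> rho2 x z <= rho2 x y + rho2 y z.
Hypothesis distortion : forall i j, Js i -> Js j ->
  `|rho1 (f i) (f j) - rho2 (g i) (g j)| <= r.

Let bridge x y : set R := [set rho1 x (f i) + r + rho2 (g i) y | i in Js].

Definition glue_dist (u v : T1 + T2) : R :=
  match u, v with
  | inl x, inl x' => rho1 x x'
  | inr y, inr y' => rho2 y y'
  | inl x, inr y | inr y, inl x => inf (bridge x y)
  end.

Definition glue_carrier (u : T1 + T2) : Prop :=
  match u with inl x => A1 x | inr y => A2 y end.

Let Af i : Js i -> A1 (f i). Proof. by move=> Ji; exists i. Qed.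
Let Ag i : Js i -> A2 (g i). Proof. by move=> Ji; exists i. Qed.

Let r0 : 0 <= r.
Proof.
have [i Ji] := Js0; apply: le_trans (distortion Ji Ji); exact: normr_ge0.
Qed.

Let rho1_ge0 x y : A1 x -> A1 y -> 0 <= rho1 x y.
Proof.
move=> Ax Ay; have := rho1_tri Ax Ay Ax; rewrite rho1xx// (rho1C Ay Ax); lra.
Qed.

Let rho2_ge0 x y : A2 x -> A2 y -> 0 <= rho2 x y.
Proof.
move=> Ax Ay; have := rho2_tri Ax Ay Ax; rewrite rho2xx// (rho2C Ay Ax); lra.
Qed.

Let bridge_le x y i : A1 x -> A2 y -> Js i ->
  inf (bridge x y) <= rho1 x (f i) + r + rho2 (g i) y.
Proof.
move=> Ax Ay Ji; apply: ge_inf; last by exists i.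
exists 0 => _ [j Jj <-].
by have := rho1_ge0 Ax (Af Jj); have := rho2_ge0 (Ag Jj) Ay; have := r0; lra.
Qed.

Let le_bridge x y c : (forall i, Js i -> c <= rho1 x (f i) + r + rho2 (g i) y) ->
  c <= inf (bridge x y).
Proof.
move=> h; apply: lb_le_inf; last by move=> _ [i Ji <-]; exact: h.
by have [i Ji] := Js0; exists (rho1 x (f i) + r + rho2 (g i) y); exists i.
Qed.

Let glue_distxx u : glue_carrier u -> glue_dist u u = 0.
Proof. by case: u => [x|y] /= h; [exact: rho1xx|exact: rho2xx]. Qed.

Let glue_distC u v : glue_carrier u -> glue_carrier v -> glue_dist u v = glue_dist v u.
Proof. by case: u v => [x|y] [x'|y'] /= hu hv //; [exact: rho1C|exact: rho2C]. Qed.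

Let tri_llr x x' y : A1 x -> A1 x' -> A2 y ->
  inf (bridge x y) <= rho1 x x' + inf (bridge x' y).
Proof.
move=> Ax Ax' Ay; rewrite -lerBlDl; apply: le_bridge => i Ji.
by have := bridge_le Ax Ay Ji; have := rho1_tri Ax Ax' (Af Ji); lra.
Qed.

Let tri_rrl y y' x : A2 y -> A2 y' -> A1 x ->
  inf (bridge x y) <= rho2 y y' + inf (bridge x y').
Proof.
move=> Ay Ay' Ax; rewrite -lerBlDl; apply: le_bridge => i Ji.
have := bridge_le Ax Ay Ji; have := rho2_tri (Ag Ji) Ay' Ay; rewrite (rho2C Ay Ay'); lra.
Qed.

Let tri_lrl x y x' : A1 x -> A2 y -> A1 x' ->
  rho1 x x' <= inf (bridge x y) + inf (bridge x' y).
Proof.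
move=> Ax Ay Ax'; rewrite -lerBlDr; apply: le_bridge => i Ji.
rewrite lerBlDr -lerBlDl; apply: le_bridge => j Jj.
have := rho1_tri Ax (Af Ji) Ax'; have := rho1_tri (Af Ji) (Af Jj) Ax'.
have := rho2_tri (Ag Ji) Ay (Ag Jj); rewrite (rho2C Ay (Ag Jj)) (rho1C (Af Jj) Ax').
by have := distortion Ji Jj; rewrite ler_norml; have := r0; lra.
Qed.

Let tri_rlr y x y' : A2 y -> A1 x -> A2 y' ->
  rho2 y y' <= inf (bridge x y) + inf (bridge x y').
Proof.
move=> Ay Ax Ay'; rewrite -lerBlDr; apply: le_bridge => i Ji.
rewrite lerBlDr -lerBlDl; apply: le_bridge => j Jj.
have := rho2_tri Ay (Ag Ji) Ay'; have := rho2_tri (Ag Ji) (Ag Jj) Ay'.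
have := rho1_tri (Af Ji) Ax (Af Jj); rewrite (rho1C (Af Ji) Ax) (rho2C Ay (Ag Ji)).
by have := distortion Ji Jj; rewrite ler_norml; have := r0; lra.
Qed.

Let glue_triangle v u w : glue_carrier u -> glue_carrier v -> glue_carrier w ->
  glue_dist u w <= glue_dist u v + glue_dist v w.
Proof.
case: u v w => [x|y] [x'|y'] [x''|y''] /= hu hv hw.
- exact: rho1_tri.
- exact: tri_llr.
- exact: tri_lrl.
- by rewrite (rho2C hv hw) addrC; apply: tri_rrl.
- by rewrite (rho1C hv hw) addrC; apply: tri_llr.
- exact: tri_rlr.
- exact: tri_rrl.
- exact: rho2_tri.
Qed.

(** A correspondence of distortion at most r, here the common parametrization
    by Js, bounds the Gromov-Hausdorff distance: glue the two spaces together,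
    with corresponding points at distance r. *)
Lemma GH_dist_le_distortion : (GH_dist A1 rho1 A2 rho2 <= r%:E)%E.
Proof.
have [i0 Ji0] := Js0.
have [Z [iota [_ iotaP]]] := metric_identification
  (ex_intro (fun u => glue_carrier u) (inl (f i0)) (Af Ji0)) glue_distxx glue_distC glue_triangle.
apply: (@le_trans _ _ (hausdorff_dist ((iota \o inl) @` A1) ((iota \o inr) @` A2))).
  apply: ereal_inf_lbound; exists Z, (iota \o inl), (iota \o inr); split => //.
    by move=> x y Ax Ay; exact: iotaP.
  by move=> x y Ax Ay; exact: iotaP.
have near i : Js i -> mdist (iota (inl (f i))) (iota (inr (g i))) <= r.
  move=> Ji; rewrite iotaP /=; [|exact: Af|exact: Ag].
  by have := bridge_le (Af Ji) (Ag Ji) Ji; rewrite rho1xx ?rho2xx; [lra|exact: Ag|exact: Af].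
rewrite /hausdorff_dist ge_max; apply/andP; split; apply: ge_ereal_sup => _ [_ [_ [i Ji <-] <-] <-].
  apply: (@le_trans _ _ (mdist (iota (inl (f i))) (iota (inr (g i))))%:E); last by rewrite lee_fin near.
  by apply: ereal_inf_lbound; exists (iota (inr (g i))) => //; exists (g i) => //; exact: Ag.
apply: (@le_trans _ _ (mdist (iota (inl (f i))) (iota (inr (g i))))%:E); last by rewrite lee_fin near.
by apply: ereal_inf_lbound; exists (iota (inl (f i))) => //; exists (f i) => //; exact: Af.
Qed.

End gluing.

(** * Traces of a class of sets *)

Definition trace (T : Type) n (t : n.-tuple T) (A : set T) : {set 'I_n} :=
  [set j | `[< A (tnth t j) >]]%SET.

Definition traces (T : Type) (M : set (set T)) n (t : n.-tuple T) : {set {set 'I_n}} :=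
  [set J | `[< exists2 A, M A & trace t A = J >]]%SET.

Lemma trace_in_traces (T : Type) (M : set (set T)) n (t : n.-tuple T) A :
  M A -> trace t A \in traces M t.
Proof. by move=> MA; rewrite inE; apply/asboolP; exists A. Qed.

Lemma tracesP (T : Type) (M : set (set T)) n (t : n.-tuple T) J :
  J \in traces M t -> exists2 A, M A & trace t A = J.
Proof. by rewrite inE => /asboolP. Qed.

Lemma wdist_trace (R : realType) (T : Type) n (t : n.-tuple T) (A A' : set T) :
  wdist (fun=> 1) (trace t A) (trace t A') = \sum_i \1_(A `+` A') (tnth t i) :> R.
Proof.
rewrite /wdist big_mkcond; apply: eq_bigr => i _; rewrite !inE indicE.
have [a|a] := asboolP (A (tnth t i)); have [a'|a'] := asboolP (A' (tnth t i)) => /=.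
- by rewrite memNset//; case; case.
- by rewrite mem_set//; left.
- by rewrite mem_set//; right.
- by rewrite memNset//; case; case.
Qed.

Lemma shatteredS (I : finType) (F : {set {set I}}) (K K' : {set I}) :
  K' \subset K -> shattered F K -> shattered F K'.
Proof.
move=> K'K /shatteredP h; apply/shatteredP => J JK'.
have [A AF AJ] := h J (fintype.subset_trans JK' K'K); exists A => //.
apply/finset.setP => x; have := congr1 (fun S : {set I} => x \in S) AJ.
have [xK'|xK'] := boolP (x \in K'); first by rewrite !inE xK' (fintype.subsetP K'K).
by rewrite !inE (negPf xK') => _; apply/esym/negbTE; apply: contra xK'; exact: (fintype.subsetP JK').
Qed.

(** Traces of a VC class have bounded VC dimension whatever the points: a set
    of indices shattered by the traces points at distinct points of a set
    shattered by the class. *)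
Lemma VC_traces d (T : measurableType d) (M : set (set T)) : VC_class M ->
  exists V, forall n (t : n.-tuple T), VC_at_most V (traces M t).
Proof.
move=> [V _ MV]; exists V => n t K Ksh; rewrite leqNgt; apply/negP => /card_geqP[s [us sz sK]].
pose K' := [set i in s]%SET.
have K'sh : shattered (traces M t) K'.
  by apply: shatteredS Ksh; apply/fintype.subsetP => i; rewrite inE => /sK.
have {}K'sh (J : {set 'I_n}) : J \subset K' ->
    exists2 A, M A & forall i, i \in s -> A (tnth t i) <-> i \in J.
  move=> /(shatteredP _ _ K'sh)[_ /tracesP[A MA <-] AJ]; exists A => // i si.
  by rewrite -AJ !inE si /=; split => [h|/asboolP]//; apply/asboolP.
have inj : {in s &, injective (fun i => tnth t i)}.
  move=> i j si sj tij; apply/eqP; apply: contraT => ij.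
  have [|A _ AJ] := K'sh [set i]%SET; first by rewrite finset.sub1set inE.
  have := (AJ j sj).1; rewrite -tij => /(_ ((AJ i si).2 (finset.set11 _))).
  by rewrite inE eq_sym (negPf ij).
have [i0 _] : exists i0, i0 \in s by case: (s) sz => // i0 s' _; exists i0; rewrite inE eqxx.
pose pt k := tnth t (nth i0 s k).
apply: (MV (pt @` `I_V.+1)).
  apply: inj_card_eq => k l; rewrite !inE /= -sz => ks ls /inj.
  by rewrite !mem_nth// => /(_ isT isT)/eqP; rewrite nth_uniq// => /eqP.
move=> J JI.
have [|A MA AJ] := K'sh [set i in s | `[< J (tnth t i) >]]%SET.
  by apply/fintype.subsetP => i; rewrite !inE => /andP[].
exists A => //; apply/seteqP; split => [_ [[k /= ks <-] Ak]|x Jx].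
  have sk : nth i0 s k \in s by rewrite mem_nth// sz.
  by have /(AJ _ sk).1 := Ak; rewrite !inE => /andP[_ /asboolP].
split; first exact: JI.
have [k /= ks ptk] := JI _ Jx; rewrite -ptk.
have sk : nth i0 s k \in s by rewrite mem_nth// sz.
apply/(AJ _ sk).2; rewrite !inE sk /=; apply/asboolP.
by rewrite -/(pt k) ptk.
Qed.

Section measurable_traces.
Context {d : measure_display} {T : measurableType d} {R : realType}.
Variables (mu : probability T R) (M : set (set T)).

(** There are finitely many possible traces, so the null sets that come with
    them merge into a single one, off which a measurable random family agrees
    with that of the traces. *)
Lemma traces_version n : traces_measurable mu M ->
  exists (F : n.-tuple T -> {set {set 'I_n}}) (N : set (n.-tuple T)),
  [/\ forall G, measurable (F @^-1` [set G]), measurable N, power_prob mu n N = 0%E &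
      forall t, ~ N t -> F t = traces M t].
Proof.
move=> /(_ n)/= h.
have /choice[B BP] (J : {set 'I_n}) : exists B, measurable B /\ (power_prob mu n).-negligible
    ([set x : n.-tuple T | exists2 A, M A & forall j, A (tnth x j) <-> j \in J] `+` B).
  by have [B mB NB] := h J; exists B.
have mB J : measurable (B J) by have [] := BP J.
pose F (t : n.-tuple T) : {set {set 'I_n}} := [set J | `[< B J t >]]%SET.
have : (power_prob mu n).-negligible (\big[setU/set0]_(J : {set 'I_n})
    ([set x : n.-tuple T | exists2 A, M A & forall j, A (tnth x j) <-> j \in J] `+` B J)).
  elim/big_ind : _ => [|X Y|J _]; [exact: negligible_set0|exact: negligibleU|].
  by have [] := BP J.
move=> [N [mN N0 subN]]; exists F, N; split => // [G|t Nt].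
  rewrite (_ : _ @^-1` _ =
      \bigcap_(J in [set: {set 'I_n}]) (if J \in G then B J else ~` B J)).
    apply: fin_bigcap_measurable => [|J _]; first exact: finite_finset.
    by case: ifP => _ //; exact: measurableC.
  apply/seteqP; split => [t /= <- J _|t /= tG].
    by rewrite inE; case: asboolP.
  apply/finset.setP => J; rewrite inE; have := tG J I.
  by case: ifP => _ BJ; [apply/asboolP|apply/negbTE/asboolPn].
apply/finset.setP => J; rewrite !inE; apply/idP/idP => /asboolP.
  move=> BJ; apply/asboolP; apply: contrapT => nE; apply: Nt; apply: subN.
  rewrite -bigcup_seq; exists J; first by rewrite /= mem_index_enum.
  right; split => // -[A MA AJ]; apply: nE; exists A => //.
  apply/finset.setP => j; rewrite inE; apply/idP/idP => [/asboolP/(AJ j).1//|jJ].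
  by apply/asboolP/AJ.
move=> [A MA AJ]; apply/asboolP; apply: contrapT => nB; apply: Nt; apply: subN.
rewrite -bigcup_seq; exists J; first by rewrite /= mem_index_enum.
left; split => //; exists A => // j; rewrite -AJ inE.
by split => [h'|/asboolP//]; apply/asboolP.
Qed.

End measurable_traces.

(** * Uniform law of large numbers over a VC class *)

Section ghost_sample.
Context {d : measure_display} {T : measurableType d} {R : realType}.
Variable mu : probability T R.

(** Two samples put end to end, after exchanging their i-th points whenever the
    i-th sign is true. *)
Definition mix n (s : n.-tuple bool) (w : n.-tuple T * n.-tuple T) : (n + n).-tuple T :=
  [tuple match fintype.split j with
         | inl i => tnth (if tnth s i then w.2 else w.1) i
         | inr i => tnth (if tnth s i then w.1 else w.2) i
         end | j < n + n].

Lemma mix_lshift n s (w : n.-tuple T * n.-tuple T) i :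
  tnth (mix s w) (lshift n i) = tnth (if tnth s i then w.2 else w.1) i.
Proof.
by rewrite tnth_mktuple; case: splitP => [j /= /val_inj<-//|j /= e];
   have := ltn_ord i; rewrite e; lia.
Qed.

Lemma mix_rshift n s (w : n.-tuple T * n.-tuple T) i :
  tnth (mix s w) (rshift n i) = tnth (if tnth s i then w.1 else w.2) i.
Proof.
rewrite tnth_mktuple; case: splitP => [j /= e|j /= /eqP].
  by have := ltn_ord j; rewrite -e; lia.
by rewrite eqn_add2l => /eqP/val_inj<-.
Qed.

Lemma measurable_mix n (s : n.-tuple bool) : measurable_fun setT (mix s).
Proof.
have m1 i : measurable_fun setT (fun w : n.-tuple T * n.-tuple T => tnth w.1 i).
  exact: (measurableT_comp (measurable_tnth i) measurable_fst).
have m2 i : measurable_fun setT (fun w : n.-tuple T * n.-tuple T => tnth w.2 i).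
  exact: (measurableT_comp (measurable_tnth i) measurable_snd).
apply/measurable_fun_tnthP => j; rewrite -(fintype.splitK j).
case: (fintype.split j) => i /=.
  rewrite (_ : _ \o _ = fun w => tnth (if tnth s i then w.2 else w.1) i).
    by case: (tnth s i).
  by apply/funext => w; rewrite /= mix_lshift.
rewrite (_ : _ \o _ = fun w => tnth (if tnth s i then w.1 else w.2) i).
  by case: (tnth s i).
by apply/funext => w; rewrite /= mix_rshift.
Qed.

(** Both halves have the same law and are independent, so swaps leave rectangles
    of the same probability. *)
Lemma mix_law n (s : n.-tuple bool) (E : set ((n + n).-tuple T)) : measurable E ->
  (power_prob mu n \x power_prob mu n)%E (mix s @^-1` E) = power_prob mu (n + n) E.
Proof.
move=> mE.
pose S : {mfun (n.-tuple T * n.-tuple T)%type >-> (n + n).-tuple T} :=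
  HB.pack (@mix n s) (isMeasurableFun.Build _ _ _ _ _ (measurable_mix s)).
rewrite -[LHS]/(distribution (power_prob mu n \x power_prob mu n)%E S E).
apply: power_prob_unique => // B mB.
rewrite -[LHS]/((power_prob mu n \x power_prob mu n)%E (mix s @^-1` rectangle B)).
pose B1 i := B (if tnth s i then rshift n i else lshift n i).
pose B2 i := B (if tnth s i then lshift n i else rshift n i).
rewrite (_ : _ @^-1` _ = rectangle B1 `*` rectangle B2).
  have mB1 i : measurable (B1 i) by exact: mB.
  have mB2 i : measurable (B2 i) by exact: mB.
  rewrite product_measure1E; [|exact: measurable_rectangle|exact: measurable_rectangle].
  rewrite [X in (X * _)%E]power_prob_rectangle// [X in (_ * X)%E]power_prob_rectangle//.
  rewrite big_split_ord -big_split /= -[RHS]big_split /=; apply: eq_bigr => i _.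
  by rewrite /B1 /B2; case: (tnth s i) => //; rewrite muleC.
apply/seteqP; split => -[t t'] /=.
  move=> h; split => i.
    rewrite /B1; case si : (tnth s i).
      by have := h (rshift n i); rewrite mix_rshift si.
    by have := h (lshift n i); rewrite mix_lshift si.
  rewrite /B2; case si : (tnth s i).
    by have := h (lshift n i); rewrite mix_lshift si.
  by have := h (rshift n i); rewrite mix_rshift si.
move=> [h1 h2] j; rewrite -(fintype.splitK j); case: (fintype.split j) => i /=.
  by rewrite mix_lshift; case si : (tnth s i); [have := h2 i|have := h1 i]; rewrite /B1 /B2 si.
by rewrite mix_rshift; case si : (tnth s i); [have := h1 i|have := h2 i]; rewrite /B1 /B2 si.
Qed.

(** The i-th term of the difference between the numbers of points of J Δ J' in
    the first and in the second half of the double sample. *)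
Definition half_diff n (J J' : {set 'I_(n + n)}) (i : 'I_n) : R :=
  ((lshift n i \in J) != (lshift n i \in J'))%:R - ((rshift n i \in J) != (rshift n i \in J'))%:R.

(** Swaps act by signs on the discrepancy, which brings in Khintchine's
    inequality. *)
Lemma half_diff_mix n (s : n.-tuple bool) (w : n.-tuple T * n.-tuple T) (A A' : set T) i :
  half_diff (trace (mix s w) A) (trace (mix s w) A') i =
  (-1) ^+ tnth s i * (\1_(A `+` A') (tnth w.1 i) - \1_(A `+` A') (tnth w.2 i)).
Proof.
have ind x : ((`[< A x >]) != (`[< A' x >]))%:R = \1_(A `+` A') x :> R.
  rewrite indicE; have [a|a] := asboolP (A x); have [a'|a'] := asboolP (A' x) => /=.
  - by rewrite memNset//; case; case.
  - by rewrite mem_set//; left.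
  - by rewrite mem_set//; right.
  - by rewrite memNset//; case; case.
rewrite /half_diff !inE mix_lshift mix_rshift !ind.
by case: (tnth s i); rewrite ?expr1 ?expr0; ring.
Qed.

Lemma half_diff_sqr n (J J' : {set 'I_(n + n)}) (i : 'I_n) : half_diff J J' i ^+ 2 <= 1.
Proof.
by rewrite /half_diff; case: (_ != _); case: (_ != _);
  rewrite ?subrr ?subr0 ?sub0r ?sqrrN ?expr0n ?expr1n.
Qed.

Definition discrepant n (c : R) (F : {set {set 'I_(n + n)}}) : Prop :=
  exists J J', [/\ J \in F, J' \in F & c < `|\sum_i half_diff J J' i|].

Section vc.
Variables (M : set (set T)) (V : nat).
Hypothesis M_VC : forall n (t : n.-tuple T), VC_at_most V (traces M t).

(** The swaps preserve the double sample, and for fixed points a random swap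
    makes a given discrepancy large with a probability that beats the
    polynomial number of traces. *)
Lemma discrepant_bound (e : R) : 0 < e -> exists2 C : R, 0 <= C &
  forall n (E : set ((n + n).-tuple T)), (0 < n)%N -> measurable E ->
    (forall u, E u -> discrepant (n%:R * e) (traces M u)) ->
  (power_prob mu (n + n) E <= (C / n%:R)%:E)%E.
Proof.
move=> e0; pose q := (2 * V).+1; have [K K0 KP] := @khintchine R q.
exists (9 ^+ V * K / (e ^+ 2) ^+ q) => [|n E n0 mE Edisc].
  by rewrite divr_ge0 ?exprn_ge0 ?mulr_ge0 ?exprn_ge0// ltW.
have nR0 : 0 < n%:R :> R by rewrite ltr0n.
pose c := n%:R * e; have c0 : 0 < c by rewrite mulr_gt0.
pose f (s : n.-tuple bool) (w : n.-tuple T * n.-tuple T) : R := \1_E (mix s w).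
pose PP : probability (n.-tuple T * n.-tuple T)%type R := (power_prob mu n \x power_prob mu n)%E.
have mpre s : measurable (@mix n s @^-1` E).
  by rewrite -[X in measurable X]setTI; exact: measurable_mix.
have fE s : mean PP (f s) = power_prob mu (n + n) E.
  rewrite -(mix_law s mE) -[RHS]/(PP (mix s @^-1` E)) -[X in PP X]setIT.
  by rewrite -integral_indic.
have bound w : sign_avg (fun s => f s w) <= 9 ^+ V * K / (e ^+ 2) ^+ q / n%:R.
  pose u0 := mix [tuple of nseq n false] w.
  pose F0 := traces M u0.
  pose v (p : {set 'I_(n + n)} * {set 'I_(n + n)}) (i : 'I_n) : 'rV[R]_1 := const_mx (half_diff p.1 p.2 i).
  have nsqv p i : nsq (v p i) = half_diff p.1 p.2 i ^+ 2.
    by rewrite /nsq big_ord_recl big_ord0 addr0 mxE.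
  have c2q : 0 <= (c ^+ 2) ^- q by rewrite invr_ge0 exprn_ge0// sqr_ge0.
  have key s : f s w <= \sum_(p in finset.setX F0 F0) (c ^+ 2) ^- q * nsq (sign_sum (v p) s) ^+ q.
    have pos p : 0 <= (c ^+ 2) ^- q * nsq (sign_sum (v p) s) ^+ q.
      by rewrite mulr_ge0// exprn_ge0// nsq_ge0.
    rewrite /f indicE; have [/set_mem Eu|_] := boolP (mix s w \in E); last first.
      by apply: sumr_ge0 => p _.
    have [_ [_ [/tracesP[A MA <-] /tracesP[A' MA' <-] cAA']]] := Edisc _ Eu.
    rewrite (bigD1 (trace u0 A, trace u0 A')) /=; last first.
      by rewrite finset.in_setX !trace_in_traces.
    rewrite ler_wpDr ?sumr_ge0// -[leLHS](@mulVf _ ((c ^+ 2) ^+ q)); last first.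
      by rewrite gt_eqF// !exprn_gt0.
    rewrite ler_wpM2l// lerXn2r ?nnegrE ?sqr_ge0 ?nsq_ge0//.
    have -> : nsq (sign_sum (v (trace u0 A, trace u0 A')) s) =
        (\sum_i half_diff (trace (mix s w) A) (trace (mix s w) A') i) ^+ 2.
      rewrite /nsq big_ord_recl big_ord0 addr0 summxE; congr (_ ^+ 2).
      apply: eq_bigr => i _; rewrite !mxE /= !half_diff_mix; congr (_ * _).
      by rewrite (tnth_nth false) nth_nseq ltn_ord expr0 mul1r.
    by rewrite -[leRHS]real_normK ?num_real// lerXn2r ?nnegrE ?(ltW c0)// ltW.
  apply: (le_trans (le_sign_avg key)); rewrite sign_avg_sum.
  apply: (@le_trans _ _ (\sum_(p in finset.setX F0 F0) (c ^+ 2) ^- q * (K * n%:R ^+ q))).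
    apply: ler_sum => p _; rewrite sign_avgZ ler_wpM2l//.
    apply: (le_trans (KP _ _ _)); rewrite ler_wpM2l// lerXn2r ?nnegrE ?ler0n//.
      by apply: sumr_ge0 => i _; exact: nsq_ge0.
    rewrite -[leRHS](_ : \sum_(i < n) 1 = _); last by rewrite sumr_const card_ord.
    by apply: ler_sum => i _; rewrite nsqv half_diff_sqr.
  rewrite sumr_const cardsX -[_ *+ _]mulr_natl.
  have cF0 : (#|F0| <= (n + n).+1 ^ V)%N.
    have := sauer_trace [set: 'I_(n + n)]%SET (@M_VC _ u0); rewrite cardsT card_ord.
    rewrite (_ : [set _ | _ in _]%SET = F0)//.
    by apply/finset.setP => J; apply/imsetP/idP => [[A AF ->]|JF];
      [rewrite finset.setTI|exists J => //; rewrite finset.setTI].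
  have nn : (#|F0| * #|F0|)%:R <= (9 * n%:R ^+ 2) ^+ V :> R.
    rewrite -natrX -natrM -natrX ler_nat.
    apply: (@leq_trans ((n + n).+1 ^ V * (n + n).+1 ^ V)); first exact: leq_mul.
    have sq9 : ((n + n).+1 * (n + n).+1 <= 9 * n ^ 2)%N by rewrite -mulnn; nia.
    by rewrite -expnMn; elim: (V) => // m IH; rewrite (expnS (_ * _)) [leqRHS]expnS leq_mul.
  apply: (@le_trans _ _ ((9 * n%:R ^+ 2) ^+ V * ((c ^+ 2) ^- q * (K * n%:R ^+ q)))).
    by rewrite ler_wpM2r// mulr_ge0// mulr_ge0 ?exprn_ge0.
  rewrite le_eqVlt; apply/orP; left; apply/eqP.
  have nq : n%:R ^+ q = n%:R * (n%:R ^+ V * n%:R ^+ V) :> R.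
    by rewrite /q exprS mul2n -addnn exprD.
  by rewrite /c !exprMn nq; field; rewrite !expf_neq0 ?gt_eqF.
rewrite -(mean_cst PP); apply: (@le_trans _ _ (mean PP (fun w => sign_avg (fun s => f s w)))).
  apply: le_mean_sign_avg => //.
  - by move=> s; apply: (measurableT_comp _ (measurable_mix s)); exact: measurable_indic.
  - by move=> s; rewrite fE.
apply: le_mean => [|||w].
- apply: measurable_sign_avg => s.
  by apply: (measurableT_comp _ (measurable_mix s)); exact: measurable_indic.
- exact: measurable_cst.
- by move=> w; apply: sign_avg_ge0 => s.
- exact: bound.
Qed.

End vc.
End ghost_sample.

(** A sample that is bad for some pair of sets is discrepant from most of its
    independent ghost copies. Those discrepant from a copy with probability at
    least 1/2 form a measurable set, small by [discrepant_bound]. *)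
Lemma vc_uniform_lln d (T : measurableType d) (R : realType) (mu : probability T R)
    (M : set (set T)) (V : nat) (e eta : R) :
  M `<=` measurable -> (forall n (t : n.-tuple T), VC_at_most V (traces M t)) ->
  traces_measurable mu M -> 0 < e -> 0 < eta ->
  exists N : nat, forall n, (N <= n)%N -> (0 < n)%N ->
  exists B, [/\ measurable B, (power_prob mu n B <= eta%:E)%E &
    forall t, ~ B t -> forall A A', M A -> M A' ->
      `|wdist (fun=> 1) (trace t A) (trace t A') - n%:R * fine (mu (A `+` A'))| <= n%:R * e].
Proof.
move=> M_meas M_VC M_traces e0 eta0.
have e20 : 0 < e / 2 by rewrite divr_gt0.
have [C C0 CP] := discrepant_bound mu M_VC e20.
exists (maxn (Num.bound (2 * C / eta)) (Num.bound (8 / e ^+ 2))) => n; rewrite geq_max => /andP[Nn1 Nn2] n0.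
have nR0 : 0 < n%:R :> R by rewrite ltr0n.
have [F [N [mF mN N0 FN]]] := traces_version (n + n) M_traces.
pose c : R := n%:R * (e / 2).
have c0 : 0 < c by rewrite mulr_gt0.
pose E1 := [set u | discrepant c (F u)].
have mE1 : measurable E1.
  rewrite (_ : E1 = \bigcup_(G in [set G | discrepant c G]) (F @^-1` [set G])).
    by apply: fin_bigcup_measurable => [|G _]; [exact: finite_finset|exact: mF].
  by apply/seteqP; split => [u cu|u [G /= cG uG]]; [by exists (F u)|by rewrite /E1 /= uG].
have mEb : measurable (E1 `\` N) by exact: measurableD.
have Eb_le : (power_prob mu (n + n) (E1 `\` N) <= (C / n%:R)%:E)%E.
  by apply: CP => // u [cu Nu]; rewrite -FN.
pose E2 := (E1 `\` N) `|` N.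
have mE2 : measurable E2 by exact: measurableU.
have E2_le : (power_prob mu (n + n) E2 <= (C / n%:R)%:E)%E.
  apply: (le_trans (measureU2 _ mEb mN)).
  by rewrite [X in (_ + X)%E]N0 adde0.
have E2_disc u : discrepant c (traces M u) -> E2 u.
  move=> cu; have [Nu|Nu] := pselect (N u); first by right.
  by left; split => //; rewrite /E1 /= FN.
pose s0 : n.-tuple bool := [tuple of nseq n false].
have s0E i : tnth s0 i = false by rewrite (tnth_nth false) nth_nseq ltn_ord.
pose S := @mix _ T n s0 @^-1` E2.
have mS : measurable S by rewrite -[X in measurable X]setTI; exact: measurable_mix.
pose h t := (\int[power_prob mu n]_t' (\1_S (t, t') : R)%:E)%E.
have mS1 : measurable_fun setT (fun w : n.-tuple T * n.-tuple T => (\1_S w : R)%:E).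
  by apply/measurable_EFinP; exact: measurable_indic.
have mh : measurable_fun setT h.
  apply: (measurable_fun_fubini_tonelli_F (m2 := power_prob mu n) (fun w => (\1_S w)%:E)) => //.
have hE : (\int[power_prob mu n]_t h t)%E = power_prob mu (n + n) E2.
  rewrite -(mix_law mu s0 mE2) -/S -[X in product_measure1 _ _ X]setIT.
  rewrite -integral_indic// fubini_tonelli1//.
have h0 t : (0 <= h t)%E by apply: integral_ge0 => t' _; rewrite lee_fin.
pose B := [set t | ((2^-1)%:E <= h t)%E].
have mB : measurable B.
  by rewrite -[X in measurable X]setTI; exact: emeasurable_fun_c_infty.
exists B; split => //.
  have : ((2^-1)%:E * power_prob mu n B <= (C / n%:R)%:E)%E.
    apply: le_trans E2_le; rewrite -hE.
    have -> : ((2^-1)%:E * power_prob mu n B = mean (power_prob mu n) (fun t => (2^-1 * \1_B t)%R))%E.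
      rewrite meanZ; [|by []|exact: measurable_indic|by []].
      by rewrite /mean integral_indic// setIT.
    apply: ge0_le_integral; [exact: measurableT|by move=> t _; rewrite lee_fin mulr_ge0| |exact: mh|].
      apply/measurable_EFinP; apply: measurable_funM; first exact: measurable_cst.
      exact: measurable_indic.
    move=> t _; rewrite indicE; have [/set_mem Bt|_] := boolP (t \in B).
      by rewrite mulr1.
    by rewrite mulr0.
  have fB : power_prob mu n B \is a fin_num by exact: fin_num_measure.
  rewrite -(fineK fB) -EFinM !lee_fin => hB.
  have : 2 * C / eta <= n%:R.
    apply: (@le_trans _ _ (Num.bound (2 * C / eta))%:R); last by rewrite ler_nat.
    by rewrite ltW// archi_boundP// divr_ge0 ?mulr_ge0// ltW.
  rewrite ler_pdivrMr// => hn.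
  have : C / n%:R <= eta / 2 by rewrite ler_pdivrMr//; lra.
  by lra.
move=> t Bt A A' MA MA'; rewrite leNgt; apply/negP => bad; apply: Bt.
pose D := A `+` A'; set p := fine (mu D) in bad.
have mD : measurable D by apply: measurableU; apply: measurableD; exact: M_meas.
have mind : measurable_fun setT (\1_D : T -> R) by exact: measurable_indic.
have ind01 x : 0 <= (\1_D x : R) <= 1 by rewrite indicE; case: (_ \in _); rewrite ?lexx ?ler01.
have mp : mean mu (\1_D : T -> R) = p%:E.
  by rewrite /mean integral_indic// setIT /p fineK//; exact: fin_num_measure.
pose g (t' : n.-tuple T) : R := \sum_i 1 * (\1_D (tnth t' i) - p).
have mg : measurable_fun setT g.
  apply: (measurable_weighted_sum (fun=> 1) (f := fun x => \1_D x - p)).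
  by apply: measurable_funB => //; exact: measurable_cst.
have gvar : (mean (power_prob mu n) (fun t' => (g t' ^+ 2)%R) <= (n%:R * 1 ^+ 2)%:E)%E.
  by apply: mean_bounded_sum_sqr => // i; rewrite expr1n.
pose G := [set t' | c ^+ 2 <= g t' ^+ 2].
have mG : measurable G.
  by apply: measurable_le_set; [exact: measurable_cst|exact: measurable_funX].
have G_le : (power_prob mu n G <= (2^-1)%:E)%E.
  apply: (le_trans (markov_mean _ (measurable_funX 2 mg) (fun t' => sqr_ge0 (g t')) _)).
    by rewrite exprn_gt0.
  apply: (@le_trans _ _ ((c ^+ 2)^-1%:E * (n%:R * 1 ^+ 2)%:E)%E).
    by apply: lee_wpmul2l => //; rewrite lee_fin invr_ge0 sqr_ge0.
  rewrite -EFinM lee_fin /c.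
  have -> : (n%:R * (e / 2)) ^- 2 * (n%:R * 1 ^+ 2) = 4 / (e ^+ 2 * n%:R).
    by field; rewrite !gt_eqF.
  have : 8 / e ^+ 2 <= n%:R.
    apply: (@le_trans _ _ (Num.bound (8 / e ^+ 2))%:R); last by rewrite ler_nat.
    by rewrite ltW// archi_boundP// divr_ge0// sqr_ge0.
  rewrite ler_pdivrMr ?exprn_gt0// => h8.
  by rewrite ler_pdivrMr ?mulr_gt0 ?exprn_gt0//; lra.
have sub : ~` G `<=` [set t' | S (t, t')].
  move=> t' /negP; rewrite -ltNge => gt'; apply: E2_disc.
  exists (trace (mix s0 (t, t')) A), (trace (mix s0 (t, t')) A').
  rewrite !trace_in_traces//; split => //.
  under eq_bigr do rewrite half_diff_mix s0E expr0 mul1r /=.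
  rewrite sumrB -wdist_trace.
  have {}gt' : `|g t'| < c.
    by rewrite -(@ltr_pXn2r _ 2)// ?nnegrE ?(ltW c0)// real_normK ?num_real.
  have gE : \sum_i \1_D (tnth t' i) = g t' + n%:R * p.
    rewrite /g; under [in RHS]eq_bigr do rewrite mul1r.
    by rewrite sumrB sumr_const card_ord mulr_natl subrK.
  rewrite -/D gE; move: bad gt'; rewrite /c.
  set x := wdist _ _ _; rewrite ltr_norml.
  have [xp|xp] := leP 0 (x - n%:R * p).
    rewrite ger0_norm// => b1 /andP[b2 b3].
    by apply: lt_le_trans (ler_norm _); lra.
  rewrite ltr0_norm// => b1 /andP[b2 b3].
  by rewrite -normrN; apply: lt_le_trans (ler_norm _); lra.
have hG : (power_prob mu n (~` G) <= h t)%E.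
  have mSt : measurable [set t' | S (t, t')].
    by rewrite -[X in measurable X]setTI; exact: pair1_measurable.
  apply: (@le_trans _ _ (power_prob mu n [set t' | S (t, t')])).
    by apply: le_measure; rewrite ?inE//; exact: measurableC.
  by rewrite -[X in power_prob mu n X]setIT -integral_indic.
apply: le_trans hG; rewrite probability_setC//.
rewrite leeBrDr ?fin_num_measure//.
by apply: (le_trans (leeD (lexx _) G_le)); rewrite -EFinD lee_fin; lra.
Qed.

(** * Convergence in probability and moment conditions *)

Lemma mean_distribution d d' (T : measurableType d) (T' : measurableType d') (R : realType)
    (P : probability T R) (X : {RV P >-> T'}) (f : T' -> R) : measurable_fun setT f ->
  mean (distribution P X) f = ('E_P[fun w => f (X w)])%E.
Proof.
move=> mf; have mEf : measurable_fun setT (EFin \o f) by exact/measurable_EFinP.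
rewrite unlock /mean integralE [RHS]integralE; congr (_ - _)%E.
  by rewrite ge0_integral_distribution//; [apply: eq_integral => w _; rewrite /= !funeposE|exact: measurable_funepos].
by rewrite ge0_integral_distribution//; [apply: eq_integral => w _; rewrite /= !funenegE|exact: measurable_funeneg].
Qed.

Lemma cvge0_squeeze (R : realType) (u : nat -> \bar R) : (forall n, (0 <= u n)%E) ->
  (forall e : R, 0 < e -> \forall n \near \oo, (u n <= e%:E)%E) -> u @ \oo --> 0%E.
Proof.
move=> u0 ue A [e /= e0 eA].
have e20 : 0 < e / 2 by rewrite divr_gt0.
suff : \forall n \near \oo, A (u n) by [].
near=> n; have un : (u n <= (e / 2)%:E)%E by near: n; exact: ue.
move: (u0 n) un.
case: (u n) => [r| |]//; rewrite !lee_fin => r0 re.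
apply: eA; rewrite /= sub0r normrN ger0_norm//; lra.
Unshelve. all: by end_near. Qed.

Lemma cvg0_in_prob_of_bound (R : realType) (dO : nat -> measure_display)
    (O : forall d, measurableType (dO d)) (P : forall d, probability (O d) R)
    (D : forall d, O d -> \bar R) :
  (forall e eta : R, 0 < e -> 0 < eta -> \forall d \near \oo,
     exists B, [/\ measurable B, (P d B <= eta%:E)%E & forall w, ~ B w -> (D d w <= e%:E)%E]) ->
  cvg0_in_prob P D.
Proof.
move=> h e e0; apply: cvge0_squeeze => [d|eta eta0]; first exact: mu_ext_ge0.
near=> d; have [B [mB PB BD]] : exists B, [/\ measurable B, (P d B <= eta%:E)%E &
  forall w, ~ B w -> (D d w <= e%:E)%E] by near: d; exact: h.
apply: le_trans PB; rewrite -(measurable_mu_extE (P d) mB); apply: le_mu_ext.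
move=> w /=; apply: contraPP => nB; rewrite ltNge; apply/negP; rewrite negbK; exact: BD.
Unshelve. all: by end_near. Qed.

Section laws.
Context {R : realType} {d0 : nat -> measure_display} {O0 : forall d, measurableType (d0 d)}.
Context {P0 : forall d, probability (O0 d) R} {X0 : forall d, {RV (P0 d) >-> d.+1.-tuple R}}.
Hypothesis Xmean : forall d (a : 'I_d.+1),
  'E_(P0 d)[(fun w => tnth (X0 d w) a)%R]%E = 0%E.
Hypothesis Xnorm : forall d, 'E_(P0 d)[(fun w => eucl_norm (vec (X0 d w)) ^+ 2)%R]%E = 1%E.
Hypothesis Xuncor : forall d (a a' : 'I_d.+1), a != a' ->
  'E_(P0 d)[(fun w => tnth (X0 d w) a * tnth (X0 d w) a')%R]%E = 0%E.
Hypothesis Xui : ereal_sup (range (fun d =>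
    'E_(P0 d)[(fun w => eucl_norm (vec (X0 d w)) ^+ 2 *
                        \1_[set v | c < eucl_norm (vec (X0 d v)) ^+ 2] w)%R]%E))
  @[c --> +oo%R] --> 0%E.
Hypothesis Xneg : \big[maxe/0%E]_(a < d.+1) 'E_(P0 d)[(fun w => tnth (X0 d w) a ^+ 2)%R]%E
  @[d --> \oo] --> 0%E.
Local Notation nu d := (distribution (P0 d) (X0 d)).

Lemma white_law_near (v : R) : 0 < v -> \forall d \near \oo, white_law (nu d) v.
Proof.
move=> v0; near=> d.
have small : (\big[maxe/0%E]_(a < d.+1) 'E_(P0 d)[(fun w => tnth (X0 d w) a ^+ 2)%R] < v%:E)%E.
  near: d; apply: (@Xneg [set x | (x < v%:E)%E]).
  exists v => //= r /=; rewrite sub0r normrN => rv; rewrite lte_fin.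
  exact: le_lt_trans (ler_norm _) rv.
split.
- exact: ltW.
- by move=> a; rewrite mean_distribution ?Xmean//; exact: measurable_tnth.
- rewrite mean_distribution; last exact: measurable_nsq_vec.
  rewrite -(Xnorm d); congr expectation; apply/funext => w.
  by rewrite eucl_norm_sqr.
- move=> a b ab; rewrite mean_distribution; first exact: Xuncor.
  by apply: measurable_funM; exact: measurable_tnth.
- move=> a; rewrite mean_distribution; last by apply: measurable_funX; exact: measurable_tnth.
  apply: le_trans (ltW small).
  exact: (le_bigmax_cond 0%E (fun a => 'E_(P0 d)[(fun w => tnth (X0 d w) a ^+ 2)%R]%E)).
Unshelve. all: by end_near. Qed.

Lemma uniform_tail (e : R) : 0 < e -> exists2 b : R, 0 <= b &
  forall d, (mean (nu d) (tail_nsq b) <= e%:E)%E.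
Proof.
move=> e0.
have : \forall c \near +oo%R, (ereal_sup (range (fun d =>
    'E_(P0 d)[(fun w => eucl_norm (vec (X0 d w)) ^+ 2 *
                        \1_[set v | c < eucl_norm (vec (X0 d v)) ^+ 2] w)%R])) < e%:E)%E.
  apply: (@Xui [set x | (x < e%:E)%E]).
  exists e => //= r /=; rewrite sub0r normrN => rv; rewrite lte_fin.
  exact: le_lt_trans (ler_norm _) rv.
move=> [c [_ hc]]; exists (Num.max c 0 + 1).
  by rewrite addr_ge0// le_max lexx orbT.
move=> d; set b := _ + 1.
have cb : c < b by rewrite /b ltr_pwDr// le_max lexx.
apply: le_trans (ltW (hc b cb)).
rewrite mean_distribution; last exact: measurable_tail_nsq.
apply: ereal_sup_ubound; exists d => //; congr expectation; apply/funext => w.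
rewrite /tail_nsq eucl_norm_sqr indicE; congr (_ * _%:R).
have [h|h] := boolP (b < nsq (vec (X0 d w))).
  by rewrite mem_set//= eucl_norm_sqr.
by rewrite memNset//= eucl_norm_sqr; exact/negP.
Unshelve. all: by end_near. Qed.

End laws.

(** * Set-indexed sums *)

Lemma measure_bigsetU_le d (T : measurableType d) (R : realType) (P : probability T R)
    (I : finType) (A : I -> set T) : (forall i, measurable (A i)) ->
  measurable (\big[setU/set0]_i A i) /\ (P (\big[setU/set0]_i A i) <= \sum_i P (A i))%E.
Proof.
move=> mA; elim/big_ind2 : _ => [|X x Y y [mX Px] [mY Py]|i _]; last by split.
  by split => //; rewrite measure0.
split; first exact: measurableU.
apply: le_trans (measureU2 _ mX mY) _; exact: leeD.
Qed.

Lemma eucl_dist_scale (R : realType) (D : nat) (c : R) (u v : 'rV[R]_D) : 0 <= c ->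
  eucl_dist (c *: u) (c *: v) = c * eucl_norm (u - v).
Proof. by move=> c0; rewrite /eucl_dist -scalerBr eucl_normZ ger0_norm. Qed.

Section euclidean_distance.
Context {R : realType} {D : nat}.
Implicit Types u v w : 'rV[R]_D.

Lemma eucl_distxx u : eucl_dist u u = 0.
Proof. by rewrite /eucl_dist subrr eucl_norm0. Qed.

Lemma eucl_distC u v : eucl_dist u v = eucl_dist v u.
Proof. by rewrite /eucl_dist -opprB eucl_normN. Qed.

Lemma eucl_dist_triangle v u w : eucl_dist u w <= eucl_dist u v + eucl_dist v w.
Proof.
rewrite /eucl_dist; have -> : u - w = (u - v) + (v - w) by rewrite addrA subrK.
exact: eucl_normD.
Qed.

End euclidean_distance.

(** The two approximations of [uniform_isometry] and of the index measure
    combine into a distortion bound. *)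
Lemma spiral_distortion (R : realType) (norm cnt mu s r e : R) :
  0 <= norm -> 0 <= cnt -> 0 <= mu -> 0 < s -> 0 <= r -> 0 <= e ->
  `|norm - Num.sqrt cnt| <= r * s -> `|cnt - s ^+ 2 * mu| <= s ^+ 2 * e ^+ 2 ->
  `|s^-1 * norm - Num.sqrt mu| <= r + e.
Proof.
move=> n0 c0 m0 s0 r0 e0 h1 h2.
have h3 : `|Num.sqrt cnt - s * Num.sqrt mu| <= s * e.
  apply: sqrt_sub_le; rewrite ?sqrtr_ge0 ?mulr_ge0 ?sqrtr_ge0 ?(ltW s0)//.
  by rewrite !exprMn !sqr_sqrtr.
have -> : s^-1 * norm - Num.sqrt mu = s^-1 * ((norm - Num.sqrt cnt) + (Num.sqrt cnt - s * Num.sqrt mu)).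
  by field; rewrite gt_eqF.
rewrite normrM ger0_norm ?invr_ge0 ?(ltW s0)// mulrC ler_pdivrMr//.
by apply: (le_trans (ler_normD _ _)); rewrite mulrDl (mulrC e); exact: lerD.
Qed.

Section set_indexed_sums.
Context {R : realType}.

(** Only the traces on the sample matter. *)
Lemma set_indexed_sum_sub d (T : Type) N (X : nat -> d.-tuple R) (U : nat -> T) (A A' : set T) :
  set_indexed_sum N X U A - set_indexed_sum N X U A' =
  lin_sum (set_diff R (trace [tuple U j | j < N] A) (trace [tuple U j | j < N] A'))
    [tuple X j | j < N].
Proof.
have ind (B : set T) y : \1_B y = `[< B y >]%:R :> R.
  by rewrite indicE; have [h|h] := asboolP (B y); [rewrite mem_set|rewrite memNset].
rewrite /set_indexed_sum /lin_sum -sumrB; apply: eq_bigr => j _.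
by rewrite -scalerBl /set_diff !inE !tnth_mktuple !ind.
Qed.

Lemma powRN_half (N : nat) : (N%:R `^ (- (1 / 2)) : R) = (Num.sqrt N%:R)^-1.
Proof. by rewrite powRN div1r powR12_sqrt. Qed.

End set_indexed_sums.

(** * Boxes and grids *)

Section boxes.
Context {R : realType}.

(** Rounding each side of a box of size at most n up by at most one changes
    its volume by at most the number of boundary points of the grid. *)
Lemma prod_rounding (m : nat) (x : 'I_m -> R) (n : R) : (forall l, 0 <= x l <= n) ->
  \prod_l (x l + 1) - \prod_l x l <= (n + 1) ^+ m - n ^+ m.
Proof.
elim: m x => [|m IH] x xn; first by rewrite !big_ord0 !expr0.
have n0 : 0 <= n by have /andP[] := xn ord0; exact: le_trans.
rewrite !big_ord_recl !exprS; have := IH (fun l => x (lift ord0 l)) (fun l => xn _).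
have /andP[x0 xn0] := xn ord0.
set p := \prod_(l < m) x (lift ord0 l); set p1 := \prod_(l < m) (x (lift ord0 l) + 1).
have p1n : p1 <= (n + 1) ^+ m.
  rewrite -[X in _ ^+ X](card_ord m) -prodr_const; apply: ler_prod => l _.
  by have /andP[? ?] := xn (lift ord0 l); rewrite addr_ge0// lerD2r.
have pp1 : p <= p1.
  by apply: ler_prod => l _; have /andP[? ?] := xn (lift ord0 l); rewrite lerDl ler01 andbT.
move=> h.
have h1 : x ord0 * (p1 - p) <= n * (p1 - p) by rewrite ler_wpM2r// subr_ge0.
have h2 : n * (p1 - p) <= n * ((n + 1) ^+ m - n ^+ m) by rewrite ler_wpM2l.
lra.
Qed.

(** The number of points of {0, .., n}^m outside {0, .., n - 1}^m is of order
    n ^ (m - 1). *)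
Lemma grid_boundary (m n : nat) :
  n%:R * ((n%:R + 1) ^+ m - n%:R ^+ m) <= (2 ^+ m - 1) * n%:R ^+ m :> R.
Proof.
elim: m => [|m IH]; first by rewrite !expr0 !subrr mulr0 mul0r.
rewrite !exprS.
set a : R := (n%:R + 1) ^+ m in IH *; set b : R := n%:R ^+ m in IH *; set c : R := 2 ^+ m in IH *.
have n0 : 0 <= n%:R :> R by [].
have c1 : 1 <= c by rewrite exprn_ege1// ler1n.
have b0 : 0 <= b by rewrite exprn_ge0.
have [->|n1] := posnP n; first by rewrite !mul0r mulr0.
have nR1 : 1 <= n%:R :> R by rewrite ler1n.
have h1 : (n%:R + 1) * (n%:R * (a - b)) <= (n%:R + 1) * ((c - 1) * b) by rewrite ler_wpM2l// addr_ge0.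
have h2 : 1 * ((c - 1) * b) <= n%:R * ((c - 1) * b) by rewrite ler_wpM2r// mulr_ge0// subr_ge0.
lra.
Qed.

Lemma wdist_card (I : finType) (A B : {set I}) :
  wdist (fun=> 1) A B = #|A|%:R + #|B|%:R - 2 * #|A :&: B|%:R :> R.
Proof.
have card (S : {set I}) : #|S|%:R = \sum_i (i \in S)%:R :> R.
  by rewrite -sum1_card natr_sum big_mkcond; apply: eq_bigr => i _; case: (i \in S).
rewrite !card mulr_sumr -sumrN -!big_split /wdist big_mkcond; apply: eq_bigr => i _ /=.
by rewrite inE; case: (i \in A) (i \in B) => [] [] /=; ring.
Qed.

Lemma measure_symdiff d (T : measurableType d) (mu : probability T R) (A B : set T) :
  measurable A -> measurable B ->
  fine (mu (A `+` B)) = fine (mu A) + fine (mu B) - 2 * fine (mu (A `&` B)).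
Proof.
move=> mA mB; have mAB : measurable (A `&` B) by exact: measurableI.
have f S : measurable S -> mu S \is a fin_num by move=> mS; exact: fin_num_measure.
have lty S : measurable S -> (mu S < +oo)%E by move=> mS; rewrite ltey_eq f.
have diff S S' : measurable S -> measurable S' ->
    fine (mu (S `\` S')) = fine (mu S) - fine (mu (S `&` S')).
  move=> mS mS'; rewrite measureD ?lty// fineB//; first exact: f.
  by apply: f; exact: measurableI.
rewrite /setY measureU; [|exact: measurableD|exact: measurableD|]; last first.
  by apply/seteqP; split => // x [[? ?] [? ?]].
rewrite fineD; [|by apply: f; exact: measurableD|by apply: f; exact: measurableD].
by rewrite !diff// (setIC B); ring.
Qed.

Lemma uniform_prob_segment (t : R) : 0 <= t <= 1 ->
  uniform_prob (@ltr01 R) `[0, t] = t%:E.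
Proof.
move=> /andP[t0 t1]; rewrite /uniform_prob.
rewrite (eq_integral (fun=> 1%:E)); last first.
  move=> x; rewrite inE /= in_itv /= => /andP[x0 xt].
  by rewrite /uniform_pdf x0 (le_trans xt t1) /= subr0 invr1.
rewrite integral_cst//= lebesgue_measure_itv /= lte_fin mul1e.
by case: ltP => [_|t0']; [rewrite -EFinD subr0|congr EFin; apply/eqP; rewrite eq_le t0 t0'].
Qed.

Definition corner_box m (t : m.-tuple R) : set (m.-tuple (measurableTypeR R)) :=
  [set x | forall l, 0 <= tnth x l <= tnth t l].

Definition unit_cube m : set (m.-tuple R) := [set t | forall l, 0 <= tnth t l <= 1].

Lemma corner_boxE m (t : m.-tuple R) :
  corner_box t = rectangle (fun l => `[0, tnth t l]%classic : set (measurableTypeR R)).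
Proof. by apply/seteqP; split => x h l; have := h l; rewrite /= in_itv. Qed.

Lemma measurable_corner_box m (t : m.-tuple R) : measurable (corner_box t).
Proof. by rewrite corner_boxE; apply: measurable_rectangle => l; exact: measurable_itv. Qed.

Lemma lebesgue_corner_box m (t : m.-tuple R) : unit_cube t ->
  fine (lebesgue_cube R m (corner_box t)) = \prod_l tnth t l.
Proof.
move=> t1; rewrite corner_boxE /lebesgue_cube.
rewrite [X in fine X]power_prob_rectangle; last by move=> l; exact: measurable_itv.
rewrite (eq_bigr (fun l => (tnth t l)%:E)) => [|l _]; last exact: uniform_prob_segment.
by rewrite prodEFin.
Qed.

Definition tuple_min m (t t' : m.-tuple R) : m.-tuple R :=
  [tuple Num.min (tnth t l) (tnth t' l) | l < m].

Lemma tuple_min_cube m (t t' : m.-tuple R) : unit_cube t -> unit_cube t' -> unit_cube (tuple_min t t').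
Proof.
move=> ht ht' l; rewrite tnth_mktuple; have /andP[a b] := ht l; have /andP[a' b'] := ht' l.
by rewrite le_min a a' ge_min b.
Qed.

Lemma corner_boxI m (t t' : m.-tuple R) :
  corner_box t `&` corner_box t' = corner_box (tuple_min t t').
Proof.
apply/seteqP; split => [x [h h'] l|x h].
  by rewrite tnth_mktuple le_min; have /andP[-> ->] := h l; have /andP[_ ->] := h' l.
by split => l; have := h l; rewrite tnth_mktuple le_min => /and3P[-> ? ?].
Qed.

(** [grid_box n t] consists of the points of {0, .., n}^m in the dilation by n
    of the box with corner t, as a set of indices in an enumeration. *)
Definition grid m n := {ffun 'I_m -> 'I_n.+1}.

Definition grid_box m n (t : m.-tuple R) : {set 'I_#|grid m n|} :=
  [set j | [forall l, ((enum_val j : grid m n) l : nat)%:R <= n%:R * tnth t l :> R]]%SET.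

Lemma grid_boxI m n (t t' : m.-tuple R) :
  (grid_box n t :&: grid_box n t')%SET = grid_box n (tuple_min t t').
Proof.
apply/finset.setP => j; rewrite !inE; apply/andP/forallP => [[/forallP h /forallP h'] l|h].
  by rewrite tnth_mktuple minr_pMr// le_min h h'.
by split; apply/forallP => l; have := h l; rewrite tnth_mktuple minr_pMr// le_min => /andP[].
Qed.

Lemma card_grid_box m n (t : m.-tuple R) : unit_cube t ->
  #|grid_box n t| = (\prod_l (Num.trunc (n%:R * tnth t l)).+1)%N.
Proof.
move=> ht; pose k l := Num.trunc (n%:R * tnth t l).
have kn l : (k l <= n)%N.
  have /andP[t0 t1] := ht l; rewrite /k truncn_le_nat -natr1.
  by rewrite (@le_lt_trans _ _ n%:R) ?ltrDl// ler_piMr.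
have ink l (i : 'I_n.+1) : ((i : nat)%:R <= n%:R * tnth t l) = (i <= k l)%N.
  by have /andP[t0 t1] := ht l; rewrite /k truncn_ge_nat ?mulr_ge0.
have -> : #|grid_box n t| = #|family (fun l => [pred i : 'I_n.+1 | (i <= k l)%N])|.
  rewrite -(card_imset _ (@enum_val_inj _ (mem (grid m n)))).
  apply: eq_card => g; apply/imsetP/familyP => [[j + ->] l|h].
    by rewrite inE => /forallP/(_ l); rewrite ink.
  exists (enum_rank g); last by rewrite enum_rankK.
  by rewrite inE; apply/forallP => l; rewrite enum_rankK ink; exact: h.
rewrite card_family foldrE big_image /=; apply: eq_bigr => l _.
rewrite -[RHS](card_ord (k l).+1).
have kn1 : ((k l).+1 <= n.+1)%N by rewrite ltnS.
have inj : injective (widen_ord kn1) by move=> i j /(congr1 val)/= /val_inj.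
rewrite -(card_codom inj); apply: eq_card => i.
apply/idP/codomP => [ik|[j ->]]; last by rewrite unfold_in /= -ltnS ltn_ord.
by exists (Ordinal (n := (k l).+1) ik); exact: val_inj.
Qed.

Lemma grid_box_volume m n (t : m.-tuple R) : unit_cube t -> (0 < n)%N ->
  `|#|grid_box n t|%:R - n%:R ^+ m * \prod_l tnth t l| <= 2 ^+ m * n%:R ^+ m / n%:R :> R.
Proof.
move=> ht n0; rewrite (card_grid_box _ ht) natr_prod.
have nR0 : 0 < n%:R :> R by rewrite ltr0n.
pose x l : R := n%:R * tnth t l.
have xn l : 0 <= x l <= n%:R.
  by have /andP[t0 t1] := ht l; rewrite /x mulr_ge0//= ler_piMr.
have -> : n%:R ^+ m * \prod_l tnth t l = \prod_l x l.
  by rewrite /x big_split /= prodr_const card_ord.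
have lo : \prod_l x l <= \prod_(l < m) (Num.trunc (x l)).+1%:R.
  by apply: ler_prod => l _; have /andP[-> _] := xn l; rewrite ltW// truncnS_gt.
have hi : \prod_(l < m) (Num.trunc (x l)).+1%:R <= \prod_l (x l + 1).
  apply: ler_prod => l _; rewrite ler0n -natr1 lerD2r truncn_le.
  by have /andP[] := xn l.
rewrite ger0_norm ?subr_ge0// ler_pdivlMr//.
have := prod_rounding xn; have := grid_boundary m n.
have b0 : 0 <= n%:R ^+ m :> R by rewrite exprn_ge0.
set a := (n%:R + 1) ^+ m - n%:R ^+ m => h1 h2.
have : n%:R * (\prod_(l < m) (Num.trunc (x l)).+1%:R - \prod_l x l) <= n%:R * a.
  by rewrite ler_wpM2l ?(ltW nR0)//; lra.
lra.
Qed.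

(** Boxes with a corner at 0 are stable under intersection, so that sizes of
    symmetric differences reduce to sizes of boxes, for counting as for the
    volume. *)
Lemma grid_box_symdiff m n (t t' : m.-tuple R) : unit_cube t -> unit_cube t' -> (0 < n)%N ->
  `|wdist (fun=> 1) (grid_box n t) (grid_box n t') -
    n%:R ^+ m * fine (lebesgue_cube R m (corner_box t `+` corner_box t'))|
  <= 4 * (2 ^+ m * n%:R ^+ m / n%:R).
Proof.
move=> ht ht' n0; have hm := tuple_min_cube ht ht'.
rewrite wdist_card grid_boxI measure_symdiff; [|exact: measurable_corner_box|exact: measurable_corner_box].
rewrite corner_boxI !lebesgue_corner_box//.
have := grid_box_volume ht n0; have := grid_box_volume ht' n0; have := grid_box_volume hm n0.
by rewrite !ler_norml => /andP[? ?] /andP[? ?] /andP[? ?]; apply/andP; split; lra.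
Qed.

(** A box containing, for each of the m coordinates, a point maximizing it,
    contains everything. *)
Lemma VC_grid_boxes m n (F : {set {set 'I_#|grid m n|}}) :
  (forall A, A \in F -> exists t, A = grid_box n t) -> VC_at_most m F.
Proof.
move=> FP K Ksh; rewrite leqNgt; apply/negP => mK.
have [j0 j0K] : exists j0, j0 \in K.
  by apply/card_gt0P; exact: leq_ltn_trans mK.
pose val_at l (j : 'I_#|grid m n|) : nat := (enum_val j : grid m n) l.
pose p l := [arg max_(j > j0 in K) val_at l j].
pose J := [set p l | l in [set: 'I_m]]%SET.
have pK l : p l \in K by rewrite /p; case: arg_maxnP.
have JK : J \subset K by apply/fintype.subsetP => _ /imsetP[l _ ->].
have [x xKJ] : exists x, x \in K :\: J.
  apply/card_gt0P; rewrite cardsD (finset.setIidPr JK) subn_gt0.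
  apply: leq_ltn_trans mK; apply: (leq_trans (leq_imset_card _ _)).
  by rewrite cardsT card_ord.
move: xKJ; rewrite inE => /andP[xJ xK].
have [A AF AJ] := shatteredP _ _ Ksh J JK; have [t At] := FP A AF.
suff : x \in J by rewrite (negPf xJ).
rewrite -AJ inE xK At inE /=; apply/forallP => l.
have : p l \in A.
  have : p l \in J by rewrite imset_f.
  by rewrite -AJ inE => /andP[].
rewrite At inE => /forallP/(_ l); apply: le_trans; rewrite ler_nat.
by rewrite -/(val_at l x) -/(val_at l (p l)) /p; case: arg_maxnP => // i _; apply.
Qed.

End boxes.

Section multiple_sums.
Context {R : realType}.

Definition grid_point m n (j : 'I_#|grid m n|) : {ffun 'I_m -> nat} :=
  [ffun l => (enum_val j : grid m n) l : nat].

Lemma grid_point_inj m n : injective (@grid_point m n).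
Proof.
move=> i j /ffunP h; apply: enum_val_inj; apply/ffunP => l.
by have := h l; rewrite !ffunE => /val_inj.
Qed.

Definition corner m n (t : m.-tuple R) : {ffun 'I_m -> nat} :=
  [ffun l => Num.trunc (n%:R * tnth t l)].

Lemma multiple_sum_grid d m n (X : {ffun 'I_m -> nat} -> d.-tuple R) (t : m.-tuple R) :
  unit_cube t ->
  multiple_sum X (corner n t) = \sum_(j in grid_box n t) vec (X (grid_point j)).
Proof.
move=> ht; rewrite /multiple_sum.
have tr l i : (i <= Num.trunc (n%:R * tnth t l))%N = (i%:R <= n%:R * tnth t l).
  by have /andP[t0 t1] := ht l; rewrite truncn_ge_nat ?mulr_ge0.
rewrite (@fsbigE _ _ _ _ _ [seq grid_point j | j <- enum (grid_box n t)]).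
- rewrite big_map big_enum_cond /=; apply: eq_bigl => j.
  have [jt|//] := boolP (j \in grid_box n t); rewrite mem_set// => l.
  by rewrite !ffunE tr; move: jt; rewrite inE => /forallP.
- by rewrite map_inj_uniq ?enum_uniq//; exact: grid_point_inj.
- move=> i /= /mapP[j]; rewrite mem_enum inE => /forallP jt -> l.
  by rewrite !ffunE tr.
move=> i it /negP; case.
have itn l : (i l < n.+1)%N.
  have := it l; rewrite ffunE ltnS tr => h; rewrite -(ler_nat R) (le_trans h)//.
  by have /andP[t0 t1] := ht l; rewrite ler_piMr.
pose g : grid m n := [ffun l => Ordinal (itn l)].
apply/mapP; exists (enum_rank g).
  rewrite mem_enum inE; apply/forallP => l; rewrite enum_rankK ffunE /= -tr.
  by have := it l; rewrite ffunE.
by apply/ffunP => l; rewrite !ffunE enum_rankK ffunE.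
Qed.

Lemma multiple_sum_sub d m n (X : {ffun 'I_m -> nat} -> d.-tuple R) (t t' : m.-tuple R) :
  unit_cube t -> unit_cube t' ->
  multiple_sum X (corner n t) - multiple_sum X (corner n t') =
  lin_sum (set_diff R (grid_box n t) (grid_box n t'))
    [tuple X (grid_point j) | j < #|grid m n|].
Proof.
move=> ht ht'; rewrite !multiple_sum_grid// /lin_sum.
rewrite [X in X - _]big_mkcond [X in _ - X]big_mkcond -sumrB; apply: eq_bigr => j _.
rewrite tnth_mktuple /set_diff scalerBl; congr (_ - _).
  by case: ifP; rewrite ?scale1r ?scale0r.
by case: ifP; rewrite ?scale1r ?scale0r.
Qed.

Lemma multiple_sum_set_corner d m n (X : {ffun 'I_m -> nat} -> d.-tuple R) : (0 < n)%N ->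
  multiple_sum_set n X = (fun t : m.-tuple R => multiple_sum X (corner n t)) @` unit_cube (R := R) (m := m).
Proof.
move=> n0; have nR0 : 0 < n%:R :> R by rewrite ltr0n.
apply/seteqP; split => _ /= [k kn <-].
  exists [tuple (k l)%:R / n%:R | l < m].
    by move=> l; rewrite tnth_mktuple divr_ge0//= ler_pdivrMr// mul1r ler_nat.
  congr multiple_sum; apply/ffunP => l.
  by rewrite ffunE tnth_mktuple mulrC divfK ?gt_eqF// natrK.
exists (corner n k) => // l; rewrite ffunE truncn_le_nat -natr1.
have /andP[t0 t1] := kn l.
by rewrite (@le_lt_trans _ _ n%:R) ?ltrDl// ler_piMr.
Qed.

Lemma powRN_half_exp (m n : nat) :
  (n%:R `^ (- (m%:R / 2)) : R) = (Num.sqrt (n%:R ^+ m))^-1.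
Proof.
by rewrite powRN powRrM powR_mulrn// -powR12_sqrt ?exprn_ge0// div1r.
Qed.

End multiple_sums.

(** * Convergence to Wiener spirals *)

Section convergence.
Context {R : realType} {nu : forall d, probability (d.+1.-tuple R) R} {n : nat -> nat}.
Hypothesis n_gt0 : forall d, (0 < n d)%N.
Hypothesis n_oo : n d @[d --> \oo] --> \oo.
Hypothesis nu_white : forall v, 0 < v -> \forall d \near \oo, white_law (nu d) v.
Hypothesis nu_tail : forall e, 0 < e -> exists2 b : R, 0 <= b &
  forall d, (mean (nu d) (tail_nsq b) <= e%:E)%E.

Lemma n_large N : \forall d \near \oo, (N <= n d)%N.
Proof. exact: (@n_oo [set k | (N <= k)%N] (nbhs_infty_ge N)). Qed.

(** Conditioning on the traces of the class on the sample of indices, which are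
    finitely many and independent of the steps. *)
Theorem set_indexed_convergence (dT : measure_display) (T : measurableType dT)
     (mu : probability T R) (M : set (set T))
     (M_meas : M `<=` measurable) (M_neq0 : M !=set0) (M_VC : VC_class M)
     (M_traces : traces_measurable mu M)
     (dO : nat -> measure_display) (O : forall d, measurableType (dO d))
     (P : forall d, probability (O d) R)
     (X : forall d, nat -> {RV (P d) >-> d.+1.-tuple R})
     (U : forall d, nat -> {RV (P d) >-> T})
     (Xiid : forall d, iid (nu d) (X d))
     (Uiid : forall d, iid mu (U d))
     (XU : forall d, independent_families (X d) (U d))
     (WS : metricType R) (WSP : is_wiener_spiral mu M WS) :
   cvg0_in_prob P (fun d w =>
     GH_dist (scale_set ((n d)%:R `^ (- (1 / 2)))
                (set_indexed_sum_set (n d) (fun j => X d j w)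
                   (fun j => U d j w) M)) (@eucl_dist R d.+1)
             [set: WS] mdist).
Proof.
have [V MV] := VC_traces M_VC.
have [iota [iotaM iotaP]] := WSP.
apply: cvg0_in_prob_of_bound => e eta e0 eta0.
have e20 : 0 < e / 2 by rewrite divr_gt0.
have eta20 : 0 < eta / 2 by rewrite divr_gt0.
have [ei ei0 isoP] := uniform_isometry V e20 eta20.
have [b b0 bP] := nu_tail ei0.
have [N0 [v0 [v00 {}isoP]]] := isoP b b0.
have [N1 llnP] := vc_uniform_lln M_meas MV M_traces (exprn_gt0 2 e20) eta20.
near=> d.
have wd : white_law (nu d) v0 by near: d; exact: nu_white.
have Nn0 : (N0 <= n d)%N by near: d; exact: n_large.
have Nn1 : (N1 <= n d)%N by near: d; exact: n_large.
set N := n d in Nn0 Nn1 *.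
have N_gt0 : (0 < N)%N by exact: n_gt0.
have [BU [mBU PBU goodU]] := llnP N Nn1 N_gt0.
have [F [Z [mF mZ Z0 FZ]]] := traces_version N M_traces.
(* the exceptional set of steps depends on the family; families that are not VC
   never occur as traces and get the empty set *)
have /choice[BX BXP] (G : {set {set 'I_N}}) : exists B, [/\ measurable B,
    (power_prob (nu d) N B <= (eta / 2)%:E)%E &
    VC_at_most V G -> forall t, ~ B t -> {in G &, forall A A',
      `|eucl_norm (lin_sum (set_diff R A A') t) - Num.sqrt (wdist (fun=> 1) A A')|
        <= e / 2 * Num.sqrt N%:R}].
  have [GV|GV] := pselect (VC_at_most V G).
    have [B [mB PB hB]] := isoP d.+1 N (nu d) v0 G wd (lexx _) Nn0 N_gt0 (bP d) GV.
    by exists B.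
  by exists set0; split => //; rewrite measure0 lee_fin ltW.
have mBX G : measurable (BX G) by have [] := BXP G.
pose s : N.-tuple nat := [tuple (j : nat) | j < N].
have us : uniq s.
  by rewrite map_inj_uniq ?enum_uniq//; exact: val_inj.
pose sX := sample (X d) s; pose sU := sample (U d) s.
have msX E : measurable E -> measurable (sX @^-1` E).
  by move=> mE; rewrite -[X in measurable X]setTI; exact: measurable_sample.
have msU E : measurable E -> measurable (sU @^-1` E).
  by move=> mE; rewrite -[X in measurable X]setTI; exact: measurable_sample.
pose BG (G : {set {set 'I_N}}) := (sX @^-1` BX G) `&` (sU @^-1` (F @^-1` [set G])).
have mBG G : measurable (BG G) by apply: measurableI; [exact: msX|exact: msU].
have [mbig Pbig] := measure_bigsetU_le (P d) mBG.
exists (sU @^-1` (BU `|` Z) `|` \big[setU/set0]_G BG G); split.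
- by apply: measurableU => //; apply: msU; exact: measurableU.
- have mBUZ : measurable (BU `|` Z) by exact: measurableU.
  apply: (le_trans (measureU2 _ (msU _ mBUZ) mbig)).
  rewrite (_ : eta%:E = (eta / 2)%:E + (eta / 2)%:E)%E; last first.
    by rewrite -EFinD; congr EFin; lra.
  apply: leeD.
    rewrite [leLHS](sample_law (Uiid d) us mBUZ).
    apply: (le_trans (measureU2 _ mBU mZ)).
    by rewrite [X in (_ + X)%E]Z0 adde0.
  apply: (le_trans Pbig).
  have indep G : P d (BG G) = (power_prob (nu d) N (BX G) * power_prob mu N (F @^-1` [set G]))%E.
    rewrite XU; [|exact: sigma_of_sample|exact: sigma_of_sample].
    by congr (_ * _)%E; [exact: (sample_law (Xiid d) us)|exact: (sample_law (Uiid d) us)].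
  have one : (\sum_G power_prob mu N (F @^-1` [set G]) = 1)%E.
    transitivity (mean (power_prob mu N) (fun t => \sum_G \1_(F @^-1` [set G]) t)).
      rewrite mean_sum//; last by move=> G; exact: measurable_indic.
      by apply: eq_bigr => G _; rewrite /mean integral_indic// setIT.
    rewrite -[RHS](mean_cst (power_prob mu N) 1); apply: eq_mean => t.
    rewrite (bigD1 (F t))//= indicE mem_set// big1 ?addr0// => G GF.
    by rewrite indicE memNset//= => FG; rewrite FG eqxx in GF.
  rewrite -[leRHS]mule1 -one ge0_sume_distrr//.
  apply: lee_sum => G _; rewrite indep.
  by apply: lee_wpmul2r => //; have [] := BXP G.
move=> w /not_orP[/not_orP[nBU nZ] nBG].
set u := sU w in nBU nZ *; set x := sX w.
have uE : [tuple U d j w | j < N] = u by apply: eq_from_tnth => j; rewrite !tnth_mktuple.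
have xE : [tuple X d j w | j < N] = x by apply: eq_from_tnth => j; rewrite !tnth_mktuple.
have Fu : F u = traces M u by exact: FZ.
have nBX : ~ BX (F u) x.
  by move=> Bx; apply: nBG; rewrite -bigcup_seq; exists (F u) => //=; rewrite mem_index_enum.
have [_ _ isoG] := BXP (F u).
have {}isoG := isoG _ x nBX; rewrite Fu in isoG.
have {}isoG := isoG (@MV N u).
pose c : R := N%:R `^ (- (1 / 2)).
have rt0 : 0 < Num.sqrt N%:R :> R by rewrite sqrtr_gt0 ltr0n.
have cE : c = (Num.sqrt N%:R)^-1 by exact: powRN_half.
have c0 : 0 <= c by rewrite cE invr_ge0 ltW.
pose f A := c *: set_indexed_sum N (fun j => X d j w) (fun j => U d j w) A.
rewrite (_ : scale_set _ _ = f @` M); last by rewrite /scale_set /set_indexed_sum_set image_comp.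
rewrite -iotaM.
apply: GH_dist_le_distortion => //.
- by move=> y _; exact: eucl_distxx.
- by move=> y z _ _; exact: eucl_distC.
- by move=> y z t _ _ _; exact: eucl_dist_triangle.
- by move=> y _; exact: mdistxx.
- by move=> y z _ _; exact: metric_sym.
- by move=> y z t _ _ _; exact: metric_triangle.
move=> A A' MA MA'; rewrite iotaP// /f eucl_dist_scale// set_indexed_sum_sub uE xE cE.
rewrite [leRHS](_ : _ = e / 2 + e / 2); last by lra.
apply: (spiral_distortion (cnt := wdist (fun=> 1) (trace u A) (trace u A'))) => //.
- exact: eucl_norm_ge0.
- exact: wdist_ge0.
- exact: fine_ge0.
- exact: ltW.
- exact: ltW.
- by apply: isoG; exact: trace_in_traces.
rewrite sqr_sqrtr ?ler0n//; exact: goodU.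
Unshelve. all: by end_near. Qed.

(** The steps are indexed by the (n + 1)^m points of the grid, the boxes by the
    points t of the unit cube: n t rounded down gives the corner of the multiple
    sum, and t that of the box of the spiral. *)
Theorem multiple_sum_convergence (m : nat) (m_gt0 : (0 < m)%N)
     (dO : nat -> measure_display) (O : forall d, measurableType (dO d))
     (P : forall d, probability (O d) R)
     (X : forall d, {ffun 'I_m -> nat} -> {RV (P d) >-> d.+1.-tuple R})
     (Xiid : forall d, iid (nu d) (X d))
     (WS : metricType R)
     (WSP : is_wiener_spiral (lebesgue_cube R m) (corner_boxes R m) WS) :
   cvg0_in_prob P (fun d w =>
     GH_dist (scale_set ((n d)%:R `^ (- (m%:R / 2)))
                (multiple_sum_set (n d) (fun k => X d k w))) (@eucl_dist R d.+1)
             [set: WS] mdist).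
Proof.
have [iota [iotaM iotaP]] := WSP.
apply: cvg0_in_prob_of_bound => e eta e0 eta0.
have e20 : 0 < e / 2 by rewrite divr_gt0.
have c20 : 0 < 2 ^+ m :> R by rewrite exprn_gt0.
have r0 : 0 < e / 2 / 2 ^+ m by rewrite divr_gt0.
have [ei ei0 isoP] := uniform_isometry m r0 eta0.
have [b b0 bP] := nu_tail ei0.
have [N0 [v0 [v00 {}isoP]]] := isoP b b0.
pose N1 := Num.bound (4 * 2 ^+ m / (e / 2) ^+ 2).
near=> d.
have wd : white_law (nu d) v0 by near: d; exact: nu_white.
have Nn0 : (N0 <= n d)%N by near: d; exact: n_large.
have Nn1 : (N1 <= n d)%N by near: d; exact: n_large.
have nd0 := n_gt0 d; have nR0 : 0 < (n d)%:R :> R by rewrite ltr0n.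
set N := #|grid m (n d)|.
have NE : N = ((n d).+1 ^ m)%N by rewrite /N card_ffun !card_ord.
have nN : (n d <= N)%N.
  rewrite NE -[m]prednK// expnS (leq_trans (leqnSn _))// leq_pmulr// expn_gt0.
  by [].
pose F : {set {set 'I_N}} :=
  [set A | `[< exists2 t : m.-tuple R, unit_cube t & A = grid_box (n d) t >]]%SET.
have FV : VC_at_most m F.
  apply: (@VC_grid_boxes R) => A; rewrite inE => /asboolP[t _ ->]; by exists t.
have [B [mB PB isoB]] := isoP d.+1 N (nu d) v0 F wd (lexx _) (leq_trans Nn0 nN)
  (leq_trans nd0 nN) (bP d) FV.
pose s : N.-tuple {ffun 'I_m -> nat} := [tuple grid_point j | j < N].
have us : uniq s by rewrite map_inj_uniq ?enum_uniq//; exact: grid_point_inj.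
pose sX := sample (X d) s.
exists (sX @^-1` B); split.
- by rewrite -[X in measurable X]setTI; exact: measurable_sample.
- by rewrite [leLHS](sample_law (Xiid d) us mB).
move=> w nBw; set x := sX w in nBw.
have xE : [tuple X d (grid_point j) w | j < N] = x.
  by apply: eq_from_tnth => j; rewrite !tnth_mktuple.
pose q : R := Num.sqrt ((n d)%:R ^+ m).
have q0 : 0 < q by rewrite sqrtr_gt0 exprn_gt0.
have q2 : q ^+ 2 = (n d)%:R ^+ m by rewrite sqr_sqrtr// exprn_ge0.
pose c : R := (n d)%:R `^ (- (m%:R / 2)).
have cE : c = q^-1 by exact: powRN_half_exp.
have c0 : 0 <= c by rewrite cE invr_ge0 ltW.
pose f (t : m.-tuple R) := c *: multiple_sum (fun k => X d k w) (corner (n d) t).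
rewrite (_ : scale_set _ _ = f @` unit_cube (R := R) (m := m)); last first.
  by rewrite /scale_set multiple_sum_set_corner// image_comp.
rewrite (_ : [set: WS] = (iota \o @corner_box R m) @` unit_cube (R := R) (m := m)); last first.
  by rewrite -iotaM /corner_boxes image_comp.
have box_mem t : unit_cube t -> corner_boxes R m (corner_box t) by move=> ht; exists t.
apply: GH_dist_le_distortion => //.
- by exists [tuple 0 | l < m] => l; rewrite tnth_mktuple lexx ler01.
- by move=> y _; exact: eucl_distxx.
- by move=> y z _ _; exact: eucl_distC.
- by move=> y z t _ _ _; exact: eucl_dist_triangle.
- by move=> y _; exact: mdistxx.
- by move=> y z _ _; exact: metric_sym.
- by move=> y z t _ _ _; exact: metric_triangle.
move=> t t' ht ht'; rewrite /= iotaP; [|exact: box_mem|exact: box_mem].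
rewrite /f eucl_dist_scale// multiple_sum_sub// xE cE.
rewrite [leRHS](_ : _ = e / 2 + e / 2); last by lra.
apply: (spiral_distortion (cnt := wdist (fun=> 1) (grid_box (n d) t) (grid_box (n d) t'))) => //.
- exact: eucl_norm_ge0.
- exact: wdist_ge0.
- exact: fine_ge0.
- exact: ltW.
- exact: ltW.
- apply: (le_trans (isoB _ nBw _ _ _ _)).
  + by rewrite inE; apply/asboolP; exists t.
  + by rewrite inE; apply/asboolP; exists t'.
  rewrite mulrAC -mulrA ler_wpM2l ?(ltW e20)// ler_pdivrMr//.
  rewrite -(@ler_pXn2r _ 2) ?nnegrE ?sqrtr_ge0 ?mulr_ge0 ?(ltW q0) ?(ltW c20)//.
  have e4 : (2 ^+ m) ^+ 2 = 4 ^+ m :> R.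
    by rewrite -exprM mulnC exprM; congr (_ ^+ _); rewrite expr2; ring.
  rewrite exprMn q2 sqr_sqrtr// NE natrX e4 -exprMn lerXn2r ?nnegrE ?mulr_ge0// -natr1.
  have : 1 <= (n d)%:R :> R by rewrite ler1n.
  lra.
rewrite q2; apply: (le_trans (grid_box_symdiff ht ht' nd0)).
have : 4 * 2 ^+ m / (e / 2) ^+ 2 <= (n d)%:R.
  apply: (@le_trans _ _ N1%:R); last by rewrite ler_nat.
  by rewrite ltW// archi_boundP// divr_ge0 ?sqr_ge0 ?mulr_ge0// ltW.
rewrite ler_pdivrMr ?exprn_gt0// => h.
have -> : 4 * (2 ^+ m * (n d)%:R ^+ m / (n d)%:R) = 4 * 2 ^+ m * (n d)%:R ^+ m / (n d)%:R :> R.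
  by rewrite !mulrA.
rewrite ler_pdivrMr//.
have -> : (n d)%:R ^+ m * (e / 2) ^+ 2 * (n d)%:R = (n d)%:R * (e / 2) ^+ 2 * (n d)%:R ^+ m :> R.
  by ring.
by rewrite ler_wpM2r ?exprn_ge0// (mulrC (n d)%:R).
Unshelve. all: by end_near. Qed.

End convergence.

(** The index [d : nat] stands for the dimension [d.+1]. *)
Theorem theorem1 (R : realType)
  (d0 : nat -> measure_display) (O0 : forall d, measurableType (d0 d))
  (P0 : forall d, probability (O0 d) R)
  (X0 : forall d, {RV (P0 d) >-> d.+1.-tuple R})
  (n : nat -> nat) (n_gt0 : forall d, (0 < n d)%N)
  (n_oo : n d @[d --> \oo] --> \oo)
  (Xmean : forall d (a : 'I_d.+1),
    'E_(P0 d)[(fun w => tnth (X0 d w) a)%R]%E = 0%E)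
  (Xnorm : forall d, 'E_(P0 d)[(fun w => eucl_norm (vec (X0 d w)) ^+ 2)%R]%E = 1%E)
  (Xuncor : forall d (a a' : 'I_d.+1), a != a' ->
    'E_(P0 d)[(fun w => tnth (X0 d w) a * tnth (X0 d w) a')%R]%E = 0%E)
  (Xui : ereal_sup (range (fun d =>
      'E_(P0 d)[(fun w => eucl_norm (vec (X0 d w)) ^+ 2 *
                          \1_[set v | c < eucl_norm (vec (X0 d v)) ^+ 2] w)%R]%E))
    @[c --> +oo%R] --> 0%E)
  (Xneg : \big[maxe/0%E]_(a < d.+1) 'E_(P0 d)[(fun w => tnth (X0 d w) a ^+ 2)%R]%E
    @[d --> \oo] --> 0%E) :
  (forall (m : nat) (m_gt0 : (0 < m)%N)
     (dO : nat -> measure_display) (O : forall d, measurableType (dO d))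
     (P : forall d, probability (O d) R)
     (X : forall d, {ffun 'I_m -> nat} -> {RV (P d) >-> d.+1.-tuple R})
     (Xiid : forall d, iid (distribution (P0 d) (X0 d)) (X d))
     (WS : metricType R)
     (WSP : is_wiener_spiral (lebesgue_cube R m) (corner_boxes R m) WS),
   cvg0_in_prob P (fun d w =>
     GH_dist (scale_set ((n d)%:R `^ (- (m%:R / 2)))
                (multiple_sum_set (n d) (fun k => X d k w))) (@eucl_dist R d.+1)
             [set: WS] mdist))
  /\
  (forall (dT : measure_display) (T : measurableType dT)
     (mu : probability T R) (M : set (set T))
     (M_meas : M `<=` measurable) (M_neq0 : M !=set0) (M_VC : VC_class M)
     (M_traces : traces_measurable mu M)
     (dO : nat -> measure_display) (O : forall d, measurableType (dO d))
     (P : forall d, probability (O d) R)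
     (X : forall d, nat -> {RV (P d) >-> d.+1.-tuple R})
     (U : forall d, nat -> {RV (P d) >-> T})
     (Xiid : forall d, iid (distribution (P0 d) (X0 d)) (X d))
     (Uiid : forall d, iid mu (U d))
     (XU : forall d, independent_families (X d) (U d))
     (WS : metricType R) (WSP : is_wiener_spiral mu M WS),
   cvg0_in_prob P (fun d w =>
     GH_dist (scale_set ((n d)%:R `^ (- (1 / 2)))
                (set_indexed_sum_set (n d) (fun j => X d j w)
                   (fun j => U d j w) M)) (@eucl_dist R d.+1)
             [set: WS] mdist)).
Proof.
split.
  move=> m m_gt0 dO O P X Xiid WS WSP.
  apply: (multiple_sum_convergence n_gt0 n_oo (white_law_near Xmean Xnorm Xuncor Xneg)
    (uniform_tail Xui) m_gt0 Xiid WSP).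
move=> dT T mu M M_meas M_neq0 M_VC M_traces dO O P X U Xiid Uiid XU WS WSP.
apply: (set_indexed_convergence n_gt0 n_oo (white_law_near Xmean Xnorm Xuncor Xneg)
  (uniform_tail Xui) M_meas M_neq0 M_VC M_traces Xiid Uiid XU WSP).
Qed.
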